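(* Let $0\le r<n$, let $\underline{d}=(d_1,\dots,d_n)$ be a sequence of positive integers, and fix nonnegative integers $p,q$ and $b_{r+1},\dots,b_n$ such that the inequality $b_j<d_j$ holds for at least one value of $j\in\{r+1,\dots,n\}$. For integers $b_1,\dots,b_r$ let $N_i=(p+q)d_i+b_i$. Then there exist a finite number of $n$-tuples of partitions $\lambda=(\lambda^1,\dots,\lambda^n)$ and corresponding multiplicities $m_\lambda$ such that the decomposition $$K_{p,q}^{\underline{d}}(b_1,\dots,b_r,b_{r+1},\dots,b_n)=\bigoplus_{\lambda} \left(S_{\lambda^1[N_1]}\otimes\cdots\otimes S_{\lambda^r[N_r]}\otimes S_{\lambda^{r+1}}\otimes\cdots\otimes S_{\lambda^n}\right)^{\oplus m_{\lambda}}$$ holds independently of $b_1,\dots,b_r$ (that is, with the same $\lambda$'s and the same $m_\lambda$'s) as long as $b_i\geq (p+q)d_i$ for $i=1,\dots,r$.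
   Context: All vector spaces are finite dimensional over a field $\mathbb{K}$ of characteristic zero; $\mathrm{Vec}$ is the category of such vector spaces. $S_\delta$ denotes the Schur functor of the partition $\delta$. For a partition $\delta=(\delta_1,\delta_2,\dots)$ of $s$ and an integer $m$, $\delta[m]$ denotes $(m-s,\delta_1,\delta_2,\dots)$; by convention $S_{\delta[m]}$ is identically zero when $m-s<\delta_1$. Koszul cohomology: if $X\subset\mathbb{P}W$ is a projective variety embedded by the complete linear series of a line bundle $\mathcal{L}$ (so $W=H^0(X,\mathcal{L})$) and $\mathcal{B}$ is a sheaf on $X$, then $K_{p,q}(X,\mathcal{B};\mathcal{L})$ is the homology at the middle of the Koszul complex $$\bigwedge^{p+1}W\otimes H^0(X,\mathcal{B}\otimes\mathcal{L}^{q-1})\to\bigwedge^{p}W\otimes H^0(X,\mathcal{B}\otimes\mathcal{L}^{q})\to\bigwedge^{p-1}W\otimes H^0(X,\mathcal{B}\otimes\mathcal{L}^{q+1}).$$ For $\underline{b}=(b_1,\dots,b_n)\in\mathbb{Z}^n$, $K_{p,q}^{\underline{d}}(\underline{b}):\mathrm{Vec}^n\to\mathrm{Vec}$ is the functor sending $(V_1,\dots,V_n)$ to $K_{p,q}(X,\mathcal{B}_{\underline b};\mathcal{L})$ with $X=\mathbb{P}V_1\times\cdots\times\mathbb{P}V_n$, $\mathcal{L}=\mathcal{O}(d_1,\dots,d_n)$, $\mathcal{B}_{\underline b}=\mathcal{O}(b_1,\dots,b_n)$. The convention for projective space is $H^0(\mathbb{P}V,\mathcal{O}(d))=\mathrm{Sym}^dV$.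 *)

(* Defs.v *)
From HB Require Import structures.
From mathcomp Require Import all_boot all_order all_algebra all_fingroup.

Set Implicit Arguments.
Unset Strict Implicit.
Unset Printing Implicit Defensive.

Import GRing.Theory.

Local Open Scope ring_scope.

Section DependentDistributivity.

Variables (R : comNzRingType) (I : finType) (T : I -> finType).

Lemma big_dffun_distr (F : forall i, T i -> R) :
  \prod_i \sum_(j : T i) F i j =
  \sum_(t : {dffun forall i, T i}) \prod_i F i (t i).
Proof.
pose P i := [ffun j : T i => F i j].
have -> : \prod_i \sum_(j : T i) F i j = \prod_i \sum_j P i j.
  by apply: eq_bigr => i _; apply: eq_bigr => j _; rewrite ffunE.
under eq_bigr => i _ do rewrite (big_tag (op := +%R) (fun i => P i) i).
rewrite bigA_distr_big_dep.
have := @big_fprod R 0 1 *%R +%R I T P => /= <-.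
rewrite (reindex (@fprod_of_dffun _ T)) /=; last exact/onW_bij/fprod_of_dffun_bij.
by apply: eq_bigr => t _; apply: eq_bigr => i _; rewrite ffunE fprodE.
Qed.

End DependentDistributivity.

Section Tensors.

Variable K : fieldType.
Implicit Types A B C D V W : vectType K.

(* Tensor products are carried by arrays of coordinates in the bases          *)
(* [vbasis {:V}]. Maps out of them are given by their values on basis tensors *)
(* through [linfun], which is only meaningful on functions that are linear;   *)
(* the lemmas [*E] give the basis-free values on arbitrary pure tensors, and  *)
(* the lemmas [*_ext] say that these values determine a map.                  *)

Definition bvec V (i : 'I_(\dim {:V})) : V := (vbasis {:V})`_i.
Definition bcoord V (i : 'I_(\dim {:V})) (v : V) : K := coord (vbasis {:V}) i v.

Lemma linfunE V W (f : V -> W) : linear f -> linfun f =1 f.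
Proof.
move=> linf; pose fB := GRing.isSemilinear.Build K V W _ f
  (GRing.semilinear_linear linf).
by pose g : {linear V -> W} := HB.pack f fB; apply: (lfunE g).
Qed.

Lemma bcoord_sum V (v : V) : v = \sum_i bcoord i v *: bvec i.
Proof. exact: (coord_vbasis (memvf v)). Qed.

Lemma bcoord_bvec V (i j : 'I_(\dim {:V})) : bcoord i (bvec j) = (i == j)%:R.
Proof. by rewrite eq_sym /bcoord /bvec coord_free ?(basis_free (vbasisP _)). Qed.

Lemma bcoord_inj V (u v : V) : (forall i, bcoord i u = bcoord i v) -> u = v.
Proof.
by move=> e; rewrite [u]bcoord_sum [v]bcoord_sum; apply: eq_bigr => i _; rewrite e.
Qed.

Lemma bcoordD V (i : 'I_(\dim {:V})) a u v :
  bcoord i (a *: u + v) = a * bcoord i u + bcoord i v.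
Proof. by rewrite /bcoord linearP. Qed.

Lemma bcoordZ V (i : 'I_(\dim {:V})) a v : bcoord i (a *: v) = a * bcoord i v.
Proof. by rewrite /bcoord linearZ. Qed.

Lemma bcoord_sumr V (i : 'I_(\dim {:V})) (J : finType) (F : J -> V) :
  bcoord i (\sum_j F j) = \sum_j bcoord i (F j).
Proof. by rewrite /bcoord linear_sum. Qed.

Lemma bcoord_lfun V W (f : 'Hom(V, W)) j (v : V) :
  bcoord j (f v) = \sum_i bcoord i v * bcoord j (f (bvec i)).
Proof.
rewrite {1}[v]bcoord_sum linear_sum bcoord_sumr; apply: eq_bigr => i _.
by rewrite linearZ bcoordZ.
Qed.

Definition tensor A B : vectType K := 'M[K]_(\dim {:A}, \dim {:B}).

Definition tpure A B (a : A) (b : B) : tensor A B :=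
  \matrix_(i, j) (bcoord i a * bcoord j b).

Definition tensor_lift A B C (beta : A -> B -> C) : 'Hom(tensor A B, C) :=
  linfun (fun x : tensor A B => \sum_i \sum_j x i j *: beta (bvec i) (bvec j)).

Lemma tensor_lift_subproof A B C (beta : A -> B -> C) :
  linear (fun x : tensor A B => \sum_i \sum_j x i j *: beta (bvec i) (bvec j)).
Proof.
move=> a x y; rewrite scaler_sumr -big_split /=; apply: eq_bigr => i _.
rewrite scaler_sumr -big_split /=; apply: eq_bigr => j _.
by rewrite !mxE scalerDl scalerA.
Qed.

Lemma tensor_liftE A B C (beta : A -> B -> C) a b :
  (forall y, linear (beta^~ y)) -> (forall x, linear (beta x)) ->
  tensor_lift beta (tpure a b) = beta a b.
Proof.
move=> linl linr; rewrite /tensor_lift linfunE; last exact: tensor_lift_subproof.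
have sumB x (J : finType) (k : J -> K) (v : J -> B) :
    beta x (\sum_j k j *: v j) = \sum_j k j *: beta x (v j).
  rewrite -(linfunE (linr x)) linear_sum.
  by apply: eq_bigr => j _; rewrite linearZ /= (linfunE (linr x)).
have sumA y (J : finType) (k : J -> K) (v : J -> A) :
    beta (\sum_j k j *: v j) y = \sum_j k j *: beta (v j) y.
  rewrite -(linfunE (linl y)) linear_sum.
  by apply: eq_bigr => j _; rewrite linearZ /= (linfunE (linl y)).
rewrite {2}[a]bcoord_sum sumA; apply: eq_bigr => i _.
rewrite {2}[b]bcoord_sum sumB scaler_sumr; apply: eq_bigr => j _.
by rewrite mxE scalerA.
Qed.

Lemma tensor_sum A B (x : tensor A B) :
  x = \sum_i \sum_j x i j *: tpure (bvec i) (bvec j).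
Proof.
apply/matrixP => k l; rewrite summxE (bigD1 k) //= summxE (bigD1 l) //=.
rewrite !mxE !bcoord_bvec !eqxx !mulr1 !big1 ?addr0 // => [i ik|j jl].
  rewrite summxE big1 // => j _.
  by rewrite !mxE !bcoord_bvec (eq_sym k) (negPf ik) mul0r mulr0.
by rewrite !mxE !bcoord_bvec (eq_sym l) (negPf jl) !mulr0.
Qed.

Lemma tensor_ext A B C (f g : 'Hom(tensor A B, C)) :
  (forall a b, f (tpure a b) = g (tpure a b)) -> f = g.
Proof.
move=> e; apply/lfunP => x; rewrite [x]tensor_sum !linear_sum.
apply: eq_bigr => i _; rewrite !linear_sum; apply: eq_bigr => j _.
by rewrite !linearZ /= e.
Qed.

Lemma tpure_linl A B (b : B) : linear (fun a : A => tpure a b).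
Proof. by move=> k u v; apply/matrixP => i j; rewrite !mxE bcoordD mulrDl -mulrA. Qed.

Lemma tpure_linr A B (a : A) : linear (fun b : B => tpure a b).
Proof. by move=> k u v; apply/matrixP => i j; rewrite !mxE bcoordD mulrDr mulrCA. Qed.

Definition tensor_map A B C D (f : 'Hom(A, C)) (g : 'Hom(B, D)) :
  'Hom(tensor A B, tensor C D) := tensor_lift (fun a b => tpure (f a) (g b)).

Lemma tensor_mapE A B C D (f : 'Hom(A, C)) (g : 'Hom(B, D)) a b :
  tensor_map f g (tpure a b) = tpure (f a) (g b).
Proof.
by rewrite /tensor_map tensor_liftE // => [y|x] k u v; rewrite linearP ?tpure_linl ?tpure_linr.
Qed.

Lemma tensor_map_id A B : tensor_map \1 \1 = \1%VF :> 'End(tensor A B).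
Proof. by apply: tensor_ext => a b; rewrite tensor_mapE !id_lfunE. Qed.

Lemma tensor_map_comp A B C D A' B' (f : 'Hom(A, C)) (g : 'Hom(B, D))
    (f' : 'Hom(C, A')) (g' : 'Hom(D, B')) :
  tensor_map (f' \o f) (g' \o g) = (tensor_map f' g' \o tensor_map f g)%VF.
Proof. by apply: tensor_ext => a b; rewrite comp_lfunE !tensor_mapE !comp_lfunE. Qed.

Section FamilyTensors.

Variable I : finType.
Implicit Types E F G : I -> vectType K.

Definition bigtensor E : vectType K :=
  {ffun {dffun forall i, 'I_(\dim {:E i})} -> K^o}.

Definition pure E (v : forall i, E i) : bigtensor E :=
  [ffun s : {dffun forall i, 'I_(\dim {:E i})} => \prod_i bcoord (s i) (v i)].

Definition bigtensor_map E F (f : forall i, 'Hom(E i, F i)) :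
    'Hom(bigtensor E, bigtensor F) :=
  linfun (fun x : bigtensor E => \sum_s x s *: pure (fun i => f i (bvec (s i)))).

Lemma bigtensor_map_subproof E F (f : forall i, 'Hom(E i, F i)) :
  linear (fun x : bigtensor E => \sum_s x s *: pure (fun i => f i (bvec (s i)))).
Proof.
move=> a x y; rewrite scaler_sumr -big_split /=; apply: eq_bigr => i _.
by rewrite !ffunE scalerDl scalerA.
Qed.

Lemma eq_pure E (u v : forall i, E i) : (forall i, u i = v i) -> pure u = pure v.
Proof.
by move=> e; apply/ffunP => s; rewrite !ffunE; apply: eq_bigr => i _; rewrite e.
Qed.

Lemma bigtensor_mapE E F (f : forall i, 'Hom(E i, F i)) v :
  bigtensor_map f (pure v) = pure (fun i => f i (v i)).
Proof.
rewrite /bigtensor_map linfunE; last exact: bigtensor_map_subproof.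
apply/ffunP => t; rewrite sum_ffunE ffunE.
under [RHS]eq_bigr => i _ do rewrite bcoord_lfun.
rewrite big_dffun_distr; apply: eq_bigr => s _.
by rewrite !ffunE -[_ *: _]/(_ * _) -big_split.
Qed.

Lemma bigtensor_sum E (x : bigtensor E) :
  x = \sum_s x s *: pure (fun i => bvec (s i)).
Proof.
apply/ffunP => t; rewrite sum_ffunE (bigD1 t) //= !ffunE.
rewrite big1 => [|i _]; last by rewrite bcoord_bvec eqxx.
rewrite [_ *: _]mulr1 big1 ?addr0 // => s st; rewrite !ffunE.
have : ~~ [forall i, s i == t i].
  apply: contra st => /forallP e; apply/eqP; apply/ffunP => i; exact/eqP/e.
case/forallPn=> i si.
by rewrite (bigD1 i) //= bcoord_bvec eq_sym (negPf si) mul0r [_ *: _]mulr0.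
Qed.

Lemma bigtensor_ext E C (f g : 'Hom(bigtensor E, C)) :
  (forall v, f (pure v) = g (pure v)) -> f = g.
Proof.
move=> e; apply/lfunP => x; rewrite [x]bigtensor_sum !linear_sum.
by apply: eq_bigr => s _; rewrite !linearZ /= e.
Qed.

Lemma eq_bigtensor_map E F (f g : forall i, 'Hom(E i, F i)) :
  (forall i, f i = g i) -> bigtensor_map f = bigtensor_map g.
Proof.
move=> e; apply: bigtensor_ext => v; rewrite !bigtensor_mapE.
by apply: eq_pure => i; rewrite e.
Qed.

Lemma bigtensor_map_id E (f : forall i, 'End(E i)) :
  (forall i, f i = \1%VF) -> bigtensor_map f = \1%VF.
Proof.
move=> e; apply: bigtensor_ext => v; rewrite bigtensor_mapE id_lfunE.
by apply: eq_pure => i; rewrite e id_lfunE.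
Qed.

Lemma bigtensor_map_comp E F G (f : forall i, 'Hom(E i, F i))
    (g : forall i, 'Hom(F i, G i)) (h : forall i, 'Hom(E i, G i)) :
  (forall i, h i = (g i \o f i)%VF) ->
  bigtensor_map h = (bigtensor_map g \o bigtensor_map f)%VF.
Proof.
move=> e; apply: bigtensor_ext => v; rewrite comp_lfunE !bigtensor_mapE.
by apply: eq_pure => i; rewrite e comp_lfunE.
Qed.

Definition bigtensor_mul E F G (m : forall i, 'Hom(tensor (E i) (F i), G i)) :
    'Hom(tensor (bigtensor E) (bigtensor F), bigtensor G) :=
  tensor_lift (fun (x : bigtensor E) (y : bigtensor F) =>
    \sum_s \sum_t (x s * y t) *:
      pure (fun i => m i (tpure (bvec (s i)) (bvec (t i))))).

Lemma bigtensor_mulE E F G (m : forall i, 'Hom(tensor (E i) (F i), G i)) u v :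
  bigtensor_mul m (tpure (pure u) (pure v)) =
  pure (fun i => m i (tpure (u i) (v i))).
Proof.
rewrite /bigtensor_mul tensor_liftE.
- apply/ffunP => r; rewrite sum_ffunE ffunE.
  under [LHS]eq_bigr => s _.
    rewrite sum_ffunE.
    under eq_bigr => t _ do
      rewrite !ffunE -[_ *: _]/(_ * _) -!big_split /=.
    rewrite -(big_dffun_distr (fun i j => bcoord (s i) (u i) * bcoord j (v i) *
      bcoord (r i) (m i (tpure (bvec (s i)) (bvec j))))).
    over.
  rewrite -(big_dffun_distr (fun i k => \sum_j bcoord k (u i) * bcoord j (v i) *
      bcoord (r i) (m i (tpure (bvec k) (bvec j))))).
  apply: eq_bigr => i _; rewrite [tpure (u i) _]tensor_sum !linear_sum.
  rewrite bcoord_sumr.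
  apply: eq_bigr => k _; rewrite !linear_sum bcoord_sumr.
  by apply: eq_bigr => j _; rewrite mxE linearZ bcoordZ.
- move=> y k a b; rewrite scaler_sumr -big_split /=; apply: eq_bigr => s _.
  rewrite scaler_sumr -big_split /=; apply: eq_bigr => t _.
  by rewrite scalerA -scalerDl !ffunE mulrDl mulrA.
- move=> x k a b; rewrite scaler_sumr -big_split /=; apply: eq_bigr => s _.
  rewrite scaler_sumr -big_split /=; apply: eq_bigr => t _.
  by rewrite scalerA -scalerDl !ffunE mulrDr mulrCA.
Qed.

End FamilyTensors.

End Tensors.

Section Quotients.

Variable K : fieldType.
Implicit Types V W : vectType K.

(* V / U, carried by the complement U^C that the library chooses; [quot_pi]   *)
(* is the projection V -> V / U and [quot_repr] a linear section of it.       *)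
Definition quot V (U : {vspace V}) : vectType K := subvs_of (U^C)%VS.

Definition quot_pi V (U : {vspace V}) : 'Hom(V, quot U) :=
  linfun (vsproj (U^C)%VS \o (\1 - projv U)%VF).

Definition quot_repr V (U : {vspace V}) : 'Hom(quot U, V) := linfun vsval.

Lemma quot_piE V (U : {vspace V}) v :
  quot_repr U (quot_pi U v) = v - projv U v.
Proof.
rewrite /quot_repr /quot_pi !lfunE /= add_lfunE opp_lfunE id_lfunE.
by rewrite vsprojK ?memv_projC.
Qed.

Lemma quot_repr_inj V (U : {vspace V}) : injective (quot_repr U).
Proof. by move=> x y; rewrite /quot_repr !lfunE; apply: subvs_inj. Qed.

Lemma quot_pi_eq0 V (U : {vspace V}) v : (quot_pi U v == 0) = (v \in U).
Proof.
rewrite -(inj_eq (@quot_repr_inj _ U)) quot_piE linear0 subr_eq0.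
by apply/eqP/idP => [->|/projv_id->//]; apply: memv_proj.
Qed.

Lemma quot_piP V (U : {vspace V}) u v :
  reflect (quot_pi U u = quot_pi U v) (u - v \in U).
Proof. by rewrite -quot_pi_eq0 linearB subr_eq0; apply: eqP. Qed.

Lemma quot_reprK V (U : {vspace V}) x : quot_pi U (quot_repr U x) = x.
Proof.
apply: quot_repr_inj; rewrite quot_piE; apply/eqP.
rewrite -subr_eq0 addrAC subrr add0r oppr_eq0 -memv_ker lker_proj.
by rewrite /quot_repr lfunE subvsP.
Qed.

Definition quot_map V W (U : {vspace V}) (U' : {vspace W}) (f : 'Hom(V, W)) :
  'Hom(quot U, quot U') := (quot_pi U' \o (f \o quot_repr U))%VF.

Lemma quot_mapE V W (U : {vspace V}) (U' : {vspace W}) (f : 'Hom(V, W)) v :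
  (f @: U <= U')%VS -> quot_map U U' f (quot_pi U v) = quot_pi U' (f v).
Proof.
move=> /subvP fU; rewrite /quot_map !comp_lfunE quot_piE; apply/quot_piP.
by rewrite -linearB addrAC subrr add0r linearN memvN fU ?memv_img ?memv_proj.
Qed.

(* Z / (B :&: Z), the usual Z / B when B is contained in Z.                   *)
Definition subquot V (Z B : {vspace V}) : vectType K :=
  quot (linfun (vsval : subvs_of Z -> V) @^-1: B)%VS.

Definition subquot_class V (Z B : {vspace V}) : 'Hom(V, subquot Z B) :=
  linfun (quot_pi _ \o vsproj Z).

Lemma subquot_classE V (Z B : {vspace V}) v :
  subquot_class Z B v = quot_pi _ (vsproj Z v).
Proof. exact: lfunE. Qed.

Definition subquot_map V W (Z B : {vspace V}) (Z' B' : {vspace W})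
    (f : 'Hom(V, W)) : 'Hom(subquot Z B, subquot Z' B') :=
  (subquot_class Z' B' \o (f \o linfun (vsval \o quot_repr _)%FUN))%VF.

Lemma subquot_class_surj V (Z B : {vspace V}) (x : subquot Z B) :
  exists2 z, z \in Z & x = subquot_class Z B z.
Proof.
exists (vsval (quot_repr _ x)); first exact: subvsP.
by rewrite subquot_classE vsvalK quot_reprK.
Qed.

Lemma subquot_class_eq0 V (Z B : {vspace V}) z :
  z \in Z -> (subquot_class Z B z == 0) = (z \in B).
Proof.
move=> Zz; rewrite subquot_classE quot_pi_eq0.
by rewrite -memv_preim lfunE /= vsprojK.
Qed.

Lemma subquot_map_repr V W (Z B : {vspace V}) (Z' B' : {vspace W})
    (f : 'Hom(V, W)) x :
  subquot_map Z B Z' B' f x = subquot_class Z' B' (f (vsval (quot_repr _ x))).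
Proof.
rewrite /subquot_map 2!comp_lfunE; congr (subquot_class _ _ (f _)).
exact: lfunE.
Qed.

Lemma subquot_mapE V W (Z B : {vspace V}) (Z' B' : {vspace W})
    (f : 'Hom(V, W)) z :
  (f @: Z <= Z')%VS -> (f @: B <= B')%VS -> z \in Z ->
  subquot_map Z B Z' B' f (subquot_class Z B z) = subquot_class Z' B' (f z).
Proof.
move=> /subvP fZ /subvP fB Zz; apply/eqP; rewrite -subr_eq0.
rewrite subquot_map_repr -!linearB /=.
set y := quot_repr _ _; have Zy : vsval y \in Z by apply: subvsP.
have Zyz : vsval y - z \in Z by rewrite memvB.
rewrite subquot_class_eq0 ?fZ ?memv_img //; apply/fB/memv_img.
rewrite -(subquot_class_eq0 B Zyz) linearB /= subr_eq0; apply/eqP.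
by rewrite [LHS]subquot_classE vsvalK quot_reprK.
Qed.

End Quotients.

Section TensorPowers.

Variable K : fieldType.
Implicit Types V W X : vectType K.

Definition tpower k V : vectType K := bigtensor (fun _ : 'I_k => V).

Definition ppure k V (v : 'I_k -> V) : tpower k V := pure v.

Lemma eq_ppure k V (u v : 'I_k -> V) : u =1 v -> ppure u = ppure v.
Proof. exact: eq_pure. Qed.

Definition tpower_map k V W (f : 'Hom(V, W)) : 'Hom(tpower k V, tpower k W) :=
  bigtensor_map (fun=> f).

Lemma tpower_mapE k V W (f : 'Hom(V, W)) (v : 'I_k -> V) :
  tpower_map k f (ppure v) = ppure (fun i => f (v i)).
Proof. exact: bigtensor_mapE. Qed.

Lemma tpower_ext k V W (f g : 'Hom(tpower k V, W)) :
  (forall v, f (ppure v) = g (ppure v)) -> f = g.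
Proof. exact: bigtensor_ext. Qed.

Definition tpower_perm k V (sigma : 'S_k) : 'End(tpower k V) :=
  linfun (fun x : tpower k V =>
    [ffun s : {dffun 'I_k -> 'I_(\dim {:V})} => x (finfun (fun i => s (sigma i)))]
    : tpower k V).

Lemma tpower_permE k V (sigma : 'S_k) (v : 'I_k -> V) :
  tpower_perm V sigma (ppure v) = ppure (fun i => v ((sigma^-1)%g i)).
Proof.
rewrite /tpower_perm linfunE => [|a x y]; last first.
  by apply/ffunP => s; rewrite !ffunE.
apply/ffunP => s; rewrite !ffunE [RHS](reindex_inj (@perm_inj _ sigma)) /=.
by apply: eq_bigr => i _; rewrite ffunE permK.
Qed.

Lemma tpower_map_perm k V W (f : 'Hom(V, W)) (sigma : 'S_k) :
  (tpower_map k f \o tpower_perm V sigma = tpower_perm W sigma \o tpower_map k f)%VF.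
Proof.
apply: tpower_ext => v.
by rewrite !comp_lfunE tpower_permE !tpower_mapE tpower_permE.
Qed.

(* The quotient of the k-th tensor power by the span of all                   *)
(* x - chi(sigma) sigma(x), for chi a linear character of S_k: the symmetric  *)
(* power when chi is trivial, and the exterior power when chi is the sign     *)
(* (as 2 is invertible in the fields considered).                             *)
Definition coinv_rel k (chi : 'S_k -> K) V : {vspace tpower k V} :=
  (\sum_(sigma : 'S_k) limg (\1 - chi sigma *: tpower_perm V sigma)%VF)%VS.

Definition coinv k (chi : 'S_k -> K) V : vectType K := quot (coinv_rel chi V).

Definition coinv_map k (chi : 'S_k -> K) V W (f : 'Hom(V, W)) :
    'Hom(coinv chi V, coinv chi W) :=
  quot_map (coinv_rel chi V) (coinv_rel chi W) (tpower_map k f).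

Definition coinv_pure k (chi : 'S_k -> K) V (v : 'I_k -> V) : coinv chi V :=
  quot_pi (coinv_rel chi V) (ppure v).

Lemma coinv_relP k (chi : 'S_k -> K) V W (f : 'Hom(tpower k V, W))
    (U : {vspace W}) :
  (forall sigma v, f (ppure v - chi sigma *: ppure (fun i => v ((sigma^-1)%g i))) \in U) ->
  (f @: coinv_rel chi V <= U)%VS.
Proof.
move=> fU; rewrite limg_sum; apply/subv_sumP => sigma _.
rewrite -limg_comp; apply/subvP => _ /memv_imgP[x _ ->].
rewrite [x]bigtensor_sum linear_sum memv_suml // => s _.
rewrite linearZ /= memvZ // -/(ppure (fun i => bvec (s i))).
by rewrite comp_lfunE add_lfunE opp_lfunE scale_lfunE id_lfunE tpower_permE.
Qed.

Lemma mem_coinv_rel k (chi : 'S_k -> K) V sigma (v : 'I_k -> V) :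
  ppure v - chi sigma *: ppure (fun i => v ((sigma^-1)%g i)) \in coinv_rel chi V.
Proof.
apply: (subvP (sumv_sup sigma isT (subvv _))); apply/memv_imgP.
exists (ppure v); first exact: memvf.
by rewrite add_lfunE opp_lfunE scale_lfunE id_lfunE tpower_permE.
Qed.

Lemma coinv_map_rel k (chi : 'S_k -> K) V W (f : 'Hom(V, W)) :
  (tpower_map k f @: coinv_rel chi V <= coinv_rel chi W)%VS.
Proof.
apply: coinv_relP => sigma v; rewrite linearB linearZ /= !tpower_mapE.
by rewrite (mem_coinv_rel _ sigma (fun i => f (v i))).
Qed.

Lemma coinv_mapE k (chi : 'S_k -> K) V W (f : 'Hom(V, W)) (v : 'I_k -> V) :
  coinv_map chi f (coinv_pure chi v) = coinv_pure chi (fun i => f (v i)).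
Proof.
by rewrite /coinv_map quot_mapE ?coinv_map_rel // tpower_mapE.
Qed.

Lemma coinv_ext k (chi : 'S_k -> K) V W (f g : 'Hom(coinv chi V, W)) :
  (forall v, f (coinv_pure chi v) = g (coinv_pure chi v)) -> f = g.
Proof.
move=> e; pose pi := quot_pi (coinv_rel chi V).
suff fg : (f \o pi = g \o pi)%VF.
  by apply/lfunP => x; rewrite -[x]quot_reprK -(comp_lfunE f) fg comp_lfunE.
by apply: tpower_ext => v; rewrite !comp_lfunE; apply: e.
Qed.

Lemma coinv_map_id k (chi : 'S_k -> K) V : coinv_map chi \1 = \1%VF :> 'End(coinv chi V).
Proof.
apply: coinv_ext => v; rewrite coinv_mapE id_lfunE; congr (quot_pi _ _).
by apply: eq_ppure => i; rewrite id_lfunE.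
Qed.

Lemma coinv_map_comp k (chi : 'S_k -> K) V W X (f : 'Hom(V, W)) (g : 'Hom(W, X)) :
  coinv_map chi (g \o f) = (coinv_map chi g \o coinv_map chi f)%VF.
Proof.
apply: coinv_ext => v; rewrite comp_lfunE !coinv_mapE; congr (quot_pi _ _).
by apply: eq_ppure => i; rewrite comp_lfunE.
Qed.

End TensorPowers.

Section SymmetricAndExteriorPowers.

Variable K : fieldType.
Implicit Types A B C V W X M N : vectType K.

Lemma tpure_lin0l A B (b : B) : tpure (0 : A) b = 0.
Proof. by apply/matrixP => i j; rewrite !mxE /bcoord linear0 mul0r. Qed.

Lemma tpure_lin0r A B (a : A) : tpure a (0 : B) = 0.
Proof. by apply/matrixP => i j; rewrite !mxE /bcoord linear0 mulr0. Qed.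

Definition curryl A B C (f : 'Hom(tensor A B, C)) b : 'Hom(A, C) :=
  linfun (fun a => f (tpure a b)).
Definition curryr A B C (f : 'Hom(tensor A B, C)) a : 'Hom(B, C) :=
  linfun (fun b => f (tpure a b)).

Lemma currylE A B C (f : 'Hom(tensor A B, C)) a b : curryl f b a = f (tpure a b).
Proof. by rewrite /curryl linfunE // => k x y; rewrite tpure_linl linearP. Qed.

Lemma curryrE A B C (f : 'Hom(tensor A B, C)) a b : curryr f a b = f (tpure a b).
Proof. by rewrite /curryr linfunE // => k x y; rewrite tpure_linr linearP. Qed.

Lemma quot_bilinear A B C (U : {vspace A}) (U' : {vspace B})
    (f : 'Hom(tensor A B, C)) a b :
  (forall u y, u \in U -> f (tpure u y) = 0) ->
  (forall x u, u \in U' -> f (tpure x u) = 0) ->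
  f (tpure (quot_repr U (quot_pi U a)) (quot_repr U' (quot_pi U' b))) =
  f (tpure a b).
Proof.
move=> fU fU'; rewrite !quot_piE.
rewrite -[LHS]currylE linearB /= !currylE [X in _ - X]fU ?memv_proj // subr0.
by rewrite -[LHS]curryrE linearB /= !curryrE [X in _ - X]fU' ?memv_proj // subr0.
Qed.

Lemma coinv_pure_perm k (chi : 'S_k -> K) V (v : 'I_k -> V) (sigma : 'S_k) :
  coinv_pure chi v = chi sigma *: coinv_pure chi (fun i => v ((sigma^-1)%g i)).
Proof.
rewrite -linearZ; apply/quot_piP; exact: (mem_coinv_rel chi sigma v).
Qed.

Definition symnat k V : vectType K := coinv (fun _ : 'S_k => 1) V.

Definition ext k V : vectType K := coinv (fun sigma : 'S_k => (-1) ^+ sigma) V.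

Definition ext_map k V W (f : 'Hom(V, W)) : 'Hom(ext k V, ext k W) :=
  coinv_map _ f.

Definition wedge k V (v : 'I_k -> V) : ext k V := coinv_pure _ v.

Definition zero_space : vectType K := 'rV[K]_0.

(* H^0(PV, O(k)) for every integer k: zero for k < 0, whatever V.             *)
Definition sym (k : int) V : vectType K :=
  if k is Posz k' then symnat k' V else zero_space.

Definition sym_map (k : int) V W (f : 'Hom(V, W)) : 'Hom(sym k V, sym k W) :=
  match k with
  | Posz k' => coinv_map (fun _ : 'S_k' => 1) f
  | Negz _ => \1%VF
  end.

Lemma sym_map_id k V : sym_map k \1 = \1%VF :> 'End(sym k V).
Proof. by case: k => k //=; apply: coinv_map_id. Qed.

Lemma sym_map_comp k V W X (f : 'Hom(V, W)) (g : 'Hom(W, X)) :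
  sym_map k (g \o f) = (sym_map k g \o sym_map k f)%VF.
Proof. by case: k => k /=; rewrite ?coinv_map_comp ?comp_lfun1l. Qed.

Definition fcat (T : Type) k l m (e : (k + l)%N = m) (u : 'I_k -> T) (v : 'I_l -> T)
    (i : 'I_m) : T :=
  match split (cast_ord (esym e) i) with inl j => u j | inr j => v j end.

Definition tpower_cat k l m (e : (k + l)%N = m) V :
    'Hom(tensor (tpower k V) (tpower l V), tpower m V) :=
  tensor_lift (fun (x : tpower k V) (y : tpower l V) =>
    [ffun s : {dffun 'I_m -> 'I_(\dim {:V})} =>
       x (finfun (fun i => s (cast_ord e (lshift l i)))) *
       y (finfun (fun j => s (cast_ord e (rshift k j))))] : tpower m V).

Lemma tpower_catE k l m (e : (k + l)%N = m) V (u : 'I_k -> V) (v : 'I_l -> V) :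
  tpower_cat e V (tpure (ppure u) (ppure v)) = ppure (fcat e u v).
Proof.
rewrite /tpower_cat tensor_liftE.
- case: m / e; apply/ffunP => s; rewrite !ffunE big_split_ord /=.
  by congr (_ * _); apply: eq_bigr => i _; rewrite /fcat !ffunE !cast_ord_id
    ?(unsplitK (inl _)) ?(unsplitK (inr _)).
- by move=> y a x x'; apply/ffunP => s; rewrite !ffunE mulrDl -mulrA.
- by move=> x a y y'; apply/ffunP => s; rewrite !ffunE mulrDr mulrCA.
Qed.

Lemma coinv_tensor_ext k l (chi : 'S_k -> K) (chi' : 'S_l -> K) V W C
    (f g : 'Hom(tensor (coinv chi V) (coinv chi' W), C)) :
  (forall u v, f (tpure (coinv_pure chi u) (coinv_pure chi' v)) =
               g (tpure (coinv_pure chi u) (coinv_pure chi' v))) -> f = g.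
Proof.
move=> fg; apply: tensor_ext => a b; rewrite -!currylE; move: a.
apply/lfunP; apply: coinv_ext => u; rewrite !currylE -!curryrE; move: b.
by apply/lfunP; apply: coinv_ext => v; rewrite !curryrE.
Qed.

Definition symnat_mul k l m (e : (k + l)%N = m) V :
    'Hom(tensor (symnat k V) (symnat l V), symnat m V) :=
  ((quot_pi _ \o tpower_cat e V) \o tensor_map (quot_repr _) (quot_repr _))%VF.

Lemma symnat_pure_perm k V (v : 'I_k -> V) (h : 'I_k -> 'I_k) :
  injective h ->
  coinv_pure (fun _ : 'S_k => 1) (fun i => v (h i)) = coinv_pure (fun=> 1) v.
Proof.
move=> h_inj; rewrite [RHS](coinv_pure_perm _ _ (perm h_inj)^-1%g) scale1r.
by congr (quot_pi _ _); apply: eq_ppure => i; rewrite invgK permE.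
Qed.

Lemma coinv_bilinearl k l (chi : 'S_k -> K) V W C
    (f : 'Hom(tensor (tpower k V) (tpower l W), C)) :
  (forall sigma (u : 'I_k -> V) (v : 'I_l -> W), f (tpure (ppure u) (ppure v)) =
    chi sigma *: f (tpure (ppure (fun i => u ((sigma^-1)%g i))) (ppure v))) ->
  forall x y, x \in coinv_rel chi V -> f (tpure x y) = 0.
Proof.
move=> fP x y xrel; rewrite -currylE; apply/eqP; rewrite -memv_ker.
apply: subvP x xrel; rewrite lkerE -subv0; apply: coinv_relP => sigma u.
rewrite memv0 currylE -curryrE; apply/eqP.
suff -> : curryr f (ppure u - chi sigma *: ppure (fun i => u ((sigma^-1)%g i))) = 0.
  by rewrite zero_lfunE.
apply: tpower_ext => v; rewrite zero_lfunE curryrE -currylE linearB linearZ /=.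
by rewrite !currylE (fP sigma) subrr.
Qed.

Lemma coinv_bilinearr k l (chi : 'S_l -> K) V W C
    (f : 'Hom(tensor (tpower k V) (tpower l W), C)) :
  (forall sigma (u : 'I_k -> V) (v : 'I_l -> W), f (tpure (ppure u) (ppure v)) =
    chi sigma *: f (tpure (ppure u) (ppure (fun i => v ((sigma^-1)%g i))))) ->
  forall x y, y \in coinv_rel chi W -> f (tpure x y) = 0.
Proof.
move=> fP x y yrel; rewrite -curryrE; apply/eqP; rewrite -memv_ker.
apply: subvP y yrel; rewrite lkerE -subv0; apply: coinv_relP => sigma v.
rewrite memv0 curryrE -currylE; apply/eqP.
suff -> : curryl f (ppure v - chi sigma *: ppure (fun i => v ((sigma^-1)%g i))) = 0.
  by rewrite zero_lfunE.
apply: tpower_ext => u; rewrite zero_lfunE currylE -curryrE linearB linearZ /=.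
by rewrite !curryrE (fP sigma) subrr.
Qed.

Lemma symnat_fcat k l m (e : (k + l)%N = m) V (u : 'I_k -> V) (v : 'I_l -> V)
    (a : 'I_k -> 'I_k) (b : 'I_l -> 'I_l) :
  injective a -> injective b ->
  coinv_pure (fun _ : 'S_m => 1) (fcat e (fun i => u (a i)) (fun j => v (b j))) =
  coinv_pure (fun=> 1) (fcat e u v).
Proof.
move=> a_inj b_inj.
pose g (x : 'I_k + 'I_l) := match x with inl i => inl (a i) | inr j => inr (b j) end.
have g_inj : injective g by move=> [i|i] [j|j] //= [] => [/a_inj|/b_inj] ->.
pose h i := cast_ord e (unsplit (g (split (cast_ord (esym e) i)))).
have h_inj : injective h.
  move=> i j /cast_ord_inj/(can_inj unsplitK)/g_inj/(can_inj (@splitK _ _)).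
  exact: cast_ord_inj.
rewrite -[RHS](symnat_pure_perm _ h_inj); congr (quot_pi _ _).
apply: eq_ppure => i; rewrite /fcat /h cast_ordK unsplitK.
by case: (split _).
Qed.

Lemma symnat_mulE k l m (e : (k + l)%N = m) V (u : 'I_k -> V) (v : 'I_l -> V) :
  symnat_mul e V (tpure (coinv_pure (fun=> 1) u) (coinv_pure (fun=> 1) v)) =
  coinv_pure (fun=> 1) (fcat e u v).
Proof.
rewrite /symnat_mul comp_lfunE tensor_mapE /coinv_pure quot_bilinear.
- by rewrite comp_lfunE tpower_catE.
- move=> x y; apply: coinv_bilinearl => sigma {}u {}v.
  rewrite !comp_lfunE !tpower_catE scale1r; apply/esym.
  by apply: (symnat_fcat e _ _ (@perm_inj _ _) (@inj_id _)).
- move=> x y; apply: coinv_bilinearr => sigma {}u {}v.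
  rewrite !comp_lfunE !tpower_catE scale1r; apply/esym.
  by apply: (symnat_fcat e _ _ (@inj_id _) (@perm_inj _ _)).
Qed.

Lemma symnat_mul_map k l m (e : (k + l)%N = m) V W (f : 'Hom(V, W)) :
  (coinv_map (fun _ : 'S_m => 1) f \o symnat_mul e V =
   symnat_mul e W \o tensor_map (coinv_map _ f) (coinv_map _ f))%VF.
Proof.
apply: coinv_tensor_ext => u v.
rewrite [LHS]comp_lfunE [RHS]comp_lfunE tensor_mapE symnat_mulE !coinv_mapE.
rewrite symnat_mulE.
by congr (quot_pi _ _); apply: eq_ppure => i; rewrite /fcat; case: (split _).
Qed.

Lemma PoszD_inj (d k l : nat) : d%:Z + k%:Z = l%:Z -> (d + k)%N = l.
Proof. by case. Qed.

Definition sym_mul (d : nat) (k l : int) : d%:Z + k = l ->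
    forall V, 'Hom(tensor (sym d V) (sym k V), sym l V) :=
  match k, l return d%:Z + k = l ->
    forall V, 'Hom(tensor (sym d V) (sym k V), sym l V) with
  | Posz k', Posz l' => fun e V => symnat_mul (PoszD_inj e) V
  | _, _ => fun _ _ => 0
  end.

Lemma sym_mul_map (d : nat) (k l : int) (e : d%:Z + k = l) V W (f : 'Hom(V, W)) :
  (sym_map l f \o sym_mul e V = sym_mul e W \o tensor_map (sym_map d f) (sym_map k f))%VF.
Proof.
case: k l e => [k|k] [l|l] e /=; first exact: symnat_mul_map;
by rewrite comp_lfun0l comp_lfun0r.
Qed.

(* Contraction of the i-th factor with the j-th vector of the dual basis.     *)
Definition tpower_del k W (i : 'I_k.+1) (j : 'I_(\dim {:W})) :
    'Hom(tpower k.+1 W, tpower k W) :=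
  linfun (fun x : tpower k.+1 W =>
    [ffun s : {dffun 'I_k -> 'I_(\dim {:W})} =>
       x (finfun (fun a => oapp s j (unlift i a)))] : tpower k W).

Lemma tpower_delE k W (i : 'I_k.+1) j (v : 'I_k.+1 -> W) :
  tpower_del i j (ppure v) = bcoord j (v i) *: ppure (fun a => v (lift i a)).
Proof.
rewrite /tpower_del linfunE => [|a x y]; last by apply/ffunP => s; rewrite !ffunE.
apply/ffunP => s; rewrite !ffunE (bigD1 i) //= ffunE unlift_none /=.
congr (_ * _); rewrite [LHS](reindex_omap (lift i) (unlift i)) /=; last first.
  by move=> a ia; case: unliftP ia => [b ->|->] //; rewrite eqxx.
apply: eq_big => [a|a _]; last by rewrite ffunE liftK.
by rewrite liftK !eqxx (eq_sym _ i) neq_lift.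
Qed.

Lemma sum_linear V (J : finType) (a : K) (F G H : J -> V) :
  (forall j, H j = a *: F j + G j) -> \sum_j H j = a *: \sum_j F j + \sum_j G j.
Proof.
by move=> e; rewrite scaler_sumr -big_split; apply: eq_bigr => j _; apply: e.
Qed.

Section Koszul.

Variables (k : nat) (W M N : vectType K) (mu : 'Hom(tensor W M, N)).

Definition koszul_tensor (m : M) : 'Hom(tpower k.+1 W, tensor (ext k W) N) :=
  linfun (fun x => \sum_(i < k.+1) (-1) ^+ i *: \sum_j
    tpure (quot_pi _ (tpower_del i j x) : ext k W) (mu (tpure (bvec j) m))).

(* The Koszul differential: see [koszulE] below for its textbook formula.     *)
Definition koszul : 'Hom(tensor (ext k.+1 W) M, tensor (ext k W) N) :=
  tensor_lift (fun x m => koszul_tensor m (quot_repr _ x)).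

Lemma koszul_tensor_def m x :
  koszul_tensor m x = \sum_(i < k.+1) (-1) ^+ i *: \sum_j
    tpure (quot_pi _ (tpower_del i j x) : ext k W) (mu (tpure (bvec j) m)).
Proof.
rewrite /koszul_tensor linfunE // => {x} a x y.
apply: sum_linear => i; rewrite scalerA mulrC -scalerA -scalerDr.
by congr (_ *: _); apply: sum_linear => j; rewrite !linearP tpure_linl.
Qed.

Lemma koszul_tensorE (m : M) (v : 'I_k.+1 -> W) :
  koszul_tensor m (ppure v) = \sum_(i < k.+1)
    (-1) ^+ i *: tpure (wedge (fun j => v (lift i j))) (mu (tpure (v i) m)).
Proof.
rewrite koszul_tensor_def; apply: eq_bigr => i _; congr (_ *: _).
rewrite -(currylE mu (v i)) [v i]bcoord_sum linear_sum.
pose w : ext k W := wedge (fun j => v (lift i j)).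
rewrite -[RHS]/(tpure w _) -[RHS](linfunE (tpure_linr w)) linear_sum.
apply: eq_bigr => j _; rewrite tpower_delE !linearZ /= (linfunE (tpure_linr w)).
by rewrite currylE -(linfunE (tpure_linl _)) linearZ /= (linfunE (tpure_linl _)).
Qed.

Lemma koszul_tensor_rel m : (koszul_tensor m @:
  coinv_rel (fun sigma : 'S_k.+1 => (-1) ^+ sigma) W <= 0)%VS.
Proof.
apply: coinv_relP => sigma v; rewrite memv0 linearB linearZ /= subr_eq0.
rewrite !koszul_tensorE; apply/eqP; rewrite [in RHS](reindex_inj (@perm_inj _ sigma)).
rewrite scaler_sumr; apply: eq_bigr => i _.
have [tau Dsigma] : exists tau, sigma = lift_perm i (sigma i) tau.
  pose f j := odflt j (unlift (sigma i) (sigma (lift i j))).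
  have fE j : lift (sigma i) (f j) = sigma (lift i j).
    rewrite /f; have ne : sigma i != sigma (lift i j).
      by rewrite (inj_eq perm_inj) neq_lift.
    by have [a -> /= ->] := unlift_some ne.
  have f_inj : injective f.
    move=> a b fab; apply/(@lift_inj _ i)/(@perm_inj _ sigma).
    by rewrite -!fE fab.
  exists (perm f_inj); apply/permP => j.
  have [j' ->|->] := unliftP i j; last by rewrite lift_perm_id.
  by rewrite lift_perm_lift permE fE.
rewrite permK scalerA.
have -> : wedge (fun j => v (lift i j)) = (-1) ^+ tau *:
    wedge (fun j => v ((sigma^-1)%g (lift (sigma i) j))).
  rewrite /wedge [LHS](coinv_pure_perm _ _ tau); congr (_ *: quot_pi _ _).
  apply: eq_ppure => j; congr v; apply: (@perm_inj _ sigma); rewrite permKV.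
  by rewrite {1}Dsigma lift_perm_lift permKV.
rewrite -(linfunE (tpure_linl _)) linearZ /= (linfunE (tpure_linl _)) scalerA.
congr (_ *: _); rewrite {1}Dsigma odd_lift_perm !signr_addb !signr_odd.
rewrite [RHS]mulrAC; congr (_ * _).
by rewrite -mulrA -expr2 sqrr_sign mulr1.
Qed.

Lemma koszulE (v : 'I_k.+1 -> W) m :
  koszul (tpure (wedge v) m) = \sum_(i < k.+1)
    (-1) ^+ i *: tpure (wedge (fun j => v (lift i j))) (mu (tpure (v i) m)).
Proof.
rewrite /koszul tensor_liftE.
- rewrite quot_piE linearB /= koszul_tensorE; set y := projv _ _.
  suff -> : koszul_tensor m y = 0 by rewrite subr0.
  apply/eqP; rewrite -memv0; apply: (subvP (koszul_tensor_rel m)).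
  by rewrite memv_img ?memv_proj.
- by move=> y a u u'; rewrite !linearP.
move=> x a u u'; rewrite !koszul_tensor_def.
apply: sum_linear => i; rewrite scalerA mulrC -scalerA -scalerDr.
by congr (_ *: _); apply: sum_linear => j; rewrite tpure_linr !linearP tpure_linr.
Qed.

End Koszul.

Lemma wedge_tensor_ext k W M C (f g : 'Hom(tensor (ext k W) M, C)) :
  (forall v m, f (tpure (wedge v) m) = g (tpure (wedge v) m)) -> f = g.
Proof.
move=> fg; apply: tensor_ext => a b; rewrite -!currylE; move: a.
by apply/lfunP; apply: coinv_ext => v; rewrite !currylE; apply: fg.
Qed.

Lemma ext_map_wedge k V W (f : 'Hom(V, W)) (v : 'I_k -> V) :
  ext_map k f (wedge v) = wedge (fun i => f (v i)).
Proof. exact: coinv_mapE. Qed.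

Lemma koszul_map k W W' M M' N N' (mu : 'Hom(tensor W M, N))
    (mu' : 'Hom(tensor W' M', N')) (g : 'Hom(W, W')) (h : 'Hom(M, M'))
    (h' : 'Hom(N, N')) :
  (h' \o mu = mu' \o tensor_map g h)%VF ->
  (tensor_map (ext_map k g) h' \o koszul k mu =
   koszul k mu' \o tensor_map (ext_map k.+1 g) h)%VF.
Proof.
move=> e; apply: wedge_tensor_ext => v m.
rewrite [LHS]comp_lfunE [RHS]comp_lfunE tensor_mapE ext_map_wedge !koszulE.
rewrite linear_sum; apply: eq_bigr => i _; rewrite linearZ /= tensor_mapE.
rewrite ext_map_wedge; congr (_ *: tpure _ _).
by rewrite -tensor_mapE -[LHS]comp_lfunE e comp_lfunE.
Qed.

Lemma koszul_term_map_comp p W W' W'' M M' M'' (g : 'Hom(W, W')) (g' : 'Hom(W', W''))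
    (g'' : 'Hom(W, W'')) (h : 'Hom(M, M')) (h' : 'Hom(M', M'')) (h'' : 'Hom(M, M'')) x :
  g'' = (g' \o g)%VF -> h'' = (h' \o h)%VF ->
  tensor_map (ext_map p g'') h'' x =
  tensor_map (ext_map p g') h' (tensor_map (ext_map p g) h x).
Proof.
by move=> -> ->; rewrite /ext_map coinv_map_comp tensor_map_comp comp_lfunE.
Qed.

(* The differential leaves ext 0 W (x) M for ext (-1) W (x) N = 0.            *)
Definition koszul_cycles p W M N (mu : 'Hom(tensor W M, N)) :
    {vspace tensor (ext p W) M} :=
  match p with
  | 0 => fullv
  | p'.+1 => lker (koszul p' mu)
  end.

Definition koszul_homology p W M0 M1 M2 (mu0 : 'Hom(tensor W M0, M1))
    (mu1 : 'Hom(tensor W M1, M2)) : vectType K :=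
  subquot (koszul_cycles p mu1) (limg (koszul p mu0)).

Definition koszul_homology_map p W W' M0 M0' M1 M1' M2 M2'
    (mu0 : 'Hom(tensor W M0, M1)) (mu1 : 'Hom(tensor W M1, M2))
    (mu0' : 'Hom(tensor W' M0', M1')) (mu1' : 'Hom(tensor W' M1', M2'))
    (g : 'Hom(W, W')) (h : 'Hom(M1, M1')) :
    'Hom(koszul_homology p mu0 mu1, koszul_homology p mu0' mu1') :=
  subquot_map _ _ _ _ (tensor_map (ext_map p g) h).

Lemma koszul_cycles_map p W W' M M' N N' (mu : 'Hom(tensor W M, N))
    (mu' : 'Hom(tensor W' M', N')) (g : 'Hom(W, W')) (h : 'Hom(M, M'))
    (h' : 'Hom(N, N')) :
  (h' \o mu = mu' \o tensor_map g h)%VF ->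
  (tensor_map (ext_map p g) h @: koszul_cycles p mu <= koszul_cycles p mu')%VS.
Proof.
case: p => [|p] e; first exact: subvf.
apply/subvP => _ /memv_imgP[x xZ ->]; rewrite memv_ker -comp_lfunE.
by rewrite -(koszul_map p e) comp_lfunE; move: xZ; rewrite memv_ker => /eqP->; rewrite linear0.
Qed.

Lemma koszul_boundaries_map p W W' M M' N N' (mu : 'Hom(tensor W M, N))
    (mu' : 'Hom(tensor W' M', N')) (g : 'Hom(W, W')) (h : 'Hom(M, M'))
    (h' : 'Hom(N, N')) :
  (h' \o mu = mu' \o tensor_map g h)%VF ->
  (tensor_map (ext_map p g) h' @: limg (koszul p mu) <= limg (koszul p mu'))%VS.
Proof.
by move=> e; rewrite -limg_comp (koszul_map p e) limg_comp limgS ?subvf.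
Qed.

End SymmetricAndExteriorPowers.

Section Functors.

Variable K : fieldType.

Record functor (n : nat) := Functor {
  fobj :> ('I_n -> vectType K) -> vectType K;
  fmap : forall V W : 'I_n -> vectType K,
    (forall i, 'Hom(V i, W i)) -> 'Hom(fobj V, fobj W);
  fmap_id : forall V : 'I_n -> vectType K,
    fmap (fun i => \1%VF : 'Hom(V i, V i)) = \1%VF;
  fmap_comp : forall (V W X : 'I_n -> vectType K) (f : forall i, 'Hom(V i, W i))
    (g : forall i, 'Hom(W i, X i)),
    fmap (fun i => (g i \o f i)%VF) = (fmap g \o fmap f)%VF }.

Record functor1 := Functor1 {
  fobj1 :> vectType K -> vectType K;
  fmap1 : forall V W : vectType K, 'Hom(V, W) -> 'Hom(fobj1 V, fobj1 W);
  fmap1_id : forall V : vectType K, fmap1 (\1%VF : 'End(V)) = \1%VF;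
  fmap1_comp : forall (V W X : vectType K) (f : 'Hom(V, W)) (g : 'Hom(W, X)),
    fmap1 (g \o f)%VF = (fmap1 g \o fmap1 f)%VF }.

Definition natural_iso n (F G : functor n) : Prop :=
  exists phi : forall V : 'I_n -> vectType K, 'Hom(F V, G V),
    (forall V, bijective (phi V)) /\
    (forall (V W : 'I_n -> vectType K) (f : forall i, 'Hom(V i, W i)),
       (phi W \o fmap F f = fmap G f \o phi V)%VF).

Lemma zero_space_id (f g : 'End(zero_space K)) : f = g.
Proof. by apply/lfunP => x; rewrite thinmx0 [RHS]thinmx0. Qed.

Definition zero_functor1 : functor1 :=
  @Functor1 (fun=> zero_space K) (fun _ _ _ => 0)
    (fun _ => zero_space_id _ _) (fun _ _ _ _ _ => zero_space_id _ _).

Definition zero_functor n : functor n :=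
  @Functor n (fun=> zero_space K) (fun _ _ _ => 0)
    (fun _ => zero_space_id _ _) (fun _ _ _ _ _ => zero_space_id _ _).

Section DirectSums.

Variables (n : nat) (F G : functor n).
Implicit Types V W X : 'I_n -> vectType K.

Definition sum_map V W (f : forall i, 'Hom(V i, W i)) :
    'Hom((F V * G V : vectType K)%type, (F W * G W : vectType K)%type) :=
  linfun (fun x : (F V * G V)%type => (fmap F f x.1, fmap G f x.2)).

Lemma sum_mapE V W (f : forall i, 'Hom(V i, W i)) x :
  sum_map f x = (fmap F f x.1, fmap G f x.2).
Proof. by rewrite /sum_map linfunE // => a u v; rewrite !linearP. Qed.

Lemma sum_map_id V : sum_map (fun i => \1%VF : 'End(V i)) = \1%VF.
Proof. by apply/lfunP => -[x y]; rewrite sum_mapE !fmap_id !id_lfunE. Qed.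

Lemma sum_map_comp V W X (f : forall i, 'Hom(V i, W i)) (g : forall i, 'Hom(W i, X i)) :
  sum_map (fun i => (g i \o f i)%VF) = (sum_map g \o sum_map f)%VF.
Proof.
by apply/lfunP => x; rewrite [RHS]comp_lfunE !sum_mapE !fmap_comp !comp_lfunE.
Qed.

Definition sum_functor : functor n := Functor sum_map_id sum_map_comp.

Variable m : nat.

Definition copies_map V W (f : forall i, 'Hom(V i, W i)) :
    'Hom(({ffun 'I_m -> F V} : vectType K), ({ffun 'I_m -> F W} : vectType K)) :=
  linfun (fun x : {ffun 'I_m -> F V} => [ffun j => fmap F f (x j)]).

Lemma copies_mapE V W (f : forall i, 'Hom(V i, W i)) x :
  copies_map f x = [ffun j => fmap F f (x j)].
Proof.
rewrite /copies_map linfunE // => a u v.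
by apply/ffunP => j; rewrite !ffunE linearP.
Qed.

Lemma copies_map_id V : copies_map (fun i => \1%VF : 'End(V i)) = \1%VF.
Proof.
apply/lfunP => x; rewrite copies_mapE fmap_id id_lfunE.
by apply/ffunP => j; rewrite ffunE id_lfunE.
Qed.

Lemma copies_map_comp V W X (f : forall i, 'Hom(V i, W i))
    (g : forall i, 'Hom(W i, X i)) :
  copies_map (fun i => (g i \o f i)%VF) = (copies_map g \o copies_map f)%VF.
Proof.
apply/lfunP => x; rewrite [RHS]comp_lfunE !copies_mapE fmap_comp.
by apply/ffunP => j; rewrite !ffunE comp_lfunE.
Qed.

Definition copies_functor : functor n := Functor copies_map_id copies_map_comp.

End DirectSums.

Definition bigsum_functor n (I : Type) (r : seq I) (F : I -> functor n) : functor n :=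
  foldr (fun i => sum_functor (F i)) (zero_functor n) r.

Section ExternalTensor.

Variables (n : nat) (F : 'I_n -> functor1).
Implicit Types V W X : 'I_n -> vectType K.

Definition tensor_functor_map V W (f : forall i, 'Hom(V i, W i)) :
    'Hom(bigtensor (fun i => F i (V i)), bigtensor (fun i => F i (W i))) :=
  bigtensor_map (fun i => fmap1 (F i) (f i)).

Lemma tensor_functor_id V : tensor_functor_map (fun i => \1%VF : 'End(V i)) = \1%VF.
Proof. by apply: bigtensor_map_id => i; apply: fmap1_id. Qed.

Lemma tensor_functor_comp V W X (f : forall i, 'Hom(V i, W i))
    (g : forall i, 'Hom(W i, X i)) :
  tensor_functor_map (fun i => (g i \o f i)%VF) =
  (tensor_functor_map g \o tensor_functor_map f)%VF.
Proof. by apply: bigtensor_map_comp => i; apply: fmap1_comp. Qed.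

Definition tensor_functor : functor n :=
  Functor tensor_functor_id tensor_functor_comp.

End ExternalTensor.

End Functors.

Record intpart := IntPart {
  parts :> seq nat;
  parts_subproof : sorted geq parts && (0%N \notin parts) }.

HB.instance Definition _ := [isSub for parts].
HB.instance Definition _ := [Equality of intpart by <:].

Section SchurFunctors.

Variables (K : fieldType) (l : seq nat).
Implicit Types V W X : vectType K.

(* The boxes of the Young diagram of l are numbered row by row: box k lies in *)
(* row [reshape_index l k] and column [reshape_offset l k].                   *)
Definition row_group : {set 'S_(sumn l)} :=
  [set s : 'S_(sumn l) | [forall k, reshape_index l (s k) == reshape_index l k]].
Definition column_group : {set 'S_(sumn l)} :=
  [set s : 'S_(sumn l) | [forall k, reshape_offset l (s k) == reshape_offset l k]].

Definition young_symmetrizer V : 'End(tpower (sumn l) V) :=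
  ((\sum_(t in column_group) (-1) ^+ t *: tpower_perm V t)
   \o (\sum_(s in row_group) tpower_perm V s))%VF.

Definition schur_obj V : vectType K :=
  subvs_of (limg (young_symmetrizer V)).

Definition schur_map V W (f : 'Hom(V, W)) :
    'Hom(schur_obj V, schur_obj W) :=
  linfun (vsproj _ \o tpower_map (sumn l) f \o vsval).

Lemma tpower_map_young V W (f : 'Hom(V, W)) :
  (tpower_map (sumn l) f \o young_symmetrizer V =
   young_symmetrizer W \o tpower_map (sumn l) f)%VF.
Proof.
have comm (A : {set 'S_(sumn l)}) (c : 'S_(sumn l) -> K) :
    (tpower_map (sumn l) f \o (\sum_(s in A) c s *: tpower_perm V s) =
     (\sum_(s in A) c s *: tpower_perm W s) \o tpower_map (sumn l) f)%VF.
  apply/lfunP => x; rewrite !comp_lfunE !sum_lfunE linear_sum.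
  apply: eq_bigr => s _; rewrite !scale_lfunE linearZ /= -!comp_lfunE.
  by rewrite tpower_map_perm.
rewrite /young_symmetrizer comp_lfunA comm -!comp_lfunA; congr (_ \o _)%VF.
have := comm row_group (fun=> 1); under eq_bigr do rewrite scale1r.
by move->; under eq_bigr do rewrite scale1r.
Qed.

Lemma tpower_map_limg V W (f : 'Hom(V, W)) x :
  x \in limg (young_symmetrizer V) ->
  tpower_map (sumn l) f x \in limg (young_symmetrizer W).
Proof.
case/memv_imgP => y _ ->; rewrite -comp_lfunE tpower_map_young comp_lfunE.
by rewrite memv_img ?memvf.
Qed.

Lemma schur_mapE V W (f : 'Hom(V, W)) (x : schur_obj V) :
  vsval (schur_map f x) = tpower_map (sumn l) f (vsval x).
Proof. by rewrite /schur_map lfunE /= vsprojK ?tpower_map_limg ?subvsP. Qed.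

Lemma schur_map_id V : schur_map \1 = \1%VF :> 'End(schur_obj V).
Proof.
apply/lfunP => x; apply: subvs_inj; rewrite schur_mapE id_lfunE.
by rewrite /tpower_map bigtensor_map_id ?id_lfunE.
Qed.

Lemma schur_map_comp V W X (f : 'Hom(V, W)) (g : 'Hom(W, X)) :
  schur_map (g \o f) = (schur_map g \o schur_map f)%VF.
Proof.
apply/lfunP => x; apply: subvs_inj; rewrite [in RHS]comp_lfunE !schur_mapE.
rewrite -comp_lfunE; congr (fun_of_lfun _ _).
by rewrite /tpower_map; apply: bigtensor_map_comp.
Qed.

Definition schur : functor1 K := Functor1 schur_map_id schur_map_comp.

End SchurFunctors.

(* The Schur functor of (N - |l|, l_1, l_2, ...). For l = () and N = 0 this   *)
(* sequence is (0), whose Schur functor is the constant functor K.            *)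
Definition schur_bracket (K : fieldType) (l : intpart) (N : int) : functor1 K :=
  if N - (sumn l)%:Z < (head 0%N l)%:Z then zero_functor1 K
  else schur K (`|N - (sumn l)%:Z|%N :: l).

Section LineBundles.

Variables (K : fieldType) (n : nat).
Implicit Types (V W X : 'I_n -> vectType K) (a c b : 'I_n -> int) (d : 'I_n -> nat).

(* H^0 (PV_1 x ... x PV_n, O(a_1, ..., a_n)).                                 *)
Definition sections a V : vectType K := bigtensor (fun i => sym (a i) (V i)).

Definition sections_map a V W (f : forall i, 'Hom(V i, W i)) :
  'Hom(sections a V, sections a W) := bigtensor_map (fun i => sym_map (a i) (f i)).

Lemma sections_map_id a V : sections_map a (fun i => \1%VF : 'End(V i)) = \1%VF.
Proof. by apply: bigtensor_map_id => i; apply: sym_map_id. Qed.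

Lemma sections_map_comp a V W X (f : forall i, 'Hom(V i, W i))
    (g : forall i, 'Hom(W i, X i)) :
  sections_map a (fun i => (g i \o f i)%VF) = (sections_map a g \o sections_map a f)%VF.
Proof. by apply: bigtensor_map_comp => i; apply: sym_map_comp. Qed.

Definition sections_mul d a c (e : forall i, (d i)%:Z + a i = c i) V :
    'Hom(tensor (sections (fun i => (d i)%:Z) V) (sections a V), sections c V) :=
  bigtensor_mul (fun i => sym_mul (e i) (V i)).

Lemma sections_mul_map d a c (e : forall i, (d i)%:Z + a i = c i) V W
    (f : forall i, 'Hom(V i, W i)) :
  (sections_map c f \o sections_mul e V =
   sections_mul e W \o tensor_map (sections_map _ f) (sections_map a f))%VF.
Proof.
apply: tensor_ext => x y; rewrite -![fun_of_lfun _ (tpure x y)]currylE; move: x.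
apply/lfunP; apply: bigtensor_ext => u; rewrite !currylE -!curryrE; move: y.
apply/lfunP; apply: bigtensor_ext => v; rewrite !curryrE.
rewrite (comp_lfunE (sections_map c f)) (comp_lfunE (sections_mul e W)).
rewrite tensor_mapE (bigtensor_mulE (fun i => sym_mul (e i) (V i))).
rewrite (bigtensor_mapE (fun i => sym_map (c i) (f i))).
rewrite (bigtensor_mapE (fun i => sym_map (d i) (f i))).
rewrite (bigtensor_mapE (fun i => sym_map (a i) (f i))).
rewrite (bigtensor_mulE (fun i => sym_mul (e i) (W i))); apply: eq_pure => i.
by rewrite -comp_lfunE sym_mul_map comp_lfunE tensor_mapE.
Qed.

(* The multidegree of B_b (x) L^k for L = O(d_1, ..., d_n).                   *)
Definition twist d b (k : int) (i : 'I_n) : int := k * (d i)%:Z + b i.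

Lemma twistS d b (k l : int) : k + 1 = l ->
  forall i, (d i)%:Z + twist d b k i = twist d b l i.
Proof. by move=> <- i; rewrite /twist mulrDl mul1r addrCA addrA. Qed.

Variables (d : 'I_n -> nat) (p q : nat) (b : 'I_n -> int).

Let W V := sections (fun i => (d i)%:Z) V.
Let M (k : int) V := sections (twist d b k) V.

Definition mul_in V : 'Hom(tensor (W V) (M (q%:Z - 1) V), M q V) :=
  sections_mul (twistS d b (subrK 1 q%:Z)) V.
Definition mul_out V : 'Hom(tensor (W V) (M q V), M (q%:Z + 1) V) :=
  sections_mul (twistS d b (erefl (q%:Z + 1))) V.

Definition Kpq_obj V : vectType K := koszul_homology p (mul_in V) (mul_out V).

Definition Kpq_map V V' (f : forall i, 'Hom(V i, V' i)) :
    'Hom(Kpq_obj V, Kpq_obj V') :=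
  koszul_homology_map p (mul_in V) (mul_out V) (mul_in V') (mul_out V')
    (sections_map _ f) (sections_map _ f).

Lemma Kpq_mapE V V' (f : forall i, 'Hom(V i, V' i)) z :
  z \in koszul_cycles p (mul_out V) ->
  Kpq_map f (subquot_class _ _ z) =
  subquot_class _ _ (tensor_map (ext_map p (sections_map _ f)) (sections_map _ f) z).
Proof.
apply: subquot_mapE; first exact/koszul_cycles_map/sections_mul_map.
exact/koszul_boundaries_map/sections_mul_map.
Qed.

Lemma Kpq_map_cycles V V' (f : forall i, 'Hom(V i, V' i)) z :
  z \in koszul_cycles p (mul_out V) ->
  tensor_map (ext_map p (sections_map _ f)) (sections_map _ f) z
    \in koszul_cycles p (mul_out V').
Proof.
move=> Zz; apply: subvP (memv_img _ Zz).
exact/koszul_cycles_map/sections_mul_map.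
Qed.

Lemma Kpq_map_id V : Kpq_map (fun i => \1%VF : 'End(V i)) = \1%VF.
Proof.
apply/lfunP => x; have [z Zz ->] := subquot_class_surj x.
rewrite Kpq_mapE // id_lfunE !sections_map_id /ext_map coinv_map_id.
by rewrite tensor_map_id id_lfunE.
Qed.

Lemma Kpq_map_comp V V' V'' (f : forall i, 'Hom(V i, V' i))
    (g : forall i, 'Hom(V' i, V'' i)) :
  Kpq_map (fun i => (g i \o f i)%VF) = (Kpq_map g \o Kpq_map f)%VF.
Proof.
apply/lfunP => x; have [z Zz ->] := subquot_class_surj x.
apply: (etrans (Kpq_mapE _ Zz)); apply/esym.
apply: (etrans (comp_lfunE (Kpq_map g) (Kpq_map f) _)).
apply: (etrans (congr1 (Kpq_map g) (Kpq_mapE f Zz))).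
apply: (etrans (Kpq_mapE g (Kpq_map_cycles f Zz))).
congr (subquot_class _ _ _); apply/esym.
by apply: koszul_term_map_comp; apply: sections_map_comp.
Qed.

Definition Kpq : functor K n := Functor Kpq_map_id Kpq_map_comp.

End LineBundles.

(* Main.v *)
(* Put N_i = (p + q) d_i + b_i. The three terms of the Koszul complex are     *)
(* natural retracts of V |-> (x)_i V_i^{(x) N_i}, whose natural endomorphisms *)
(* form the group algebra A of the product of the symmetric groups S_{N_i}.   *)
(* Hence so is the Koszul homology, cut out by an idempotent eps of A, and    *)
(* the multiplicity of the Schur functor of nu is the dimension of            *)
(* c_nu A eps for the Young symmetrizer c_nu. This number is also the         *)
(* dimension of the homology of the complex of highest weight vectors of      *)
(* weight nu.                                                                 *)
(*   When b_i grows by s_i, multiplication of the coefficient factor          *)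
(* Sym^{a_i} V_i by the s_i-th power of the highest weight vector of V_i is   *)
(* injective and commutes with the differentials. It maps the highest weight  *)
(* vectors of weight nu onto those of weight nu + (s_i, 0, 0, ...): a         *)
(* polytabloid survives the symmetrization of the a_i coefficient boxes only  *)
(* if these lie in distinct columns, and then s_i of them can be moved to     *)
(* columns of height one. The same remark bounds the part of nu below the     *)
(* first row by p d_i, so that only finitely many lambda occur.               *)

Require Import Defs.
From HB Require Import structures.
From mathcomp Require Import all_boot all_order all_algebra all_fingroup.

Set Implicit Arguments.
Unset Strict Implicit.
Unset Printing Implicit Defensive.

Import GRing.Theory.

Local Open Scope ring_scope.

(** * The group algebra *)

(** The first half of the argument is Schur-Weyl duality for functors. In characteristic zero each
    Koszul term of total degree N_i in V_i is a natural direct summand of the tensor product of the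
    N_i-th tensor powers of the V_i ([kterm_is_retract]), and the natural endomorphisms of that
    functor come from a group algebra A ([natural_endo]). As A is von Neumann regular
    ([galg_regular]), natural maps between summands have natural pseudo-inverses
    ([natural_regular]), so that homology is again a natural summand ([homology_retract],
    [retract_exists]). A summand cut out by an idempotent eps is the sum over shapes nu of dim (c_nu
    A eps) copies of the Schur functor of nu ([schur_decomposition]); this rests on the
    orthogonality of Young symmetrizers ([young_orth], [young_scalar]) and on 1 lying in the
    two-sided ideal that they generate ([young_complete]).

    The second half is stability. The dimension of c_nu A eps is read off on highest weight vectors
    ([dim_sandwich_hw], [homology_multiplicity]). The degree b is compared with the smallest
    admissible one, where b_i = (p + q) d_i for i <= r; let s_i be the excess. Multiplication by the
    s_i-th powers of the highest weight vectors is injective and commutes with the differentials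
    ([mul_omega_inj], [kterm_shift_koszul]). It identifies the highest weight spaces of nu with
    those of nu + (s_i, 0, 0, ...) provided that the second row of nu is not longer than the
    coefficient degree ([tableau_normalize], [hw_shift]). Hence the multiplicities agree
    ([kpq_stable_multiplicity]).

    The bounds come from the middle term. Its highest weight vectors vanish unless the first row of
    nu^i has at least q d_i + b_i boxes ([kterm_hw_eq0]), which leaves at most p d_i boxes for the
    part lambda^i below it. So finitely many lambda occur; moreover the second row is at most p d_i
    <= (p + q) d_i, which is the condition needed for stability in the middle and in the source
    term. The inequality b_j < d_j enters for q = 0, where it makes the source term zero; for q > 0
    the source term has coefficient degree (q - 1) d_i + b_i >= b_i. *)

Definition galg (K : fieldType) (gT : finGroupType) : Type := {ffun gT -> K^o}.

Section GroupAlgebra.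

Variables (K : fieldType) (gT : finGroupType).

HB.instance Definition _ := GRing.Lmodule.copy (galg K gT) {ffun gT -> K^o}.
HB.instance Definition _ := Vector.copy (galg K gT) {ffun gT -> K^o}.

Implicit Types (x y z : galg K gT) (g h : gT).

Definition gcoef x g : K := (x : {ffun gT -> K^o}) g.
Definition gelt g : galg K gT := [ffun h => (h == g)%:R : K^o].
Definition gmul x y : galg K gT := [ffun g => \sum_h gcoef x h * gcoef y (h^-1 * g)%g : K^o].

Lemma galgP x y : (forall g, gcoef x g = gcoef y g) -> x = y.
Proof. by move=> e; apply/ffunP => g; apply: e. Qed.

Lemma gcoef_elt g h : gcoef (gelt g) h = (h == g)%:R.
Proof. by rewrite /gcoef ffunE. Qed.

Lemma gcoef_mul x y g : gcoef (gmul x y) g = \sum_h gcoef x h * gcoef y (h^-1 * g)%g.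
Proof. by rewrite /gcoef ffunE. Qed.

Lemma gcoefD x y g : gcoef (x + y) g = gcoef x g + gcoef y g.
Proof. by rewrite /gcoef ffunE. Qed.

Lemma gcoefZ a x g : gcoef (a *: x) g = a * gcoef x g.
Proof. by rewrite /gcoef ffunE. Qed.

Lemma gcoef_sum (J : Type) (r : seq J) (P : pred J) (F : J -> galg K gT) g :
  gcoef (\sum_(j <- r | P j) F j) g = \sum_(j <- r | P j) gcoef (F j) g.
Proof. by apply: (big_morph _ (fun x y => gcoefD x y g)); rewrite /gcoef ffunE. Qed.

Lemma gmulA : associative gmul.
Proof.
move=> x y z; apply: galgP => g; rewrite !gcoef_mul.
under eq_bigr => h _ do rewrite gcoef_mul mulr_sumr.
under [RHS]eq_bigr => h _ do rewrite gcoef_mul mulr_suml.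
rewrite [RHS]exchange_big /=; apply: eq_bigr => h _.
rewrite [RHS](reindex_inj (mulgI h)) /=; apply: eq_bigr => k _.
by rewrite mulrA mulKg invMg mulgA.
Qed.

Lemma gmul1 : left_id (gelt 1%g) gmul.
Proof.
move=> x; apply: galgP => g; rewrite gcoef_mul (bigD1 1%g) //= gcoef_elt eqxx.
rewrite mul1r invg1 mul1g big1 ?addr0 // => h /negPf h1.
by rewrite gcoef_elt h1 mul0r.
Qed.

Lemma gmulr1 : right_id (gelt 1%g) gmul.
Proof.
move=> x; apply: galgP => g; rewrite gcoef_mul (bigD1 g) //= gcoef_elt mulVg eqxx.
rewrite mulr1 big1 ?addr0 // => h hg; rewrite gcoef_elt.
case: eqP => [e|_]; last by rewrite mulr0.
by case/eqP: hg; rewrite -[h]mulg1 -e mulKVg.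
Qed.

Lemma gmulDl : left_distributive gmul +%R.
Proof.
move=> x y z; apply: galgP => g; rewrite gcoefD !gcoef_mul -big_split /=.
by apply: eq_bigr => h _; rewrite gcoefD mulrDl.
Qed.

Lemma gmulDr : right_distributive gmul +%R.
Proof.
move=> x y z; apply: galgP => g; rewrite gcoefD !gcoef_mul -big_split /=.
by apply: eq_bigr => h _; rewrite gcoefD mulrDr.
Qed.

Lemma gelt1_neq0 : gelt 1%g != 0.
Proof.
apply/eqP => /(congr1 (gcoef^~ 1%g)); rewrite gcoef_elt eqxx /gcoef ffunE.
by apply/eqP; rewrite oner_eq0.
Qed.

HB.instance Definition _ := GRing.Zmodule_isNzRing.Build (galg K gT)
  gmulA gmul1 gmulr1 gmulDl gmulDr gelt1_neq0.

Lemma gscaleAl (a : K) x y : a *: (x * y) = a *: x * y.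
Proof.
apply: galgP => g; rewrite gcoefZ !gcoef_mul mulr_sumr.
by apply: eq_bigr => h _; rewrite gcoefZ mulrA.
Qed.
HB.instance Definition _ := GRing.Lmodule_isLalgebra.Build K (galg K gT) gscaleAl.

Lemma gscaleAr (a : K) x y : a *: (x * y) = x * (a *: y).
Proof.
apply: galgP => g; rewrite gcoefZ !gcoef_mul mulr_sumr.
by apply: eq_bigr => h _; rewrite gcoefZ mulrCA.
Qed.
HB.instance Definition _ := GRing.Lalgebra_isAlgebra.Build K (galg K gT) gscaleAr.

Lemma gcoefM x y g : gcoef (x * y) g = \sum_h gcoef x h * gcoef y (h^-1 * g)%g.
Proof. exact: gcoef_mul. Qed.

Lemma gelt1 : gelt 1%g = 1. Proof. by []. Qed.

Lemma geltM g h : gelt (g * h)%g = gelt g * gelt h.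
Proof.
apply: galgP => k; rewrite gcoefM (bigD1 g) //= gcoef_elt big1 ?addr0.
  rewrite !gcoef_elt eqxx mul1r; congr (_%:R : K); congr nat_of_bool.
  by apply/eqP/eqP => [->|<-]; rewrite ?mulKg ?mulKVg.
by move=> k' /negPf kg; rewrite gcoef_elt kg mul0r.
Qed.

Lemma geltM_eq x y g h g' h' : (g * h = g' * h')%g ->
  x * gelt g * gelt h * y = x * gelt g' * (gelt h' * y).
Proof. by move=> e; rewrite -mulrA mulrA -(mulrA x) -geltM e geltM !mulrA. Qed.

Lemma galg_sum x : x = \sum_g gcoef x g *: gelt g.
Proof.
apply: galgP => h; rewrite gcoef_sum (bigD1 h) //= gcoefZ gcoef_elt eqxx mulr1.
rewrite big1 ?addr0 // => g gh.
by rewrite gcoefZ gcoef_elt eq_sym (negPf gh) mulr0.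
Qed.

Lemma galg_mul_sum x y z : x * z * y = \sum_g gcoef z g *: (x * gelt g * y).
Proof.
rewrite {1}[z]galg_sum mulr_sumr mulr_suml; apply: eq_bigr => g _.
by rewrite -scalerAr -scalerAl.
Qed.

Definition glmul x : 'End(galg K gT) := linfun ( *%R x).
Definition grmul x : 'End(galg K gT) := linfun (fun y => y * x).

Lemma glmulE x y : glmul x y = x * y.
Proof. by rewrite /glmul linfunE // => a u v; rewrite mulrDr scalerAr. Qed.

Lemma grmulE x y : grmul x y = y * x.
Proof. by rewrite /grmul linfunE // => a u v; rewrite mulrDl scalerAl. Qed.

(* Averaging over the group makes a linear pseudo-inverse of right            *)
(* multiplication by x left-equivariant, hence a right multiplication.        *)
Lemma galg_regular x : [pchar K] =i pred0 -> exists y, x * y * x = x.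
Proof.
move=> char0; pose L0 := ((grmul x)^-1)%VF.
have LL0 z : L0 (z * x) * x = z * x.
  by rewrite -!grmulE limg_lfunVK // memv_img ?memvf.
have N0 : (#|gT|%:R : K) != 0.
  by rewrite (pcharf0P K).1 // -lt0n; apply/card_gt0P; exists 1%g.
pose y := (#|gT|%:R)^-1 *: \sum_g gelt g * L0 (gelt g^-1%g).
exists y; rewrite /y -scalerAr -scalerAl mulr_sumr mulr_suml.
rewrite [X in _ *: X](_ : _ = \sum_(g : gT) x); last first.
  have -> : \sum_g x * (gelt g * L0 (gelt g^-1%g)) * x =
            \sum_g gelt g * L0 (gelt g^-1%g * x) * x.
    transitivity (\sum_h \sum_g gcoef x h *: (gelt g * L0 (gelt (g^-1 * h)%g) * x)).
      under [RHS]eq_bigr => h _ do rewrite (reindex_inj (mulgI h)) /=.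
      rewrite exchange_big; apply: eq_bigr => g _.
      rewrite {1}[x]galg_sum mulr_suml mulr_suml; apply: eq_bigr => h _.
      by rewrite -!scalerAl mulrA -geltM invMg mulgKV.
    rewrite exchange_big; apply: eq_bigr => g _.
    rewrite [in RHS](_ : gelt _ * x = \sum_h gelt (g^-1)%g * (gcoef x h *: gelt h)).
      rewrite linear_sum mulr_sumr mulr_suml; apply: eq_bigr => h _.
      by rewrite -scalerAr linearZ /= -scalerAr -scalerAl geltM.
    by rewrite -mulr_sumr -galg_sum.
  by apply: eq_bigr => g _; rewrite -mulrA LL0 mulrA -geltM mulgV mul1r.
by rewrite sumr_const -scaler_nat scalerA mulVf ?scale1r.
Qed.

End GroupAlgebra.

Arguments gelt {K gT} g.

(** * Young symmetrizers *)

Section Tableaux.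

Variable N : nat.
Implicit Types (l m : seq nat) (rw cl : 'I_N -> nat).

(** A bijective numbering of the boxes of [l] by ['I_N], recorded by the row and the column of each
    number. Surjectivity follows by counting ([tableau_box]); no monotonicity is imposed. *)
Definition tableau l rw cl :=
  [/\ sumn l = N, forall k, (cl k < nth 0 l (rw k))%N
    & forall k k', rw k = rw k' -> cl k = cl k' -> k = k'].

Definition box_row l (k : 'I_N) := reshape_index l k.
Definition box_col l (k : 'I_N) := reshape_offset l k.

Lemma box_tableau l : sumn l = N -> tableau l (box_row l) (box_col l).
Proof.
move=> e; split=> // [k|k k' er ec]; first by apply: reshape_offsetP; rewrite e.
apply/val_inj; rewrite -[LHS](reshape_indexK l) -[RHS](reshape_indexK l).
by congr flatten_index.
Qed.

(** Reading the boxes row by row turns the numbering into an injective self-map of ['I_N], which is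
    therefore onto. *)
Lemma tableau_box l rw cl r c : tableau l rw cl -> (c < nth 0 l r)%N ->
  exists k, rw k = r /\ cl k = c.
Proof.
case=> e bd inj lt_c.
have ltN k : (flatten_index l (rw k) (cl k) < N)%N by rewrite -[X in (_ < X)%N]e flatten_indexP.
pose f k := Ordinal (ltN k).
have f_inj : injective f.
  move=> k k' /(congr1 val) /= ff; apply: inj.
    by rewrite -(flatten_indexKl (bd k)) ff flatten_indexKl.
  by rewrite -(flatten_indexKr (bd k)) ff flatten_indexKr.
have lt_rc : (flatten_index l r c < N)%N by rewrite -[X in (_ < X)%N]e flatten_indexP.
have [g _ fK] := injF_bij f_inj; exists (g (Ordinal lt_rc)).
have /(congr1 val) /= E := fK (Ordinal lt_rc).
rewrite -(flatten_indexKl (bd _)) E flatten_indexKl //; split=> //.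
by rewrite -(flatten_indexKr (bd _)) E flatten_indexKr.
Qed.

Lemma nth_part l i j : sorted geq l -> (i <= j)%N -> (nth 0 l j <= nth 0 l i)%N.
Proof.
move=> sl le_ij; have [lt_j|ge_j] := ltnP j (size l); last by rewrite nth_default.
apply: (sorted_leq_nth (rev_trans leq_trans) leqnn 0 sl) => //.
by rewrite inE (leq_ltn_trans le_ij).
Qed.

Lemma tableau_row_card l rw cl k : tableau l rw cl ->
  #|[set x | rw x == k]| = nth 0 l k.
Proof.
move=> tl; have [e bd inj] := tl.
have [n0|n_gt0] := posnP (nth 0 l k).
  rewrite n0; apply/eqP; rewrite cards_eq0 -subset0; apply/subsetP => x.
  by rewrite inE => /eqP rx; have := bd x; rewrite rx n0.
pose f x : 'I_(nth 0 l k).-1.+1 := inord (cl x).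
have fE x : rw x = k -> f x = cl x :> nat.
  by move=> rx; rewrite inordK ?prednK // -rx bd.
transitivity #|f @: [set x | rw x == k]|.
  rewrite card_in_imset // => x y; rewrite !inE => /eqP rx /eqP ry.
  by move/(congr1 val); rewrite /= !fE //; apply: inj; rewrite rx.
rewrite (_ : _ @: _ = setT) ?cardsT ?card_ord ?prednK //.
apply/setP => c; rewrite inE; apply/imsetP.
have [|x [rx cx]] := @tableau_box l rw cl k c tl; first by apply: leq_trans (ltn_ord c) _; rewrite prednK.
by exists x; [rewrite inE rx | apply/val_inj; rewrite /= fE].
Qed.

Lemma tableau_rows_card l rw cl k : tableau l rw cl ->
  #|[set x | (rw x < k)%N]| = (\sum_(i < k) nth 0 l i)%N.
Proof.
move=> tl; elim: k => [|k IHk].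
  by rewrite big_ord0; apply/eqP; rewrite cards_eq0 -subset0; apply/subsetP => x; rewrite inE.
rewrite big_ord_recr /= -IHk -(tableau_row_card k tl) -cardsUI.
rewrite (_ : _ :&: _ = set0) ?cards0 ?addn0.
  apply: eq_card => x; rewrite !inE ltnS leq_eqVlt orbC //.
by apply/setP => x; rewrite !inE; case: eqP => [->|]; rewrite ?ltnn ?andbF.
Qed.

Section Pair.

Variables (l m : seq nat) (rw cl1 rw2 cl : 'I_N -> nat).
Hypotheses (tl : tableau l rw cl1) (tm : tableau m rw2 cl) (sm : sorted geq m).
Hypothesis rc_inj : forall x y, rw x = rw y -> cl x = cl y -> x = y.

Let S j k := [set x | (cl x == j) && (rw x < k)%N].
Let S2 j k := [set x | (cl x == j) && (rw2 x < k)%N].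

(** Numbers in one column of the second tableau lie in distinct rows of the first, so at most [k] of
    them are in its first [k] rows. If the column is longer than [k], the second tableau has [k] of
    them there; otherwise it has the whole column there. *)
Lemma leq_card_column j k : (#|S j k| <= #|S2 j k|)%N.
Proof.
have [/existsP[x /andP[/eqP cx rx]]|] := boolP [exists x, (cl x == j) && (k <= rw2 x)%N].
  apply: (@leq_trans k).
    case: k rx => [|k] rx.
      by rewrite leqn0 cards_eq0 -subset0; apply/subsetP => y; rewrite inE andbF.
    pose f x : 'I_k.+1 := inord (rw x).
    rewrite -(card_in_imset (f := f)); first by rewrite -[X in (_ <= X)%N]card_ord max_card.
    move=> y z; rewrite !inE => /andP[/eqP cy ry] /andP[/eqP cz rz].
    by move/(congr1 val); rewrite /= !inordK // => e; apply: rc_inj; rewrite // cy cz.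
  have ex (r : 'I_k) : exists y, (rw2 y == r) && (cl y == j).
    have [|y [<- <-]] := @tableau_box m rw2 cl r j tm; last by exists y; rewrite !eqxx.
    case: tm => _ bd _; rewrite -cx; apply: leq_trans (bd x) _.
    by rewrite nth_part // (leq_trans _ rx) // ltnW.
  pose g r := xchoose (ex r).
  have gP r : rw2 (g r) = r /\ cl (g r) = j.
    by have /andP[/eqP-> /eqP->] := xchooseP (ex r).
  have g_inj : injective g by move=> r r' e; apply/val_inj; rewrite /= -(gP r).1 e (gP r').1.
  rewrite -[X in (X <= _)%N]card_ord -(card_imset _ g_inj) subset_leq_card //.
  by apply/subsetP => _ /imsetP[r _ ->]; rewrite inE (gP r).1 (gP r).2 eqxx /=.
rewrite negb_exists => /forallP H; apply/subset_leq_card/subsetP => x.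
rewrite !inE => /andP[cx _]; rewrite cx /= ltnNge.
by have := H x; rewrite cx.
Qed.

Lemma sum_card_columns (f : 'I_N -> nat) k :
  #|[set x | (f x < k)%N]| =
  (\sum_(j < (\max_x cl x).+1) #|[set x | (cl x == j) && (f x < k)%N]|)%N.
Proof.
rewrite -sum1_card (partition_big (fun x => inord (cl x) : 'I_(\max_x cl x).+1) predT) //=.
apply: eq_bigr => j _; rewrite -sum1_card; apply: eq_bigl => x; rewrite !inE andbC.
congr (_ && _); apply/eqP/eqP => [<-|e]; last by apply/val_inj; rewrite /= inordK e.
by rewrite inordK // ltnS leq_bigmax.
Qed.

Lemma tableau_pair_dom k : (\sum_(i < k) nth 0 l i <= \sum_(i < k) nth 0 m i)%N.
Proof.
rewrite -(tableau_rows_card k tl) -(tableau_rows_card k tm) !sum_card_columns.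
by apply: leq_sum => j _; apply: leq_card_column.
Qed.

Hypothesis lm : forall i, nth 0 l i = nth 0 m i.

Lemma card_column_eq j k : #|S j k| = #|S2 j k|.
Proof.
have [lt_j|ge_j] := ltnP j (\max_x cl x).+1; last first.
  have e0 (f : 'I_N -> nat) : #|[set x | (cl x == j) && (f x < k)%N]| = 0%N.
    apply/eqP; rewrite cards_eq0 -subset0; apply/subsetP => x; rewrite inE.
    by move=> /andP[/eqP cx _]; move: ge_j; rewrite -cx ltnNge leq_bigmax.
  by rewrite !e0.
have e : (\sum_(j < (\max_x cl x).+1) #|S j k| = \sum_(j < (\max_x cl x).+1) #|S2 j k|)%N.
  rewrite -!sum_card_columns (tableau_rows_card k tl) (tableau_rows_card k tm).
  by apply: eq_bigr => i _; rewrite lm.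
apply/eqP; rewrite eqn_leq leq_card_column leqNgt; apply/negP => lt.
move/eqP: e; rewrite eqn_leq andbC => /andP[+ _]; rewrite leqNgt => /negP; apply.
rewrite (bigD1 (Ordinal lt_j)) //= [X in (_ < X)%N](bigD1 (Ordinal lt_j)) //=.
by rewrite -addSn leq_add // leq_sum // => i _; apply: leq_card_column.
Qed.

(** For equal shapes the inequalities of [leq_card_column] are equalities. Each column of the second
    tableau then contains as many numbers from row k of the first tableau as from row k of the
    second, and a column permutation matches them. *)
Lemma tableau_pair_perm :
  exists c : 'S_N, forall x, cl (c x) = cl x /\ rw2 (c x) = rw x.
Proof.
have cardE (f : 'I_N -> nat) j k : (#|[set x | (cl x == j) && (f x == k)]| =
   #|[set x | (cl x == j) && (f x < k.+1)%N]| - #|[set x | (cl x == j) && (f x < k)%N]|)%N.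
  rewrite -cardsDS; last first.
    by apply/subsetP => x; rewrite !inE => /andP[-> /ltnW].
  apply: eq_card => x; rewrite !inE ltnS; case: (cl x == j) => //=.
  by rewrite -leqNgt eqn_leq andbC.
have ex x : exists y, (cl y == cl x) && (rw2 y == rw x).
  have : (0 < #|[set y | (cl y == cl x) && (rw y == rw x)]|)%N.
    by apply/card_gt0P; exists x; rewrite inE !eqxx.
  rewrite cardE !card_column_eq -cardE => /card_gt0P[y].
  by rewrite inE => yP; exists y.
pose c x := xchoose (ex x).
have cP x : cl (c x) = cl x /\ rw2 (c x) = rw x.
  by have /andP[/eqP-> /eqP->] := xchooseP (ex x).
have c_inj : injective c.
  by move=> x y e; apply: rc_inj; rewrite -?(cP x).1 -?(cP y).1 -?(cP x).2 -?(cP y).2 e.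
by exists (perm c_inj) => x; rewrite permE.
Qed.

End Pair.

End Tableaux.

(** The dominance order. *)
Definition pdom (l m : seq nat) := forall k, (\sum_(i < k) nth 0 l i <= \sum_(i < k) nth 0 m i)%N.

Lemma pdom_nth l m : pdom l m -> pdom m l -> forall i, nth 0%N l i = nth 0%N m i.
Proof.
move=> lm ml i; have e k : (\sum_(j < k) nth 0 l j = \sum_(j < k) nth 0 m j)%N.
  by apply/eqP; rewrite eqn_leq lm ml.
by have := e i.+1; rewrite !big_ord_recr /= e => /addnI.
Qed.

Lemma natr_neq0 (K : fieldType) : [pchar K] =i pred0 -> forall n, (0 < n)%N -> n%:R != 0 :> K.
Proof. by move=> char0 n; rewrite (pcharf0P K).1 // lt0n. Qed.

Lemma eq_oppr0 (K : fieldType) (V : lmodType K) (v : V) :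
  [pchar K] =i pred0 -> v = - v -> v = 0.
Proof.
move=> char0 /eqP; rewrite -subr_eq0 opprK -mulr2n -scaler_nat scaler_eq0.
by rewrite (negPf (natr_neq0 char0 _)) //= => /eqP.
Qed.

Lemma prod_nat_bool (K : fieldType) (I : finType) (P : pred I) : \prod_i (P i)%:R = [forall i, P i]%:R :> K.
Proof.
case: (boolP [forall i, _]) => [/forallP H|/forallPn[i ni]].
  by rewrite big1 // => i _; rewrite H.
by rewrite (bigD1 i) //= (negPf ni) mul0r.
Qed.

Lemma tableau_perm N l (rw cl : 'I_N -> nat) (g : 'S_N) :
  tableau l rw cl -> tableau l (rw \o g) (cl \o g).
Proof.
by case=> e bd inj; split=> // [k|k k' r c] /=; [apply: bd | apply: (@perm_inj _ g); apply: inj].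
Qed.

Section YoungSymmetrizers.

Variables (K : fieldType) (N : nat).
Hypothesis char0 : [pchar K] =i pred0.
Implicit Types (l m : seq nat) (s t g : 'S_N).
Local Notation A := (galg K 'S_N).

Definition rowg l : {set 'S_N} :=
  [set s : 'S_N | [forall k, box_row l (s k) == box_row l k]].
Definition colg l : {set 'S_N} :=
  [set s : 'S_N | [forall k, box_col l (s k) == box_col l k]].

Definition rsum l : A := \sum_(s in rowg l) gelt s.
Definition csum l : A := \sum_(s in colg l) (-1) ^+ s *: gelt s.
(** The row sum stands first because the group algebra acts on tensors from the right: this product
    acts as row symmetrization followed by column antisymmetrization, that is, as
    [young_symmetrizer] (see [young_trho]). *)
Definition young l : A := rsum l * csum l.

Lemma rowgP l s : reflect (forall k, box_row l (s k) = box_row l k) (s \in rowg l).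
Proof. by rewrite inE; apply: (iffP forallP) => H k; apply/eqP/H. Qed.

Lemma colgP l s : reflect (forall k, box_col l (s k) = box_col l k) (s \in colg l).
Proof. by rewrite inE; apply: (iffP forallP) => H k; apply/eqP/H. Qed.

Lemma rowg_group l : group_set (rowg l).
Proof.
apply/group_setP; split=> [|s t /rowgP Hs /rowgP Ht]; apply/rowgP => k.
  by rewrite perm1.
by rewrite permM Ht Hs.
Qed.
Canonical rowg_groupType l := Group (rowg_group l).

Lemma colg_group l : group_set (colg l).
Proof.
apply/group_setP; split=> [|s t /colgP Hs /colgP Ht]; apply/colgP => k.
  by rewrite perm1.
by rewrite permM Ht Hs.
Qed.
Canonical colg_groupType l := Group (colg_group l).

Lemma rsum_l l s : s \in rowg l -> gelt s * rsum l = rsum l.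
Proof.
move=> sR; rewrite /rsum mulr_sumr [RHS](reindex_inj (mulgI s)) /=.
by apply: eq_big => [t|t _]; rewrite ?geltM // (groupMl _ sR).
Qed.

Lemma rsum_r l s : s \in rowg l -> rsum l * gelt s = rsum l.
Proof.
move=> sR; rewrite /rsum mulr_suml [RHS](reindex_inj (mulIg s)) /=.
by apply: eq_big => [t|t _]; rewrite ?geltM // (groupMr _ sR).
Qed.

Lemma signr_permM s t : (-1) ^+ s * (-1) ^+ (s * t)%g = (-1) ^+ t :> K.
Proof. by rewrite odd_permM signr_addb mulrA -expr2 sqrr_sign mul1r. Qed.

Lemma csum_l l s : s \in colg l -> gelt s * csum l = (-1) ^+ s *: csum l.
Proof.
move=> sC; rewrite /csum mulr_sumr scaler_sumr [RHS](reindex_inj (mulgI s)) /=.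
apply: eq_big => [t|t _]; first by rewrite (groupMl _ sC).
by rewrite scalerA signr_permM -scalerAr geltM.
Qed.

Lemma csum_r l s : s \in colg l -> csum l * gelt s = (-1) ^+ s *: csum l.
Proof.
move=> sC; rewrite /csum mulr_suml scaler_sumr [RHS](reindex_inj (mulIg s)) /=.
apply: eq_big => [t|t _]; first by rewrite (groupMr _ sC).
by rewrite scalerA odd_permM addbC -odd_permM signr_permM -scalerAl geltM.
Qed.

Lemma tperm_conj s x y : (tperm x y * s = s * tperm (s x) (s y))%g.
Proof. by rewrite -tpermJ conjgE mulKVg. Qed.

(** The row sum absorbs the transposition of [x] and [y]. Moved past [s], it becomes a column
    transposition of [m] and changes the sign of [csum m]; so the product equals its opposite. *)
Lemma rsum_csum0 l m s x y : x != y -> box_row l x = box_row l y ->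
  box_col m (s x) = box_col m (s y) -> rsum l * gelt s * csum m = 0.
Proof.
move=> xy rx cy; apply: (eq_oppr0 char0).
have tR : tperm x y \in rowg l.
  by apply/rowgP => k; case: tpermP => // ->.
have tC : tperm (s x) (s y) \in colg m.
  by apply/colgP => k; case: tpermP => // ->.
rewrite -{1}(rsum_r tR) (geltM_eq _ _ (tperm_conj s x y)) (csum_l tC).
by rewrite odd_tperm (inj_eq perm_inj) xy expr1 scaleN1r mulrN.
Qed.

Lemma csum_rsum0 l m s x y : x != y -> box_col l x = box_col l y ->
  box_row m (s x) = box_row m (s y) -> csum l * gelt s * rsum m = 0.
Proof.
move=> xy rx cy; apply: (eq_oppr0 char0).
have tC : tperm x y \in colg l.
  by apply/colgP => k; case: tpermP => // ->.
have tR : tperm (s x) (s y) \in rowg m.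
  by apply/rowgP => k; case: tpermP => // ->.
rewrite -[in RHS](rsum_l tR) -(geltM_eq _ _ (tperm_conj s x y)) (csum_r tC).
by rewrite odd_tperm xy expr1 scaleN1r !mulNr opprK.
Qed.

Lemma rsum_csum_pair l m s : sumn l = N -> sumn m = N -> sorted geq m ->
  rsum l * gelt s * csum m = 0 \/
  (forall x y, box_row l x = box_row l y -> box_col m (s x) = box_col m (s y) -> x = y).
Proof.
move=> el em sm.
have [/existsP[x /existsP[y /and3P[xy /eqP rx /eqP cx]]]|] :=
  boolP [exists x, exists y, [&& x != y, box_row l x == box_row l y
                              & box_col m (s x) == box_col m (s y)]].
  by left; apply: (rsum_csum0 xy rx cx).
move=> H; right => x y rx cx; apply/eqP; apply: contraNT H => xy.
by apply/existsP; exists x; apply/existsP; exists y; rewrite xy rx cx !eqxx.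
Qed.

Lemma csum_rsum_pair l m s : sumn l = N -> sumn m = N ->
  csum l * gelt s * rsum m = 0 \/
  (forall x y, box_row m (s x) = box_row m (s y) -> box_col l x = box_col l y -> x = y).
Proof.
move=> el em.
have [/existsP[x /existsP[y /and3P[xy /eqP rx /eqP cx]]]|] :=
  boolP [exists x, exists y, [&& x != y, box_row m (s x) == box_row m (s y)
                              & box_col l x == box_col l y]].
  by left; apply: (csum_rsum0 xy cx rx).
move=> H; right => x y rx cx; apply/eqP; apply: contraNT H => xy.
by apply/existsP; exists x; apply/existsP; exists y; rewrite xy rx cx !eqxx.
Qed.

Lemma rsum_csum_dom l m z : sumn l = N -> sumn m = N -> sorted geq m ->
  rsum l * z * csum m = 0 \/ pdom l m.
Proof.
move=> el em sm.
have [e|/forallPn[g ng]] := boolP [forall g, rsum l * gelt g * csum m == 0].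
  left; rewrite galg_mul_sum big1 // => g _.
  by rewrite (eqP (forallP e g)) scaler0.
right=> k; have [e|H] := rsum_csum_pair g el em sm; first by rewrite e eqxx in ng.
exact: (tableau_pair_dom (box_tableau el) (tableau_perm g (box_tableau em)) sm H).
Qed.

Lemma csum_rsum_dom l m z : sumn l = N -> sumn m = N -> sorted geq l ->
  csum l * z * rsum m = 0 \/ pdom m l.
Proof.
move=> el em sl.
have [e|/forallPn[g ng]] := boolP [forall g, csum l * gelt g * rsum m == 0].
  left; rewrite galg_mul_sum big1 // => g _.
  by rewrite (eqP (forallP e g)) scaler0.
right=> k; have [e|H] := csum_rsum_pair g el em; first by rewrite e eqxx in ng.
exact: (tableau_pair_dom (tableau_perm g (box_tableau em)) (box_tableau el) sl H).
Qed.

(** If the product is nonzero, its outer factors [rsum l] and [csum m] force [l] to be dominated by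
    [m], while the inner ones [csum l] and [rsum m] force the converse. *)
Lemma young_orth l m z : sumn l = N -> sumn m = N -> sorted geq l -> sorted geq m ->
  (exists i, nth 0%N l i != nth 0%N m i) -> young l * z * young m = 0.
Proof.
move=> el em sl sm [i ni]; rewrite /young.
have [e|lm] := rsum_csum_dom (csum l * z * rsum m) el em sm.
  by rewrite -[RHS]e !mulrA.
have [e|ml] := csum_rsum_dom z el em sl.
  by rewrite !mulrA -(mulrA (rsum l)) -(mulrA (rsum l)) e mulr0 mul0r.
by rewrite (pdom_nth lm ml) eqxx in ni.
Qed.

(** By linearity [z] may be a permutation [g]. Unless the product vanishes, no two numbers share a
    row of the diagram and a column of its translate by [g]; then [tableau_pair_perm] factors [g] as
    a row permutation times a column permutation, and both are absorbed up to sign. *)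
Lemma rsum_csum_scalar l z : sumn l = N -> sorted geq l ->
  exists k : K, rsum l * z * csum l = k *: young l.
Proof.
move=> el sl.
have ex g : exists k : K, rsum l * gelt g * csum l == k *: young l.
  have [->|H] := rsum_csum_pair g el el sl; first by exists 0; rewrite scale0r.
  have tl := box_tableau el.
  have [c cP] := tableau_pair_perm tl (tableau_perm g tl) sl H (fun=> erefl).
  have rR : (c * g)%g \in rowg l by apply/rowgP => x; rewrite permM; apply: (cP x).2.
  have cC : (c ^ g)%g \in colg l.
    apply/colgP => x; rewrite conjgE !permM -[in RHS](permKV g x).
    exact: (cP _).1.
  have -> : g = ((c * g) * (c ^ g)^-1)%g by rewrite conjgE invMg invgK mulKVg.
  rewrite geltM mulrA rsum_r //; exists ((-1) ^+ (c ^ g)^-1%g).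
  by rewrite -mulrA (csum_l (groupVr cC)) -scalerAr.
exists (\sum_g gcoef z g * xchoose (ex g)); rewrite galg_mul_sum scaler_suml.
by apply: eq_bigr => g _; rewrite -scalerA -(eqP (xchooseP (ex g))).
Qed.

Lemma young_scalar l z : sumn l = N -> sorted geq l ->
  exists k : K, young l * z * young l = k *: young l.
Proof.
move=> el sl; have [k e] := rsum_csum_scalar (csum l * z * rsum l) el sl.
by exists k; rewrite -e /young !mulrA.
Qed.

(** The row group and the column group meet only in the identity. *)
Lemma young_coef1 l : sumn l = N -> gcoef (young l) 1%g = 1.
Proof.
move=> el; have [_ _ inj] := box_tableau el.
rewrite /young /rsum mulr_suml gcoef_sum (bigD1 1%g) //=.
rewrite gelt1 mul1r /csum gcoef_sum (bigD1 1%g) //=.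
rewrite gcoefZ gcoef_elt odd_perm1 eqxx mulr1 big1 ?addr0 => [|s /andP[_ s1]]; last first.
  by rewrite gcoefZ gcoef_elt eq_sym (negPf s1) mulr0.
rewrite big1 ?addr0 // => s /andP[/rowgP sR s1].
rewrite mulr_sumr gcoef_sum big1 // => t /colgP tC.
rewrite -scalerAr -geltM gcoefZ gcoef_elt; case: eqP => [e|]; last by rewrite mulr0.
case/eqP: s1; apply/permP => x; rewrite perm1; apply: inj; first exact: sR.
have := tC (s x); rewrite -permM -e perm1 => ->; by [].
Qed.

End YoungSymmetrizers.

(** * Cycle types, partitions and the completeness of Young symmetrizers *)

Section CycleTypes.

Variable N : nat.
Implicit Types s t : 'S_N.

Definition cycle_roots s :=
  sort (fun x y => fingraph.order s y <= fingraph.order s x)%N (enum (froots s)).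
Definition cycle_type s := [seq fingraph.order s x | x <- cycle_roots s].

Let crow s x := index (froot s x) (cycle_roots s).
Let ccol s x := findex s (froot s x) x.

Lemma mem_cycle_roots s x : (x \in cycle_roots s) = (froot s x == x).
Proof. by rewrite mem_sort mem_enum. Qed.

Lemma cycle_root_mem s x : froot s x \in cycle_roots s.
Proof. by rewrite mem_cycle_roots root_root //; apply/fconnect_sym/perm_inj. Qed.

Lemma cycle_root_connect s x : fconnect s (froot s x) x.
Proof. by rewrite (fconnect_sym (@perm_inj _ s)) connect_root. Qed.

Lemma nth_cycle_type s x : nth 0%N (cycle_type s) (crow s x) = fingraph.order s (froot s x).
Proof.
by rewrite (nth_map x) ?index_mem ?cycle_root_mem // nth_index ?cycle_root_mem.
Qed.

Lemma cycle_type_sorted s : sorted geq (cycle_type s).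
Proof.
rewrite sorted_map; apply: (@sort_sorted _ (relpre (fingraph.order s) geq)) => x y /=.
exact: leq_total.
Qed.

Lemma cycle_type_neq0 s : 0%N \notin cycle_type s.
Proof.
by apply/mapP => -[x _ /eqP]; rewrite eq_sym -leqn0 leqNgt fingraph.order_gt0.
Qed.

Lemma sumn_cycle_type s : sumn (cycle_type s) = N.
Proof.
have fs := fconnect_sym (@perm_inj _ s).
rewrite sumnE big_map /cycle_roots (perm_big _ (permEl (perm_sort _ _))) /=.
rewrite big_enum /= -[RHS]card_ord -sum1_card.
rewrite [RHS](partition_big (froot s) (froots s)) => [|x _]; last exact: roots_root.
apply: eq_bigr => x /eqP rx; rewrite /fingraph.order -sum1_card.
by apply: eq_bigl => y; rewrite !inE -{2}rx (root_connect fs) fs.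
Qed.

(** One row per cycle, written along the cycle from its root. In these coordinates [s] is the cyclic
    shift of every row ([crow_perm], [ccol_perm]). *)
Lemma cycle_tableau s : tableau (cycle_type s) (crow s) (ccol s).
Proof.
split=> [|x|x y rxy cxy]; first exact: sumn_cycle_type.
  by rewrite nth_cycle_type findex_max ?cycle_root_connect.
have e : froot s x = froot s y.
  by rewrite -(nth_index x (cycle_root_mem s x)) -[index _ _]/(crow s x) rxy nth_index ?cycle_root_mem.
rewrite -(iter_findex (cycle_root_connect s x)) -(iter_findex (cycle_root_connect s y)).
by rewrite -[findex _ _ x]/(ccol s x) cxy e.
Qed.

Lemma crow_perm s x : crow s (s x) = crow s x.
Proof.
rewrite /crow; congr index; apply/eqP.
by rewrite (root_connect (fconnect_sym (@perm_inj _ s))) (fconnect_sym (@perm_inj _ s)) fconnect1.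
Qed.

Lemma ccol_perm s x :
  ccol s (s x) = ((ccol s x).+1 %% nth 0 (cycle_type s) (crow s x))%N.
Proof.
have e : froot s (s x) = froot s x.
  apply/eqP.
  by rewrite (root_connect (fconnect_sym (@perm_inj _ s))) (fconnect_sym (@perm_inj _ s)) fconnect1.
rewrite /ccol e nth_cycle_type; set r := froot s x.
have lt := findex_max (cycle_root_connect s x).
have sx : s x = iter (findex s r x).+1 s r by rewrite iterS iter_findex ?cycle_root_connect.
have [lt1|ge1] := ltnP (findex s r x).+1 (fingraph.order s r).
  by rewrite modn_small // sx findex_iter.
have E : (findex s r x).+1 = fingraph.order s r by apply/eqP; rewrite eqn_leq lt ge1.
by rewrite E modnn sx E iter_order ?findex0 //; apply: perm_inj.
Qed.

(** Identifying the boxes of the two cycle tableaux carries one cyclic shift to the other. *)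
Lemma cycle_type_conj s t : cycle_type s = cycle_type t -> exists c, t = (s ^ c)%g.
Proof.
move=> e; have ts := cycle_tableau s; have tt := cycle_tableau t.
have ex x : exists y, (crow t y == crow s x) && (ccol t y == ccol s x).
  have [_ bd _] := ts; have := bd x; rewrite {1}e => /(tableau_box tt)[y [<- <-]].
  by exists y; rewrite !eqxx.
pose c x := xchoose (ex x).
have cP x : crow t (c x) = crow s x /\ ccol t (c x) = ccol s x.
  by have /andP[/eqP-> /eqP->] := xchooseP (ex x).
have c_inj : injective c.
  have [_ _ inj] := ts; move=> x y exy; apply: inj.
    by rewrite -(cP x).1 -(cP y).1 exy.
  by rewrite -(cP x).2 -(cP y).2 exy.
exists (perm c_inj); rewrite conjgE; apply: (mulgI (perm c_inj)).
rewrite mulKVg; apply/permP => x; rewrite !permM !permE.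
have [_ _ inj] := tt; apply: inj.
  by rewrite crow_perm (cP _).1 (cP _).1 crow_perm.
by rewrite ccol_perm (cP _).1 (cP _).2 (cP _).2 ccol_perm e.
Qed.

End CycleTypes.

(** A partition of [N] has at most [N] parts, each at most [N]; padded by zeros it is one of
    finitely many tuples. *)
Definition parts_of N : seq (seq nat) :=
  undup [seq l <- [seq [seq i <- map val (tval t) | i != 0%N]
                   | t <- enum {: N.-tuple 'I_N.+1}]
         | [&& sorted geq l, 0%N \notin l & sumn l == N]].

Lemma mem_parts_of N l :
  (l \in parts_of N) = [&& sorted geq l, 0%N \notin l & sumn l == N].
Proof.
rewrite mem_undup mem_filter; case P: [&& _, _ & _] => //=.
have [sl l0 /eqP el] := and3P P; apply/mapP.
have size_le (k : seq nat) : 0%N \notin k -> (size k <= sumn k)%N.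
  elim: k => //= a k IHk; rewrite inE negb_or eq_sym => /andP[a0 /IHk le].
  by rewrite -add1n leq_add // lt0n.
have le_sz : (size l <= N)%N by rewrite -[X in (_ <= X)%N]el size_le.
have le_el i : i \in l -> (i <= N)%N.
  by move=> il; rewrite -el sumnE (big_rem i) //= leq_addr.
pose k : seq 'I_N.+1 := [seq inord i | i <- l] ++ nseq (N - size l) ord0.
have sk : size k == N by rewrite size_cat size_map size_nseq subnKC.
exists (Tuple sk); first by rewrite mem_enum.
rewrite /= /k map_cat filter_cat -map_comp.
rewrite (_ : filter _ (map _ (nseq _ _)) = [::]) ?cats0; last first.
  by elim: (N - size l)%N => //=.
rewrite (_ : map _ l = l); last first.
  by rewrite -[RHS]map_id; apply/eq_in_map => i /le_el le /=; rewrite inordK.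
by apply/esym/all_filterP/allP => i il; apply: contraNneq l0 => <-.
Qed.

Lemma parts_of_uniq N : uniq (parts_of N). Proof. exact: undup_uniq. Qed.

Lemma cycle_type_part N (s : 'S_N) : cycle_type s \in parts_of N.
Proof.
by rewrite mem_parts_of cycle_type_sorted cycle_type_neq0 sumn_cycle_type eqxx.
Qed.

Lemma part_neq_nth (l m : seq nat) : 0%N \notin l -> 0%N \notin m -> l != m ->
  exists i, nth 0%N l i != nth 0%N m i.
Proof.
move=> l0 m0 lm.
have [e|] := boolP [forall i : 'I_(maxn (size l) (size m)), nth 0%N l i == nth 0%N m i].
  have E i : nth 0%N l i = nth 0%N m i.
    have [lt|ge] := ltnP i (maxn (size l) (size m)).
      exact/eqP/(forallP e (Ordinal lt)).
    by move: ge; rewrite geq_max => /andP[? ?]; rewrite !nth_default.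
  have sz (a b : seq nat) : 0%N \notin b -> (forall i, nth 0%N a i = nth 0%N b i) ->
      (size b <= size a)%N.
    move=> b0 ab; rewrite leqNgt; apply: contra b0 => lt.
    by rewrite -(nth_default 0%N (leqnn (size a))) ab mem_nth.
  case/eqP: lm; apply: (@eq_from_nth _ 0%N) => // .
  by apply/eqP; rewrite eqn_leq !sz.
by case/forallPn=> i ni; exists i.
Qed.

Section Completeness.

Variables (K : fieldType) (N : nat).
Hypothesis char0 : [pchar K] =i pred0.
Local Notation A := (galg K 'S_N).

(** The sum over all conjugates makes the symmetrizer central ([young_class_comm]). *)
Definition young_class (l : seq nat) : A := \sum_(g : 'S_N) gelt g^-1%g * young K N l * gelt g.

Lemma young_class_conj l (h : 'S_N) :
  gelt h^-1%g * young_class l * gelt h = young_class l.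
Proof.
rewrite /young_class mulr_sumr mulr_suml [RHS](reindex_inj (mulIg h)) /=.
by apply: eq_bigr => g _; rewrite invMg !geltM !mulrA.
Qed.

Lemma young_class_comm l x : young_class l * x = x * young_class l.
Proof.
rewrite [x]galg_sum mulr_sumr mulr_suml; apply: eq_bigr => g _.
rewrite -scalerAr -scalerAl; congr (_ *: _).
by rewrite -{2}(young_class_conj l g) !mulrA -geltM mulgV gelt1 mul1r.
Qed.

Lemma young_class_coef l (s c : 'S_N) :
  gcoef (young_class l) (s ^ c)%g = gcoef (young_class l) s.
Proof.
rewrite -{1}(young_class_conj l c) {1}[young_class l]galg_sum mulr_sumr mulr_suml.
rewrite gcoef_sum (bigD1 s) //= -scalerAr -scalerAl -!geltM gcoefZ gcoef_elt.
rewrite conjgE mulgA eqxx mulr1 big1 ?addr0 // => t ts.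
rewrite -scalerAr -scalerAl -!geltM gcoefZ gcoef_elt -mulgA -[X in (_ == X)]mulgA.
by rewrite (inj_eq (mulgI _)) (inj_eq (mulIg _)) eq_sym (negPf ts) mulr0.
Qed.

Lemma young_class_neq0 l : sumn l = N -> young_class l != 0.
Proof.
move=> el; apply/eqP => /(congr1 (fun x => gcoef x 1%g)); rewrite gcoef_sum.
under eq_bigr => g _.
  rewrite {1}[young K N l]galg_sum mulr_sumr mulr_suml gcoef_sum (bigD1 1%g) //=.
  rewrite big1 ?addr0 => [|t t1]; last first.
    rewrite -scalerAr -scalerAl -!geltM gcoefZ gcoef_elt.
    rewrite -{1}(mulVg g) -mulgA (inj_eq (mulgI _)) -{1}[g]mul1g (inj_eq (mulIg _)).
    by rewrite eq_sym (negPf t1) mulr0.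
  rewrite -scalerAr -scalerAl -!geltM gcoefZ gcoef_elt mulg1 mulVg eqxx mulr1.
  rewrite (young_coef1 K el); over.
rewrite sumr_const /gcoef ffunE => /eqP; apply/negP/natr_neq0 => //.
by apply/card_gt0P; exists 1%g.
Qed.

Lemma young_class_orth l m : l \in parts_of N -> m \in parts_of N -> l != m ->
  young_class l * young_class m = 0.
Proof.
rewrite !mem_parts_of => /and3P[sl l0 /eqP el] /and3P[sm m0 /eqP em] lm.
rewrite /young_class mulr_suml big1 // => g _; rewrite mulr_sumr big1 // => h _.
transitivity (gelt g^-1%g * (young K N l * (gelt g * gelt h^-1%g) * young K N m) * gelt h).
  by rewrite !mulrA.
rewrite (young_orth char0 _ el em sl sm (part_neq_nth l0 m0 lm)).
by rewrite mulr0 mul0r.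
Qed.

(** A central element z of square zero vanishes, because z = z y z = z z y for some y. *)
Lemma young_class_sqr l : sumn l = N -> young_class l * young_class l != 0.
Proof.
move=> el; apply/eqP => e; have /eqP := young_class_neq0 el; apply.
have [y <-] := galg_regular (young_class l) char0.
by rewrite -mulrA -young_class_comm mulrA e mul0r.
Qed.

Lemma young_class_free : free [seq young_class l | l <- parts_of N].
Proof.
set X := map _ _; change (free (in_tuple X)); apply/freeP => k e i.
have szX : size X = size (parts_of N) by rewrite size_map.
have lt_i : (i < size (parts_of N))%N by rewrite -szX.
pose l j := nth [::] (parts_of N) j.
have Xl (j : 'I_(size X)) : X`_j = young_class (l j).
  by rewrite /X (nth_map [::]) // -szX.
have lP (j : 'I_(size X)) : l j \in parts_of N.
  by rewrite mem_nth // -szX.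
have [_ _ /eqP li] : [/\ sorted geq (l i), 0%N \notin l i & sumn (l i) == N].
  by apply/and3P; rewrite -mem_parts_of.
have := congr1 (fun x => x * young_class (l i)) e; rewrite /=.
rewrite mul0r mulr_suml (bigD1 i) //= big1 ?addr0 => [|j ji]; last first.
  rewrite Xl -scalerAl young_class_orth ?scaler0 // nth_uniq ?parts_of_uniq -?szX ?ltn_ord //.
rewrite Xl -scalerAl => /eqP; rewrite scaler_eq0 => /orP[/eqP //|].
by rewrite (negPf (young_class_sqr li)).
Qed.

(** The elements [young_class l], being orthogonal with nonzero squares, are linearly independent,
    and there are as many as partitions of [N]. They lie in the space of class functions, which is
    spanned by as many indicators of cycle types. So they span that space, and it contains 1. *)
Lemma young_complete : exists (J : finType) (x y : J -> A) (l : J -> seq nat),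
  (forall j, l j \in parts_of N) /\ 1 = \sum_j x j * young K N (l j) * y j.
Proof.
pose ind (l : seq nat) : A := \sum_(s : 'S_N | cycle_type s == l) gelt s.
pose X := [seq young_class l | l <- parts_of N].
pose Y := [seq ind l | l <- parts_of N].
have inY (z : A) : (forall s c, gcoef z (s ^ c)%g = gcoef z s) -> z \in <<Y>>%VS.
  move=> zc.
  have -> : z = \sum_(l <- parts_of N) \sum_(s : 'S_N | cycle_type s == l)
                  gcoef z s *: gelt s.
    rewrite {1}[z]galg_sum (exchange_big_dep predT) //=; apply: eq_bigr => s _.
    rewrite -big_filter (perm_big [:: cycle_type s]) ?big_seq1 //=.
    apply: uniq_perm; rewrite ?filter_uniq ?parts_of_uniq // => l.
    rewrite mem_filter inE eq_sym; case: eqP => //= ->; exact: cycle_type_part.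
  rewrite big_seq; apply: memv_suml => l lP.
  have [s0 /eqP s0l|no] := pickP (fun s : 'S_N => cycle_type s == l); last first.
    by rewrite big1 ?mem0v // => s sl; rewrite no in sl.
  rewrite (_ : \sum_(s | _) _ = gcoef z s0 *: ind l).
    by rewrite memvZ // memv_span // map_f.
  rewrite /ind scaler_sumr; apply: eq_bigr => s /eqP sl; congr (_ *: _).
  have [c ->] := cycle_type_conj (etrans s0l (esym sl)).
  exact: zc.
have XY : <<X>>%VS = <<Y>>%VS.
  apply/eqP; rewrite eqEdim; apply/andP; split.
    apply/span_subvP => _ /mapP[l _ ->]; apply: inY => s c; exact: young_class_coef.
  apply: leq_trans (dim_span _) _.
  by have := young_class_free; rewrite /free size_map -/X => /eqP->; rewrite size_map.
have : 1 \in <<X>>%VS.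
  rewrite XY; apply: inY => s c; rewrite !gcoef_elt.
  by rewrite -(inj_eq (mulgI c)) conjgE mulKVg mulg1 -{2}[c]mul1g (inj_eq (mulIg _)).
rewrite -[X]/(in_tuple X : seq _) => /coord_span ->.
pose k i := coord (in_tuple X) i 1.
exists ('I_(size X) * 'S_N)%type, (fun j => k j.1 *: gelt j.2^-1%g), (fun j => gelt j.2),
  (fun j => nth [::] (parts_of N) (val j.1)).
have lt (i : 'I_(size X)) : (i < size (parts_of N))%N.
  by apply: leq_trans (ltn_ord i) _; rewrite size_map.
split=> [j|]; first by apply/mem_nth/lt.
rewrite -(pair_bigA _ (fun i g => k i *: gelt g^-1%g *
   young K N (nth [::] (parts_of N) i) * gelt g)) /=.
apply: eq_bigr => i _; rewrite (nth_map [::]) // /young_class scaler_sumr.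
by apply: eq_bigr => g _; rewrite -!scalerAl.
Qed.

End Completeness.

(** * Products of symmetric groups *)

Section ProductGroup.

Variables (K : fieldType) (I : finType) (gT : I -> finGroupType).
Local Notation G := {dffun forall i, gT i}.
Implicit Types x y z : forall i, galg K (gT i).

Definition gtens x : galg K G := [ffun g : G => \prod_i gcoef (x i) (g i) : K^o].

Lemma gcoef_gtens x (g : G) : gcoef (gtens x) g = \prod_i gcoef (x i) (g i).
Proof. by rewrite /gcoef ffunE. Qed.

Lemma eq_gtens x y : (forall i, x i = y i) -> gtens x = gtens y.
Proof. by move=> e; apply: galgP => g; rewrite !gcoef_gtens; apply: eq_bigr => i _; rewrite e. Qed.

Lemma gtensM x y : gtens x * gtens y = gtens (fun i => x i * y i).
Proof.
apply: galgP => g; rewrite gcoefM gcoef_gtens.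
under [RHS]eq_bigr => i _ do rewrite gcoefM.
rewrite big_dffun_distr; apply: eq_bigr => h _.
rewrite !gcoef_gtens -big_split /=; apply: eq_bigr => i _.
by rewrite !ffunE.
Qed.

Lemma gelt_gtens (g : G) : gelt g = gtens (fun i => gelt (g i)).
Proof.
apply: galgP => h; rewrite gcoef_gtens gcoef_elt; case: eqP => [->|hg].
  by rewrite big1 // => i _; rewrite gcoef_elt eqxx.
have : ~~ [forall i, h i == g i].
  by apply/negP => /forallP e; apply: hg; apply/ffunP => i; apply/eqP.
by case/forallPn => i ni; rewrite (bigD1 i) //= gcoef_elt (negPf ni) mul0r.
Qed.

Lemma gtens1 : gtens (fun=> 1) = 1.
Proof. by rewrite -gelt1 gelt_gtens; apply: eq_gtens => i; rewrite ffunE gelt1. Qed.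

Lemma gtens_sum (J : I -> finType) (F : forall i, J i -> galg K (gT i)) :
  gtens (fun i => \sum_j F i j) = \sum_(t : {dffun forall i, J i}) gtens (fun i => F i (t i)).
Proof.
apply: galgP => g; rewrite gcoef_gtens gcoef_sum.
under [LHS]eq_bigr => i _ do rewrite gcoef_sum.
by rewrite big_dffun_distr; apply: eq_bigr => t _; rewrite gcoef_gtens.
Qed.

Lemma gtensZ (k : I -> K) x : gtens (fun i => k i *: x i) = (\prod_i k i) *: gtens x.
Proof.
apply: galgP => g; rewrite gcoefZ !gcoef_gtens -big_split /=.
by apply: eq_bigr => i _; rewrite gcoefZ.
Qed.

Lemma gtens0 i x : x i = 0 -> gtens x = 0.
Proof.
move=> x0; apply: galgP => g; rewrite gcoef_gtens (bigD1 i) //= x0.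
by rewrite /gcoef !ffunE mul0r.
Qed.

End ProductGroup.

Section MultiYoung.

Variables (K : fieldType) (I : finType) (N : I -> nat).
Hypothesis char0 : [pchar K] =i pred0.
Local Notation G := {dffun forall i, 'S_(N i)}.
Local Notation A := (galg K G).
Implicit Types nu mu : I -> seq nat.

Definition myoung nu : A := gtens (fun i => young K (N i) (nu i)).

Definition mshape nu := forall i, sumn (nu i) = N i /\ sorted geq (nu i).

Lemma gtens_gelt_gtens (x y : forall i, galg K 'S_(N i)) (g : G) :
  gtens x * gelt g * gtens y = gtens (fun i => x i * gelt (g i) * y i).
Proof. by rewrite gelt_gtens !gtensM. Qed.

Lemma myoung_orth nu mu z : mshape nu -> mshape mu ->
  (exists i k, nth 0%N (nu i) k != nth 0%N (mu i) k) -> myoung nu * z * myoung mu = 0.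
Proof.
move=> snu smu [i ni]; rewrite galg_mul_sum big1 // => g _.
rewrite gtens_gelt_gtens (gtens0 (i := i)) ?scaler0 //.
exact: (young_orth char0 _ (snu i).1 (smu i).1 (snu i).2 (smu i).2 ni).
Qed.

Lemma myoung_scalar nu z : mshape nu -> exists k : K, myoung nu * z * myoung nu = k *: myoung nu.
Proof.
move=> snu.
have ex (g : G) i : exists k : K, young K (N i) (nu i) * gelt (g i) * young K (N i) (nu i)
    == k *: young K (N i) (nu i).
  by have [k ->] := young_scalar char0 (gelt (g i)) (snu i).1 (snu i).2; exists k.
exists (\sum_g gcoef z g * \prod_i xchoose (ex g i)).
rewrite galg_mul_sum scaler_suml; apply: eq_bigr => g _.
rewrite gtens_gelt_gtens -scalerA -gtensZ; congr (_ *: _); apply: eq_gtens => i.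
exact/eqP/(xchooseP (ex g i)).
Qed.

Lemma myoung_complete : exists (J : finType) (x y : J -> A) (l : J -> I -> seq nat),
  (forall j i, l j i \in parts_of (N i)) /\ 1 = \sum_j x j * myoung (l j) * y j.
Proof.
have /fin_all_exists [J] := fun i => young_complete (N i) char0.
case/fin_all_exists => x /fin_all_exists [y] /fin_all_exists [l lP].
pose JJ : finType := {dffun forall i, J i}.
exists JJ, (fun t : JJ => gtens (fun i => x i (t i))),
  (fun t : JJ => gtens (fun i => y i (t i))), (fun (t : JJ) i => l i (t i)).
split=> [t i|]; first exact: (lP i).1.
rewrite -gtens1 (eq_gtens (fun i => (lP i).2)) gtens_sum.
by apply: eq_bigr => t _; rewrite /myoung !gtensM.
Qed.

End MultiYoung.

(** * Pseudo-inverses, and dual bases of e A eps and eps A e *)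

Section PseudoInverse.

Variables (K : fieldType) (gT : finGroupType).
Hypothesis char0 : [pchar K] =i pred0.

Lemma galg_pinv_subproof (x : galg K gT) : exists y, x * y * x == x.
Proof. by have [y e] := galg_regular x char0; exists y; apply/eqP. Qed.

Definition galg_pinv x := xchoose (galg_pinv_subproof x).

Lemma galg_pinvK x : x * galg_pinv x * x = x.
Proof. exact/eqP/(xchooseP (galg_pinv_subproof x)). Qed.

End PseudoInverse.

Section IsotypicBasis.

Variables (K : fieldType) (gT : finGroupType).
Hypothesis char0 : [pchar K] =i pred0.
Local Notation A := (galg K gT).
Variables (e eps : A).
Hypotheses (e_idem : e * e = e) (eps_idem : eps * eps = eps).
Hypothesis e_scal : forall z, exists k : K, e * z * e = k *: e.

Definition sandwich (a b : A) : {vspace A} := limg (grmul b \o glmul a)%VF.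

Lemma sandwichP (a b z : A) : reflect (exists w, z = a * w * b) (z \in sandwich a b).
Proof.
apply: (iffP memv_imgP) => [[w _ ->]|[w ->]]; exists w; rewrite ?memvf //;
  by rewrite comp_lfunE grmulE glmulE.
Qed.

(** A product of u in e A eps and v in eps A e lies in e A e, hence in K e, which gives a bilinear
    pairing. It has no left kernel: with u = u w u, also u = u (eps w e) u, which is zero when u
    pairs to zero with eps A e. The Gram matrix of two bases thus has a right inverse, from which
    the dual family [y] is built. *)
Lemma sandwich_dual_basis : exists x y : 'I_(\dim (sandwich e eps)) -> A,
  [/\ forall j, x j = e * x j * eps, forall j, y j = eps * y j * e,
    forall j k, x j * y k = (j == k)%:R *: e
    & forall z, e * z * eps = \sum_j (e * z * eps) * y j * x j].
Proof.
set U := sandwich e eps; pose U' := sandwich eps e.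
have UP z : z \in U -> z = e * z * eps.
  case/sandwichP => w ->.
  by rewrite !mulrA e_idem -!mulrA eps_idem.
have UP' z : z \in U' -> z = eps * z * e.
  case/sandwichP => w ->.
  by rewrite !mulrA eps_idem -!mulrA e_idem.
have [f f_lin fE] : exists2 f : A -> K, linear_for *%R f &
    forall u v, u \in U -> v \in U' -> u * v = f (u * v) *: e.
  have [e0|/eqP ne0] := eqVneq e 0.
    exists (fun=> 0) => [a u v|u v /UP uE _]; first by rewrite mulr0 addr0.
    by rewrite uE e0 !mul0r scaler0.
  have [g ng] : exists g, gcoef e g != 0.
    have [/forallP e0|/forallPn[g ng]] := boolP [forall g, gcoef e g == 0]; last by exists g.
    case: ne0; apply: galgP => g; rewrite (eqP (e0 g)).
    by rewrite /gcoef ffunE.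
  exists (fun z => gcoef z g / gcoef e g) => [a u v|u v /UP uE /UP' vE].
    by rewrite gcoefD gcoefZ mulrDl mulrA.
  have [k kE] := e_scal (u * eps * eps * v).
  have -> : u * v = k *: e by rewrite uE vE -kE uE vE !mulrA.
  by rewrite gcoefZ mulfK.
have f_sum (J : finType) (c : J -> K) (v : J -> A) :
    f (\sum_j c j *: v j) = \sum_j c j * f (v j).
  have f0 : f 0 = 0.
    by have := f_lin (-1) 0 0; rewrite scaler0 addr0 mulN1r addNr.
  apply: (big_rec2 (fun a b => f a = b)) => // j a b _ <-.
  exact: f_lin.
pose X := vbasis U; pose Y := vbasis U'.
have XU (j : 'I_(\dim U)) : X`_j \in U.
  by rewrite vbasis_mem // mem_nth // size_tuple.
have YU (i : 'I_(\dim U')) : Y`_i \in U'.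
  by rewrite vbasis_mem // mem_nth // size_tuple.
pose B := \matrix_(j < \dim U, i < \dim U') f (X`_j * Y`_i).
have Bfree : row_free B.
  apply: inj_row_free => c cB; pose u := \sum_j c 0 j *: X`_j.
  have uU : u \in U by apply: memv_suml => j _; rewrite memvZ.
  have uY (i : 'I_(\dim U')) : u * Y`_i = 0.
    rewrite (fE _ _ uU (YU i)) /u mulr_suml; under eq_bigr do rewrite -scalerAl.
    rewrite f_sum.
    have -> : \sum_j c 0 j * f (X`_j * Y`_i) = (c *m B) 0 i.
      by rewrite mxE; apply: eq_bigr => j _; rewrite mxE.
    by rewrite cB mxE scale0r.
  have u0 : u = 0.
    clearbody u.
    have [w uwu] := galg_regular u char0.
    have vU' : eps * w * e \in U' by apply/sandwichP; exists w.
    rewrite -uwu (_ : u * w * u = u * (eps * w * e) * u).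
      rewrite (coord_vbasis vU') mulr_sumr big1 ?mul0r // => i _.
      by rewrite -scalerAr -/Y (uY i) scaler0.
    by rewrite (UP u uU) !mulrA -(mulrA _ eps eps) eps_idem -(mulrA _ e e) e_idem.
  have /freeP fX := basis_free (vbasisP U).
  by apply/rowP => j; rewrite mxE (fX (c 0)).
have [C BC] := row_freeP Bfree.
pose y k := \sum_(i < \dim U') C i k *: Y`_i.
have yU k : y k \in U' by apply: memv_suml => i _; rewrite memvZ.
have xy (j k : 'I_(\dim U)) : X`_j * y k = (j == k)%:R *: e.
  rewrite (fE _ _ (XU j) (yU k)); congr (_ *: _).
  rewrite /y mulr_sumr; under eq_bigr do rewrite -scalerAr.
  rewrite f_sum; have := congr1 (fun M : 'M_(_) => M j k) BC; rewrite !mxE => <-.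
  by apply: eq_bigr => i _; rewrite mxE mulrC.
exists (fun j => X`_j), y; split=> [j|j|j k|z]; [exact: (UP _ (XU j)) | exact: (UP' _ (yU j)) | exact: xy |].
have zU : e * z * eps \in U by apply/sandwichP; exists z.
rewrite {1}(coord_vbasis zU); apply: eq_bigr => k _.
rewrite {2}(coord_vbasis zU) mulr_suml (bigD1 k) //= big1 ?addr0 => [|j jk].
  rewrite -scalerAl xy eqxx scale1r -scalerAl; congr (_ *: _).
  by rewrite (UP _ (XU k)) !mulrA e_idem.
by rewrite -scalerAl xy (negPf jk) scale0r scaler0.
Qed.

End IsotypicBasis.

(** * Natural endomorphisms of tensor functors *)

Section Multilinear.

Variables (K : fieldType) (I : finType) (E : I -> vectType K).
Implicit Types (C D : vectType K) (u v w : forall i, E i) (x y : I).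

(** Three families that agree off the slot [x] are compared, rather than one family updated at [x];
    this form passes through composites such as [slot_linear_comp] without dependent updates. *)
Definition slot_linear C x (beta : (forall i, E i) -> C) :=
  forall (a : K) u u' w, (forall y, y != x -> u y = w y) ->
    (forall y, y != x -> u' y = w y) -> w x = a *: u x + u' x ->
    beta w = a *: beta u + beta u'.

Definition slot_indep C x (beta : (forall i, E i) -> C) :=
  forall u w, (forall y, y != x -> u y = w y) -> beta u = beta w.

(** Families are plain dependent functions, so invariance under pointwise equality has to be part of
    multilinearity. *)
Definition extensional C (beta : (forall i, E i) -> C) :=
  forall u w, (forall y, u y = w y) -> beta u = beta w.

Definition multilinear C (beta : (forall i, E i) -> C) :=
  extensional beta /\ forall x, slot_linear x beta.

Lemma slot_linear_proj x y : y = x -> slot_linear x (fun v => v y).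
Proof. by move=> -> a u u' w. Qed.

Lemma slot_indep_proj x y : x != y -> slot_indep x (fun v => v y).
Proof. by move=> xy u w; apply; rewrite eq_sym. Qed.

Lemma slot_linear_tpurel C D x (beta : (forall i, E i) -> C) (gamma : (forall i, E i) -> D) :
  slot_linear x beta -> slot_indep x gamma ->
  slot_linear x (fun v => tpure (beta v) (gamma v)).
Proof.
move=> H H' a u u' w uw u'w e; rewrite (H a u u') // tpure_linl.
by rewrite -(H' u w) // (H' u' u) // => y yx; rewrite uw ?u'w.
Qed.

Lemma slot_linear_tpurer C D x (beta : (forall i, E i) -> C) (gamma : (forall i, E i) -> D) :
  slot_linear x gamma -> slot_indep x beta ->
  slot_linear x (fun v => tpure (beta v) (gamma v)).
Proof.
move=> H H' a u u' w uw u'w e; rewrite (H a u u') // tpure_linr.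
by rewrite -(H' u w) // (H' u' u) // => y yx; rewrite uw ?u'w.
Qed.

Lemma multilinear_pure : multilinear (@pure K I E).
Proof.
split=> [u w|x a u u' w uw u'w e]; first exact: eq_pure.
apply/ffunP => s; rewrite !ffunE -[_ *: _]/(_ * _).
have P z : (forall y, y != x -> z y = w y) ->
    \prod_y bcoord (s y) (z y) =
    bcoord (s x) (z x) * \prod_(y | y != x) bcoord (s y) (w y).
  by move=> zw; rewrite (bigD1 x) //=; congr (_ * _); apply: eq_bigr => y yx; rewrite zw.
by rewrite (P u) // (P u') // (P w) // e bcoordD mulrDl mulrA.
Qed.

Definition bigtensor_lift C (beta : (forall i, E i) -> C) : 'Hom(bigtensor E, C) :=
  linfun (fun z : bigtensor E => \sum_s z s *: beta (fun i => bvec (s i))).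

Lemma multilinear_sum C (beta : (forall i, E i) -> C) x v (J : finType)
    (c : J -> K) (h : J -> E x) : multilinear beta ->
  beta (dfwith v (\sum_j c j *: h j)) = \sum_j c j *: beta (dfwith v (h j)).
Proof.
move=> [_ bl]; have lin : linear (fun z : E x => beta (dfwith v z)).
  move=> a z z'; apply: (bl x) => [y yx|y yx|]; rewrite ?dfwith_in //.
    by rewrite !dfwith_out // eq_sym.
  by rewrite !dfwith_out // eq_sym.
rewrite -[LHS](linfunE lin) linear_sum; apply: eq_bigr => j _.
by rewrite linearZ /= linfunE.
Qed.

(** Induction on the number of slots whose vector is not a basis vector: expanding the vector in one
    such slot lowers this number. *)
Lemma multilinear_eq0 C (beta : (forall i, E i) -> C) : multilinear beta ->
  (forall s : {dffun forall i, 'I_(\dim {:E i})}, beta (fun i => bvec (s i)) = 0) ->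
  forall v, beta v = 0.
Proof.
move=> bml b0 v; have [bext _] := bml.
have [k] := ubnP #|[set i | ~~ [exists j, v i == bvec j]]|.
elim: k => // k IHk in v *; rewrite ltnS => le_k.
have [e0|[x]] := set_0Vmem [set i | ~~ [exists j, v i == bvec j]].
  have ex i : exists j, v i == bvec j.
    by apply/existsP; have := in_set0 i; rewrite -e0 inE => /negbFE.
  rewrite -(b0 (finfun (fun i => xchoose (ex i)))); apply: bext => i.
  by rewrite ffunE; apply/eqP/(xchooseP (ex i)).
rewrite inE => nx; transitivity (beta (dfwith v (\sum_j bcoord j (v x) *: bvec j))).
  apply: bext => y; have [<-|xy] := eqVneq x y; last by rewrite dfwith_out.
  by rewrite dfwith_in -bcoord_sum.
rewrite multilinear_sum // big1 // => j _; rewrite IHk ?scaler0 //.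
apply: leq_trans le_k; apply/proper_card/properP; split.
  apply/subsetP => y; rewrite !inE; have [<-|xy] := eqVneq x y; last by rewrite dfwith_out.
  by rewrite dfwith_in => /negP[]; apply/existsP; exists j.
exists x; rewrite inE // dfwith_in negbK; by apply/existsP; exists j.
Qed.

Lemma bigtensor_liftE C (beta : (forall i, E i) -> C) v : multilinear beta ->
  bigtensor_lift beta (pure v) = beta v.
Proof.
move=> bml; have [bext bl] := bml.
have Lml : multilinear (fun v => bigtensor_lift beta (pure v) - beta v).
  split=> [u w uw|x a u u' w uw u'w e]; first by rewrite (eq_pure uw) (bext _ _ uw).
  have [_ /(_ x) pl] := multilinear_pure.
  rewrite (pl a u u' w uw u'w e) (bl x a u u' w uw u'w e) linearP scalerBr.
  by rewrite opprD addrACA.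
apply/eqP; rewrite -subr_eq0; apply/eqP; apply: (multilinear_eq0 Lml) => s.
rewrite /bigtensor_lift linfunE => [|a x y]; last first.
  rewrite scaler_sumr -big_split /=; apply: eq_bigr => t _.
  by rewrite !ffunE scalerDl scalerA.
apply/eqP; rewrite subr_eq0 (bigD1 s) //= big1 => [|t ts].
  rewrite ffunE big1 => [|i _]; last by rewrite bcoord_bvec eqxx.
  by rewrite scale1r addr0.
have : ~~ [forall i, t i == s i].
  by apply: contra ts => /forallP e; apply/eqP; apply/ffunP => i; exact/eqP/e.
case/forallPn => i ti.
by rewrite ffunE (bigD1 i) //= bcoord_bvec (negPf ti) mul0r scale0r.
Qed.

End Multilinear.

Lemma slot_linear_comp (K : fieldType) (I J : finType) (E : I -> vectType K)
    (C : J -> vectType K) (D : vectType K) (beta : (forall j, C j) -> D)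
    (gamma : forall j, (forall i, E i) -> C j) x j0 :
  multilinear beta -> slot_linear x (gamma j0) ->
  (forall j, j != j0 -> slot_indep x (gamma j)) ->
  slot_linear x (fun v => beta (fun j => gamma j v)).
Proof.
move=> [_ bl] gl gi a u u' w uw u'w e; apply: (bl j0) => [j jj0|j jj0|].
- exact: gi.
- exact: gi.
exact: gl.
Qed.

Lemma slot_indep_comp (K : fieldType) (I J : finType) (E : I -> vectType K)
    (C : J -> vectType K) (D : vectType K) (beta : (forall j, C j) -> D)
    (gamma : forall j, (forall i, E i) -> C j) x :
  multilinear beta -> (forall j, slot_indep x (gamma j)) ->
  slot_indep x (fun v => beta (fun j => gamma j v)).
Proof. by move=> [bext _] gi u w uw; apply: bext => j; apply: gi. Qed.

Section TensorFunctor.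

Variables (K : fieldType) (n : nat).
Implicit Types (N : 'I_n -> nat) (V W : 'I_n -> vectType K).

(** All factors of all tensor powers are gathered in one index type, so that a single multilinear
    tensor product carries the whole action. The nested form is recovered by [nest]. *)
Definition slots N : finType := {i : 'I_n & 'I_(N i)}.
Definition slot N i (k : 'I_(N i)) : slots N := Tagged (fun i => 'I_(N i)) k.

Definition tens_obj N V : vectType K := bigtensor (fun x : slots N => V (tag x)).
Definition tens_map N V W (f : forall i, 'Hom(V i, W i)) : 'Hom(tens_obj N V, tens_obj N W) :=
  bigtensor_map (fun x : slots N => f (tag x)).

Lemma tens_map_id N V : tens_map N (fun i => \1%VF : 'End(V i)) = \1%VF.
Proof. by apply: bigtensor_map_id. Qed.

Lemma tens_map_comp N (V W X : 'I_n -> vectType K) (f : forall i, 'Hom(V i, W i))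
    (g : forall i, 'Hom(W i, X i)) :
  tens_map N (fun i => (g i \o f i)%VF) = (tens_map N g \o tens_map N f)%VF.
Proof. by apply: bigtensor_map_comp. Qed.

Definition tens N : functor K n := Functor (@tens_map_id N) (@tens_map_comp N).

Definition slot_group N : finGroupType := {dffun forall i, 'S_(N i)}.
Definition slot_perm N (g : slot_group N) (x : slots N) : slots N :=
  slot (g (tag x) (tagged x)).

Lemma slot_permK N (g : slot_group N) : cancel (slot_perm g) (slot_perm g^-1%g).
Proof. by case=> i k; rewrite /slot_perm /slot /= invg_ffun permK. Qed.

Definition slot_act N V (g : slot_group N) : 'End(tens_obj N V) :=
  bigtensor_lift (fun v : forall x : slots N, V (tag x) =>
    pure (fun x => v (slot_perm g^-1%g x) : V (tag x)) : tens_obj N V).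

Lemma slot_actE N V (g : slot_group N) (v : forall x : slots N, V (tag x)) :
  slot_act V g (pure v) = pure (fun x => v (slot_perm g^-1%g x) : V (tag x)).
Proof.
apply: (bigtensor_liftE (beta := fun v => pure (fun x => v (slot_perm g^-1%g x) : V (tag x)))).
split=> [u w uw|x]; first by apply: eq_pure => x; exact: (uw (slot_perm g^-1%g x)).
apply: (slot_linear_comp (j0 := slot_perm g x)
  (gamma := fun y (v : forall x : slots N, V (tag x)) => v (slot_perm g^-1%g y) : V (tag y))).
- exact: multilinear_pure.
- exact: (slot_linear_proj (slot_permK g x)).
move=> y yx; have xy : x != slot_perm g^-1%g y.
  by apply: contraNneq yx => ->; rewrite -{1}(invgK g) slot_permK.
exact: (slot_indep_proj xy).
Qed.

Section Action.

Variable N : 'I_n -> nat.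
Local Notation A := (galg K (slot_group N)).
Implicit Types (x y z : A).

Definition rho V x : 'End(tens_obj N V) := \sum_g gcoef x g *: slot_act V g.

Lemma rhoE V x t : rho V x t = \sum_g gcoef x g *: slot_act V g t.
Proof. by rewrite /rho sum_lfunE; apply: eq_bigr => g _; rewrite scale_lfunE. Qed.

Lemma rhoD V x y : rho V (x + y) = rho V x + rho V y.
Proof. by rewrite /rho -big_split /=; apply: eq_bigr => g _; rewrite gcoefD scalerDl. Qed.

Lemma rhoZ V a x : rho V (a *: x) = a *: rho V x.
Proof. by rewrite /rho scaler_sumr; apply: eq_bigr => g _; rewrite gcoefZ scalerA. Qed.

Lemma rho0 V : rho V 0 = 0.
Proof. by rewrite -(scale0r 0) rhoZ scale0r. Qed.

Lemma rho_sum V (J : finType) (P : pred J) (F : J -> A) :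
  rho V (\sum_(j | P j) F j) = \sum_(j | P j) rho V (F j).
Proof. by apply: (big_morph _ (rhoD V) (rho0 V)). Qed.

Lemma rho_gelt V (g : slot_group N) : rho V (gelt g) = slot_act V g.
Proof.
rewrite /rho (bigD1 g) //= gcoef_elt eqxx scale1r big1 ?addr0 // => h hg.
by rewrite gcoef_elt (negPf hg) scale0r.
Qed.

Lemma slot_actM V (g h : slot_group N) : (slot_act V g \o slot_act V h)%VF = slot_act V (h * g)%g.
Proof.
apply: bigtensor_ext => v; rewrite comp_lfunE !slot_actE.
apply: eq_pure => -[i k]; rewrite /slot_perm /slot /=.
by rewrite invMg mulg_ffun permM.
Qed.

(** Permutations are multiplied from left to right, so the action reverses products: tensors form a
    right module over the group algebra. *)
Lemma rhoM V x y : (rho V x \o rho V y)%VF = rho V (y * x).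
Proof.
have e (g : slot_group N) z : (slot_act V g \o rho V z)%VF = rho V (z * gelt g).
  rewrite {2}[z]galg_sum mulr_suml rho_sum; apply/lfunP => t.
  rewrite comp_lfunE rhoE linear_sum sum_lfunE; apply: eq_bigr => h _.
  by rewrite linearZ /= -scalerAl rhoZ -geltM rho_gelt scale_lfunE -slot_actM comp_lfunE.
apply/lfunP => t; rewrite comp_lfunE rhoE {2}[x]galg_sum mulr_sumr rho_sum sum_lfunE.
by apply: eq_bigr => g _; rewrite -scalerAr rhoZ scale_lfunE -e comp_lfunE.
Qed.

Lemma rhoM_app V x y t : rho V x (rho V y t) = rho V (y * x) t.
Proof. by rewrite -rhoM comp_lfunE. Qed.

Lemma rho1 V : rho V 1 = \1%VF.
Proof.
rewrite -gelt1 rho_gelt; apply: bigtensor_ext => v; rewrite slot_actE id_lfunE.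
apply: eq_pure => -[i k]; rewrite /slot_perm /slot /= invg_ffun oneg_ffun.
by rewrite invg1 perm1.
Qed.

Lemma rho_natural V W (f : forall i, 'Hom(V i, W i)) x :
  (rho W x \o tens_map N f)%VF = (tens_map N f \o rho V x)%VF.
Proof.
apply/lfunP => t; rewrite !comp_lfunE !rhoE linear_sum; apply: eq_bigr => g _.
rewrite linearZ /=; congr (_ *: _); rewrite -!comp_lfunE; move: t; apply/lfunP.
apply: bigtensor_ext => v.
by rewrite !comp_lfunE bigtensor_mapE !slot_actE bigtensor_mapE.
Qed.

End Action.

End TensorFunctor.

Section NaturalMaps.

Variables (K : fieldType) (n : nat).
Implicit Types (F G H : functor K n) (V W : 'I_n -> vectType K) (N : 'I_n -> nat).

Definition natural F G (phi : forall V, 'Hom(F V, G V)) :=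
  forall V W (f : forall i, 'Hom(V i, W i)),
    (phi W \o fmap F f = fmap G f \o phi V)%VF.

Lemma natural_app F G (phi : forall V, 'Hom(F V, G V)) V W (f : forall i, 'Hom(V i, W i)) t :
  natural phi -> phi W (fmap F f t) = fmap G f (phi V t).
Proof. by move=> nat; rewrite -[LHS]comp_lfunE nat comp_lfunE. Qed.

Lemma natural_comp F G H (phi : forall V, 'Hom(F V, G V)) (psi : forall V, 'Hom(G V, H V)) :
  natural phi -> natural psi -> natural (fun V => psi V \o phi V)%VF.
Proof.
move=> nphi npsi V W f; apply/lfunP => t; rewrite [LHS]comp_lfunE [LHS]comp_lfunE.
by rewrite [RHS]comp_lfunE [X in _ = _ X]comp_lfunE (natural_app _ _ nphi) (natural_app _ _ npsi).
Qed.

Lemma natural_id F : natural (fun V => \1%VF : 'End(F V)).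
Proof. by move=> V W f; rewrite comp_lfun1l comp_lfun1r. Qed.

Lemma natural_zero F G : natural (fun V => 0 : 'Hom(F V, G V)).
Proof. by move=> V W f; rewrite comp_lfun0l comp_lfun0r. Qed.

Lemma natural_sub F G (phi psi : forall V, 'Hom(F V, G V)) :
  natural phi -> natural psi -> natural (fun V => phi V - psi V).
Proof.
move=> nphi npsi V W f; apply/lfunP => t.
rewrite [LHS]comp_lfunE [RHS]comp_lfunE !add_lfunE !opp_lfunE linearB /=.
by rewrite (natural_app _ _ nphi) (natural_app _ _ npsi).
Qed.

Lemma natural_rho N x : natural (fun V => rho V x : 'Hom(tens K N V, tens K N V)).
Proof. by move=> V W f; apply: rho_natural. Qed.

Lemma pure_eq0 (I : finType) (E : I -> vectType K) (v : forall i, E i) i :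
  v i = 0 -> pure v = 0.
Proof.
move=> v0; apply/ffunP => s; rewrite !ffunE (bigD1 i) //= v0.
by rewrite /bcoord linear0 mul0r.
Qed.

(* The pure tensor of the tautological basis vectors is generic, so a natural *)
(* endomorphism is determined by its value there; killing one basis vector at *)
(* a time shows that this value is multilinear in the basis.                  *)
Lemma natural_endo N (phi : forall V, 'End(tens K N V)) :
  natural phi -> exists x, forall V, phi V = rho V x.
Proof.
move=> nphi; pose E (i : 'I_n) : vectType K := 'rV[K]_(N i).
have eN i : N i = \dim {:E i} by rewrite dimvf dim_matrix; apply/esym/mul1n.
pose ix i (k : 'I_(N i)) : 'I_(\dim {:E i}) := cast_ord (eN i) k.
pose eb i (k : 'I_(N i)) : E i := bvec (ix i k).
pose g : tens K N E := pure (fun x : slots N => eb (tag x) (tagged x)).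
pose y := phi E g.
pose sg (h : slot_group N) : {dffun forall x : slots N, 'I_(\dim {:E (tag x)})} :=
  finfun (fun x : slots N => ix (tag x) (h^-1%g (tag x) (tagged x))).
have act_g h : slot_act E h g = pure (fun x => bvec (sg h x)).
  by rewrite slot_actE; apply: eq_pure => x; rewrite ffunE.
have sg_inj : injective sg.
  move=> h h' e; apply: invg_inj; apply/ffunP => i; apply/permP => k.
  have := congr1 (fun s : {dffun forall x : slots N, 'I_(\dim {:E (tag x)})} => s (slot k)) e.
  by rewrite !ffunE /= => /cast_ord_inj.
(* Only the indices that use every basis vector of every block exactly once, that is, the [sg h],
   can carry a nonzero coefficient of [y]. *)
have y_supp s : (forall h, sg h != s) -> y s = 0.
  move=> sN; pose t i (k : 'I_(N i)) : 'I_(N i) := cast_ord (esym (eN i)) (s (slot k)).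
  have [/forallP inj|/forallPn[i ninj]] := boolP [forall i, injectiveb (t i)].
    pose h : slot_group N := finfun (fun i => (perm (injectiveP _ (inj i)))^-1%g).
    have /eqP[] := sN h; apply/ffunP => -[i k].
    rewrite ffunE /= invg_ffun ffunE invgK permE; apply/val_inj => /=; by rewrite /slot.
  have [k0 k0N] : exists k0, k0 \notin codom (t i).
    have [/forallP H|/forallPn//] := boolP [forall k0, k0 \in codom (t i)].
    case/negP: ninj; apply/injectiveP => a b; move: a b (isT) (isT).
    suff /image_injP inj : #|image (t i) 'I_(N i)| == #|'I_(N i)|.
      by move=> a b _ _; apply: inj.
    by apply/eqP/eq_card => k; rewrite (H k).
  (* If [s] misses the basis vector [k0] of block [i], let [q] kill this vector and fix all other
     basis vectors; comparing slots makes it the identity on the other blocks. It preserves the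
     coefficient at [s] but kills [g], hence [y]. *)
  pose q j : 'End(E j) := linfun (fun z : E j =>
    \sum_(k | slot k != slot k0) bcoord (ix j k) z *: eb j k).
  have qE j (z : E j) : q j z = \sum_(k | slot k != slot k0) bcoord (ix j k) z *: eb j k.
    rewrite /q linfunE // => a u v; rewrite scaler_sumr -big_split /=.
    by apply: eq_bigr => k _; rewrite bcoordD scalerDl scalerA.
  have qs (x : slots N) z : bcoord (s x) (q (tag x) z) = bcoord (s x) z.
    pose k : 'I_(N (tag x)) := cast_ord (esym (eN (tag x))) (s x).
    have sx : s x = ix (tag x) k by apply/val_inj.
    have kk0 : slot k != slot k0.
      apply: contraNneq k0N; rewrite /k; case: (x) => j l.
      have P (z' : slots N) : slot (t j l) = z' -> tagged z' \in codom (t (tag z')).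
        by move=> <-; apply: codom_f.
      exact: (P (slot k0)).
    rewrite qE sx; transitivity (\sum_(l | slot l != slot k0)
        bcoord (ix (tag x) k) (bcoord (ix (tag x) l) z *: eb (tag x) l)).
      by rewrite /bcoord linear_sum.
    rewrite (bigD1 k) //= bcoordZ bcoord_bvec eqxx mulr1 big1 ?addr0 // => l /andP[_ lk].
    rewrite bcoordZ bcoord_bvec.
    by rewrite (inj_eq (@cast_ord_inj _ _ _)) eq_sym (negPf lk) mulr0.
  have q0 : tens_map N q g = 0.
    rewrite bigtensor_mapE; apply: (pure_eq0 (i := slot k0)) => /=.
    rewrite qE big1 // => k kk; rewrite bcoord_bvec.
    case: eqP => [/cast_ord_inj e|]; last by rewrite scale0r.
    by rewrite e eqxx in kk.
  have qy : tens_map N q y = 0.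
    by rewrite -[tens_map N q]/(fmap (tens K N) q) -(natural_app _ _ nphi) [fmap _ _ _]q0 linear0.
  have : tens_map N q y s = y s.
    rewrite {1}[y]bigtensor_sum linear_sum sum_ffunE [in RHS](bigtensor_sum y) sum_ffunE.
    apply: eq_bigr => u _; rewrite linearZ /= bigtensor_mapE !ffunE.
    by congr (_ * _); apply: eq_bigr => x _; rewrite qs.
  by rewrite qy ffunE.
exists (\sum_h (y (sg h) : K) *: gelt h) => V; apply: bigtensor_ext => v.
(* Every pure tensor is the image of the generic one [g] under a family of linear maps. *)
pose f i : 'Hom(E i, V i) := linfun (fun z : E i => \sum_k bcoord (ix i k) z *: (v (slot k) : V i)).
have fE i (k : 'I_(N i)) : f i (eb i k) = v (slot k).
  rewrite /f linfunE => [|a u w]; last first.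
    rewrite scaler_sumr -big_split /=.
    by apply: eq_bigr => l _; rewrite bcoordD scalerDl scalerA.
  rewrite (bigD1 k) //= bcoord_bvec eqxx scale1r big1 ?addr0 // => l lk.
  by rewrite bcoord_bvec (inj_eq (@cast_ord_inj _ _ _)) (negPf lk) scale0r.
have vE : pure v = fmap (tens K N) f g.
  by rewrite [RHS]bigtensor_mapE; apply: eq_pure => -[i k]; rewrite fE.
rewrite vE (natural_app _ _ nphi) (natural_app _ _ (natural_rho _)).
congr (_ _); apply/ffunP => s; rewrite rho_sum sum_lfunE sum_ffunE.
rewrite -[LHS]/(y s).
under eq_bigr => h _ do rewrite rhoZ rho_gelt scale_lfunE act_g.
have [/existsP[h /eqP <-]|/existsPn sN] := boolP [exists h, sg h == s].
  rewrite (bigD1 h) //= big1 ?addr0 => [|h' h'h].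
    by rewrite !ffunE big1 => [|x _]; rewrite ?[_ *: _]mulr1 ?bcoord_bvec ?eqxx.
  rewrite !ffunE.
  have : ~~ [forall x, sg h' x == sg h x].
    apply: contra h'h => /forallP e; apply/eqP/sg_inj; apply/ffunP => x; exact/eqP/e.
  case/forallPn => x nx.
  by rewrite (bigD1 x) //= bcoord_bvec (eq_sym (sg h x)) (negPf nx) mul0r [_ *: _]mulr0.
rewrite y_supp // big1 // => h _; rewrite !ffunE.
have : ~~ [forall x, sg h x == s x].
  by apply: contra (sN h) => /forallP e; apply/eqP; apply/ffunP => x; exact/eqP/e.
case/forallPn => x nx.
by rewrite (bigD1 x) //= bcoord_bvec (eq_sym (s x)) (negPf nx) mul0r [_ *: _]mulr0.
Qed.

End NaturalMaps.

(** * Decomposition into Schur functors *)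

Section Decomposition.

Variables (K : fieldType) (n : nat) (N : 'I_n -> nat).
Hypothesis char0 : [pchar K] =i pred0.
Local Notation A := (galg K (slot_group N)).
Local Notation P := (tens K N).

Definition retract_of (F : functor K n) (eps : A) (i : forall V, 'Hom(F V, P V))
    (r : forall V, 'Hom(P V, F V)) :=
  [/\ natural i, natural r, forall V, (r V \o i V)%VF = \1%VF
    & forall V, (i V \o r V)%VF = rho V eps].

Lemma retract_ri F eps i r V t : @retract_of F eps i r -> r V (i V t) = t.
Proof. by case=> _ _ e _; rewrite -comp_lfunE e id_lfunE. Qed.

Lemma retract_ir F eps i r V t : @retract_of F eps i r -> i V (r V t) = rho V eps t.
Proof. by case=> _ _ _ e; rewrite -comp_lfunE e. Qed.

Variables (F : functor K n) (eps : A) (i : forall V, 'Hom(F V, P V))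
  (r : forall V, 'Hom(P V, F V)).
Hypotheses (Fr : retract_of eps i r) (eps_idem : eps * eps = eps).

Let ri V t : r V (i V t) = t. Proof. exact: retract_ri Fr. Qed.
Let ir V t : i V (r V t) = rho V eps t. Proof. exact: retract_ir Fr. Qed.

Section Isotypic.

Variables (e : A) (S : functor K n) (iS : forall V, 'Hom(S V, P V))
  (rS : forall V, 'Hom(P V, S V)).
Hypotheses (Sr : retract_of e iS rS) (e_idem : e * e = e).
Hypothesis e_scal : forall z, exists k : K, e * z * e = k *: e.

Let rS_iS V t : rS V (iS V t) = t. Proof. exact: retract_ri Sr. Qed.
Let iS_rS V t : iS V (rS V t) = rho V e t. Proof. exact: retract_ir Sr. Qed.

Lemma rho_iS V z t : rho V (e * z) (iS V t) = rho V z (iS V t).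
Proof. by rewrite -rhoM_app -iS_rS rS_iS. Qed.

(** The dual bases give the maps: [x j] embeds the j-th copy of [S] into [F] and [y j] projects
    back. Their composite corresponds to p = sum_j y_j x_j. That p lies in the ideal A e A separates
    different types; that p fixes e A eps from the right says that the whole e-isotypic part of [F]
    is captured. *)
Lemma isotypic_retract : let m := \dim (sandwich e eps) in
  exists p (I : forall V, 'Hom(copies_functor S m V, F V))
           (O : forall V, 'Hom(F V, copies_functor S m V)),
  [/\ natural I, natural O, forall V t, O V (I V t) = t
    & (forall V t, i V (I V (O V (r V t))) = rho V p t) /\
      ((exists (J : finType) (a b : J -> A), p = \sum_j a j * e * b j) /\
       (forall z, e * z * eps * p = e * z * eps))].
Proof.
move=> m.
have [x [y [xE yE xy zE]]] := sandwich_dual_basis char0 e_idem eps_idem e_scal.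
pose I V : 'Hom(copies_functor S m V, F V) := linfun (fun a : {ffun 'I_m -> S V} =>
  \sum_j r V (rho V (x j) (iS V (a j)))).
have IE V a : I V a = \sum_j r V (rho V (x j) (iS V ((a : {ffun 'I_m -> S V}) j))).
  rewrite /I linfunE // => k u v; rewrite scaler_sumr -big_split /=.
  by apply: eq_bigr => j _; rewrite !ffunE !linearP.
pose O V : 'Hom(F V, copies_functor S m V) := linfun (fun t : F V =>
  [ffun j => rS V (rho V (y j) (i V t))] : {ffun 'I_m -> S V}).
have OE V t : O V t = [ffun j => rS V (rho V (y j) (i V t))] :> {ffun 'I_m -> S V}.
  by rewrite /O linfunE // => k u v; apply/ffunP => j; rewrite !ffunE !linearP.
have [ni nr _ _] := Fr; have [niS nrS _ _] := Sr.
exists (\sum_j y j * x j), I, O; split.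
- move=> V W f; apply/lfunP => a.
  rewrite [LHS]comp_lfunE [RHS]comp_lfunE !IE linear_sum; apply: eq_bigr => j _.
  rewrite [fmap _ _ _]copies_mapE ffunE (natural_app _ _ niS).
  by rewrite (natural_app _ _ (natural_rho (x j))) (natural_app _ _ nr).
- move=> V W f; apply/lfunP => t.
  rewrite [LHS]comp_lfunE [RHS]comp_lfunE OE [RHS]copies_mapE; apply/ffunP => j.
  rewrite !ffunE OE ffunE (natural_app _ _ ni).
  by rewrite (natural_app _ _ (natural_rho (y j))) (natural_app _ _ nrS).
- move=> V t; rewrite OE; apply/ffunP => k; rewrite ffunE IE !linear_sum /=.
  rewrite (bigD1 k) //= big1 ?addr0 => [|j jk]; rewrite ir !rhoM_app.
    rewrite [y k]yE !mulrA -(mulrA (x k)) eps_idem -2!mulrA [eps * (_ * e)]mulrA -yE xy eqxx.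
    by rewrite scale1r -[e]mulr1 rho_iS rho1 id_lfunE rS_iS.
  rewrite [y k]yE !mulrA -(mulrA (x j)) eps_idem -2!mulrA [eps * (_ * e)]mulrA -yE xy (negPf jk).
  by rewrite scale0r rho0 zero_lfunE linear0.
split=> [V t|].
  rewrite IE rho_sum sum_lfunE linear_sum; apply: eq_bigr => j _.
  rewrite /= OE ffunE !ir iS_rS !rhoM_app; congr (fun_of_lfun (rho V _) t).
  by rewrite [in RHS]xE [in RHS]yE !mulrA -(mulrA _ e e) e_idem.
split; first exists _, y, x.
  apply: eq_bigr => j _; congr (_ * _).
  by rewrite [RHS](_ : _ = y j) // {1}(yE j) -mulrA e_idem -yE.
by move=> z; rewrite [RHS]zE mulr_sumr; apply: eq_bigr => j _; rewrite mulrA.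
Qed.

End Isotypic.

Variables (T : eqType) (e : T -> A) (S : T -> functor K n).
Local Notation m l := (\dim (sandwich (e l) eps)).

Lemma bigsum_retract (L : seq T) : uniq L ->
  (forall l, l \in L -> exists iS rS, retract_of (F := S l) (e l) iS rS) ->
  (forall l, l \in L -> e l * e l = e l) ->
  (forall l z, l \in L -> exists k : K, e l * z * e l = k *: e l) ->
  (forall l l' z, l \in L -> l' \in L -> l != l' -> e l * z * e l' = 0) ->
  let G := bigsum_functor L (fun l => copies_functor (S l) (m l)) in
  exists p (I : forall V, 'Hom(G V, F V)) (O : forall V, 'Hom(F V, G V)),
  [/\ natural I, natural O, forall V t, O V (I V t) = t
    & (forall V t, i V (I V (O V (r V t))) = rho V p t) /\
      ((exists (J : finType) (l : J -> T) (a b : J -> A), (forall j, l j \in L) /\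
          p = \sum_j a j * e (l j) * b j) /\
       (forall l z, l \in L -> e l * z * eps * p = e l * z * eps))].
Proof.
elim: L => [|l L IHL] /=.
  move=> _ _ _ _ _; exists 0, (fun V => 0), (fun V => 0); split.
  - exact: natural_zero.
  - exact: natural_zero.
  - by move=> V t; rewrite [LHS]zero_lfunE [LHS]thinmx0 [RHS]thinmx0.
  split=> [V t|]; first by rewrite !zero_lfunE linear0 rho0 zero_lfunE.
  split=> //; exists void, (fun j : void => match j return T with end), (fun=> 0), (fun=> 0).
  by split=> [[]|]; rewrite big1 //; case.
case/andP=> lL uL Sr e_idem e_scal e_orth.
have [l' l'L|l' l'L|l' z l'L|l1 l2 z l1L l2L l12|p' [I' [O' [nI' nO' OI' [IO' [[J' [lab' [a' [b' [lab'L p'E]]]]] zp']]]]]] := IHL uL.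
- by apply: Sr; rewrite inE l'L orbT.
- by apply: e_idem; rewrite inE l'L orbT.
- by apply: e_scal; rewrite inE l'L orbT.
- by apply: e_orth; rewrite ?inE ?l1L ?l2L ?orbT.
have ll : l \in l :: L by rewrite inE eqxx.
have [iS [rS Slr]] := Sr l ll.
have [p [I1 [O1 [nI1 nO1 OI1 [IO1 [[J [a [b pE]]] zp]]]]]] :=
  isotypic_retract Slr (e_idem l ll) (fun z => e_scal l z ll).
have e_lL j z : e l * z * e (lab' j) = 0.
  by apply: e_orth => //; [rewrite inE lab'L orbT | apply: contraNneq lL => ->].
have e_Ll j z : e (lab' j) * z * e l = 0.
  by apply: e_orth => //; [rewrite inE lab'L orbT | apply: contraNneq lL => <-].
have pp' : p * p' = 0.
  rewrite pE p'E mulr_suml big1 // => j _; rewrite mulr_sumr big1 // => k _.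
  transitivity (a j * (e l * (b j * a' k) * e (lab' k)) * b' k); first by rewrite !mulrA.
  by rewrite e_lL mulr0 mul0r.
have p'p : p' * p = 0.
  rewrite pE p'E mulr_suml big1 // => j _; rewrite mulr_sumr big1 // => k _.
  transitivity (a' j * (e (lab' j) * (b' j * a k) * e l) * b k); first by rewrite !mulrA.
  by rewrite e_Ll mulr0 mul0r.
have OI1' V t : O1 V (I' V t) = 0.
  have := congr1 (fun z => O1 V (r V z)) (IO1 V (i V (I' V t))).
  rewrite !ri OI1 => ->.
  have := IO' V (i V (I' V t)); rewrite ri OI' => ->.
  by rewrite rhoM_app p'p rho0 zero_lfunE !linear0.
have OI'1 V t : O' V (I1 V t) = 0.
  have := congr1 (fun z => O' V (r V z)) (IO' V (i V (I1 V t))).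
  rewrite !ri OI' => ->.
  have := IO1 V (i V (I1 V t)); rewrite ri OI1 => ->.
  by rewrite rhoM_app pp' rho0 zero_lfunE !linear0.
set G1 := copies_functor _ _; set G2 := bigsum_functor L _.
pose I V : 'Hom(sum_functor G1 G2 V, F V) :=
  linfun (fun t : (G1 V * G2 V)%type => I1 V t.1 + I' V t.2).
have IE V t : I V t = I1 V t.1 + I' V t.2.
  by rewrite /I linfunE // => k u v; rewrite !linearP scalerDr addrACA.
pose O V : 'Hom(F V, sum_functor G1 G2 V) :=
  linfun (fun t : F V => (O1 V t, O' V t) : (G1 V * G2 V)%type).
have OE V t : O V t = (O1 V t, O' V t).
  by rewrite /O linfunE // => k u v; rewrite !linearP.
exists (p + p'), I, O; split.
- move=> V W f; apply/lfunP => t.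
  rewrite [LHS]comp_lfunE [RHS]comp_lfunE !IE [fmap _ _ _]sum_mapE linearD /=.
  by rewrite (natural_app _ _ nI1) (natural_app _ _ nI').
- move=> V W f; apply/lfunP => t.
  rewrite [LHS]comp_lfunE [RHS]comp_lfunE OE [RHS]sum_mapE OE /=.
  by rewrite (natural_app _ _ nO1) (natural_app _ _ nO').
- move=> V [t1 t2]; rewrite OE IE /= !linearD /= OI1 OI' OI1' OI'1.
  by rewrite addr0 add0r.
split=> [V t|].
  by rewrite IE OE /= linearD /= IO1 IO' rhoD add_lfunE.
split.
  exists (J + J')%type, (fun j => match j with inl _ => l | inr k => lab' k end),
    (fun j => match j with inl k => a k | inr k => a' k end),
    (fun j => match j with inl k => b k | inr k => b' k end).
  split=> [[k|k]|]; rewrite ?inE ?eqxx ?lab'L ?orbT //.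
  by rewrite big_sumType /= pE p'E.
move=> l0 z; rewrite inE => /predU1P[->|l0L]; rewrite mulrDr.
  rewrite zp p'E mulr_sumr big1 ?addr0 // => j _.
  transitivity (e l * (z * eps * a' j) * e (lab' j) * b' j); first by rewrite !mulrA.
  by rewrite e_lL mul0r.
rewrite zp' // pE mulr_sumr big1 ?add0r // => j _.
transitivity (e l0 * (z * eps * a j) * e l * b j); first by rewrite !mulrA.
by rewrite e_orth ?mul0r ?inE ?eqxx ?l0L ?orbT //; apply: contraNneq lL => <-.
Qed.

(** The completeness hypothesis applied to z = 1 - p gives eps p = eps, so the retraction onto the
    direct sum is invertible. *)
Lemma retract_decomposition (L : seq T) : uniq L ->
  (forall l, l \in L -> exists iS rS, retract_of (F := S l) (e l) iS rS) ->
  (forall l, l \in L -> e l * e l = e l) ->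
  (forall l z, l \in L -> exists k : K, e l * z * e l = k *: e l) ->
  (forall l l' z, l \in L -> l' \in L -> l != l' -> e l * z * e l' = 0) ->
  (forall z, (forall l x, l \in L -> e l * x * eps * z = 0) -> eps * z = 0) ->
  natural_iso F (bigsum_functor L (fun l => copies_functor (S l) (m l))).
Proof.
move=> uL Sr e_idem e_scal e_orth complete.
have [p [I [O [nI nO OI [IO [_ zp]]]]]] := bigsum_retract uL Sr e_idem e_scal e_orth.
have ep : eps * p = eps.
  apply/eqP; rewrite -subr_eq0 -{2}[eps]mulr1 -mulrBr; apply/eqP.
  by apply: complete => l x lL; rewrite mulrBr mulr1 zp // subrr.
exists O; split=> // V; exists (I V) => // t.
have ip : rho V p (i V t) = i V t.
  by rewrite -[in RHS](ri t) ir -ep -rhoM_app -ir ri.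
by have := congr1 (r V) (IO V (i V t)); rewrite !ri ip ri.
Qed.

End Decomposition.

(** * Dimension counts and spanning families *)

Section Dimensions.

Variable K : fieldType.
Implicit Types A B C : vectType K.

Lemma dim_tensor A B : \dim {: tensor A B} = (\dim {:A} * \dim {:B})%N.
Proof. by rewrite dimvf dim_matrix. Qed.

Lemma dim_bigtensor (I : finType) (E : I -> vectType K) :
  \dim {: bigtensor E} = (\prod_i \dim {: E i})%N.
Proof.
rewrite dimvf -[LHS]/(#|{dffun forall i, 'I_(\dim {:E i})}| * 1)%N muln1.
rewrite card_dep_ffun /image_mem -[RHS]big_enum /=.
by elim: (enum I) => [|i s IHs]; rewrite ?big_nil ?big_cons //= IHs card_ord.
Qed.

Lemma surj_lker0 A B (f : 'Hom(A, B)) : \dim {:A} = \dim {:B} ->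
  limg f = fullv -> lker f == 0%VS.
Proof.
move=> e fE; have := limg_ker_dim f fullv; rewrite fE e capfv => /eqP.
by rewrite -[X in _ == X]add0n eqn_add2r dimv_eq0.
Qed.

Lemma lker0_invK A B (f : 'Hom(A, B)) : lker f == 0%VS -> limg f = fullv ->
  cancel f (f^-1)%VF /\ cancel (f^-1)%VF f.
Proof.
by move=> f0 fE; split; [apply: lker0_lfunK | move=> x; rewrite limg_lfunVK // fE memvf].
Qed.

Lemma pure_sum (I : finType) (E : I -> vectType K) (J : I -> finType)
    (c : forall i, J i -> K) (u : forall i, J i -> E i) :
  pure (fun i => \sum_j c i j *: u i j) =
  \sum_(t : {dffun forall i, J i}) (\prod_i c i (t i)) *: pure (fun i => u i (t i)).
Proof.
apply/ffunP => s; rewrite sum_ffunE ffunE.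
under eq_bigr => i _ do rewrite bcoord_sumr.
rewrite big_dffun_distr; apply: eq_bigr => t _; rewrite !ffunE -[_ *: _]/(_ * _) -big_split /=.
by apply: eq_bigr => i _; rewrite bcoordZ.
Qed.

Definition spans (J : finType) (A : vectType K) (u : J -> A) :=
  forall x : A, exists c : J -> K, x = \sum_j c j *: u j.

Lemma spans_full (J : finType) A (u : J -> A) (U : {vspace A}) :
  spans u -> (forall j, u j \in U) -> U = fullv.
Proof.
move=> su uU; apply/eqP; rewrite eqEsubv subvf /=; apply/subvP => x _.
by have [c ->] := su x; rewrite memv_suml // => j _; rewrite memvZ.
Qed.

Lemma spans_bvec (I : finType) (E : I -> vectType K) :
  spans (fun s : {dffun forall i, 'I_(\dim {:E i})} => pure (fun i => bvec (s i))).
Proof. by move=> x; exists x; apply: bigtensor_sum. Qed.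

Lemma spans_sum (J L : finType) A (u : J -> A) (w : L -> A) :
  spans u -> (forall j, exists c : L -> K, u j = \sum_l c l *: w l) -> spans w.
Proof.
move=> su /fin_all_exists[b ub] x; have [c ->] := su x.
exists (fun l => \sum_j c j * b j l).
under eq_bigr => j _ do rewrite ub scaler_sumr.
rewrite exchange_big; apply: eq_bigr => l _; rewrite scaler_suml.
by apply: eq_bigr => j _; rewrite scalerA.
Qed.

Lemma spans_pure (I : finType) (E : I -> vectType K) (J : I -> finType)
    (u : forall i, J i -> E i) : (forall i, spans (u i)) ->
  spans (fun t : {dffun forall i, J i} => pure (fun i => u i (t i))).
Proof.
move=> su; apply: spans_sum (spans_bvec (E := E)) _ => s.
have /fin_all_exists[c cP] := fun i => su i (bvec (s i)).
by exists (fun t : {dffun forall i, J i} => \prod_i c i (t i)); rewrite (eq_pure cP) pure_sum.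
Qed.

Lemma spans_tpure (J L : finType) A B (u : J -> A) (w : L -> B) :
  spans u -> spans w -> spans (fun t : J * L => tpure (u t.1) (w t.2)).
Proof.
move=> su sw x.
have e (a : A) (b : B) : exists c : J * L -> K, tpure a b = \sum_t c t *: tpure (u t.1) (w t.2).
  have [c ->] := su a; have [c' ->] := sw b; exists (fun t => c t.1 * c' t.2).
  rewrite -(linfunE (tpure_linl _)) linear_sum /=.
  rewrite -(pair_bigA _ (fun j l => (c j * c' l) *: tpure (u j) (w l))) /=.
  apply: eq_bigr => j _; rewrite linearZ /= (linfunE (tpure_linl _)).
  rewrite -(linfunE (tpure_linr _)) linear_sum scaler_sumr; apply: eq_bigr => l _.
  by rewrite linearZ /= (linfunE (tpure_linr _)) scalerA.
apply: (spans_sum (u := fun t : 'I_(\dim {:A}) * 'I_(\dim {:B}) => tpure (bvec t.1) (bvec t.2))).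
  move=> z; exists (fun t => z t.1 t.2).
  by rewrite {1}[z]tensor_sum pair_bigA.
by move=> t; apply: e.
Qed.

End Dimensions.

(** * Schur functors as natural summands of tensor powers *)

Section TensorPowerAction.

Variables (K : fieldType) (k : nat).
Implicit Types (V W : vectType K) (x y : galg K 'S_k).

Definition trho V x : 'End(tpower k V) := \sum_g gcoef x g *: tpower_perm V g.

Lemma trhoE V x t : trho V x t = \sum_g gcoef x g *: tpower_perm V g t.
Proof. by rewrite /trho sum_lfunE; apply: eq_bigr => g _; rewrite scale_lfunE. Qed.

Lemma trhoM V x y : (trho V x \o trho V y)%VF = trho V (y * x).
Proof.
apply: tpower_ext => v; rewrite comp_lfunE [LHS]trhoE [RHS]trhoE.
under [LHS]eq_bigr => g _.
  rewrite trhoE linear_sum scaler_sumr; over.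
under [RHS]eq_bigr => g _.
  rewrite gcoefM scaler_suml; over.
rewrite /= exchange_big [RHS]exchange_big /=; apply: eq_bigr => h _.
rewrite [RHS](reindex_inj (mulgI h)) /=; apply: eq_bigr => g _.
rewrite mulKg mulrC -scalerA linearZ /=; congr (_ *: (_ *: _)).
rewrite !tpower_permE; apply: eq_ppure => i; by rewrite invMg permM.
Qed.

Lemma trho_natural V W (f : 'Hom(V, W)) x :
  (trho W x \o tpower_map k f = tpower_map k f \o trho V x)%VF.
Proof.
apply/lfunP => t; rewrite !comp_lfunE !trhoE linear_sum; apply: eq_bigr => g _.
by rewrite linearZ /= -!comp_lfunE tpower_map_perm.
Qed.

End TensorPowerAction.

Section SchurRetract.

Variable K : fieldType.
Hypothesis char0 : [pchar K] =i pred0.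

(** An idempotent generating the same left ideal as the Young symmetrizer c. The pseudo-inverse
    avoids computing the scalar that relates c c to c. *)
Definition eyoung N l : galg K 'S_N :=
  galg_pinv char0 (young K N l) * young K N l.

Definition tpower_retract (F : functor1 K) N (x : galg K 'S_N) :=
  exists (s : forall V, 'Hom(F V, tpower N V)) (p : forall V, 'Hom(tpower N V, F V)),
  [/\ forall (V W : vectType K) (f : 'Hom(V, W)), (s W \o fmap1 F f = tpower_map N f \o s V)%VF,
      forall (V W : vectType K) (f : 'Hom(V, W)), (p W \o tpower_map N f = fmap1 F f \o p V)%VF,
      forall V, (p V \o s V)%VF = \1%VF & forall V, (s V \o p V)%VF = trho V x].

Lemma young_trho l V : young_symmetrizer l V = trho V (young K (sumn l) l).
Proof.
rewrite /young -trhoM /young_symmetrizer; congr (_ \o _)%VF.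
  rewrite /trho /csum [RHS](bigID (mem (colg (sumn l) l))) /= [X in _ = _ + X]big1 ?addr0 => [|g gC].
    apply: eq_bigr => g gC; rewrite gcoef_sum (bigD1 g) //= gcoefZ gcoef_elt eqxx mulr1.
    rewrite big1 ?addr0 // => h /andP[_ hg].
    by rewrite gcoefZ gcoef_elt eq_sym (negPf hg) mulr0.
  rewrite gcoef_sum big1 ?scale0r // => h hC; rewrite gcoefZ gcoef_elt.
  by case: eqP => [e|]; rewrite ?mulr0 //; rewrite e hC in gC.
rewrite /trho /rsum [RHS](bigID (mem (rowg (sumn l) l))) /= [X in _ = _ + X]big1 ?addr0 => [|g gC].
  apply: eq_bigr => g gC; rewrite gcoef_sum (bigD1 g) //= gcoef_elt eqxx.
  rewrite big1 ?addr0 ?scale1r // => h /andP[_ hg].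
  by rewrite gcoef_elt eq_sym (negPf hg).
rewrite gcoef_sum big1 ?scale0r // => h hC; rewrite gcoef_elt.
by case: eqP => [e|] //; rewrite e hC in gC.
Qed.

(** Because the action reverses products, [eyoung] acts as a pseudo-inverse followed by the Young
    symmetrizer: a projection onto the image of the latter. *)
Lemma schur_tpower_retract l N : sumn l = N -> tpower_retract (schur K l) (eyoung N l).
Proof.
move=> e; case: N / e; set c := young K (sumn l) l; set y := galg_pinv char0 c.
have cyc : c * y * c = c by apply: galg_pinvK.
have eE V t : trho V (eyoung (sumn l) l) t = young_symmetrizer l V (trho V y t).
  by rewrite young_trho -comp_lfunE trhoM.
pose s V : 'Hom(schur K l V, tpower (sumn l) V) :=
  linfun (vsval : subvs_of (limg (young_symmetrizer l V)) -> _).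
have sE V w : s V w = vsval (w : subvs_of (limg (young_symmetrizer l V))).
  by rewrite /s lfunE.
pose p V : 'Hom(tpower (sumn l) V, schur K l V) :=
  (linfun (vsproj (limg (young_symmetrizer l V))) \o trho V (eyoung (sumn l) l))%VF.
have pE V t : s V (p V t) = trho V (eyoung (sumn l) l) t.
  rewrite sE /p comp_lfunE lfunE /= vsprojK // eE memv_img ?memvf //.
have s_inj V : injective (s V) by move=> w w'; rewrite !sE; apply: subvs_inj.
exists s, p; split=> [V W f|V W f|V|V].
- by apply/lfunP => w; rewrite [LHS]comp_lfunE [RHS]comp_lfunE !sE; apply: schur_mapE.
- apply/lfunP => t; rewrite [LHS]comp_lfunE [RHS]comp_lfunE; apply: s_inj.
  rewrite pE [RHS]sE [RHS](schur_mapE (l := l)) -sE pE.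
  by rewrite -[LHS]comp_lfunE trho_natural comp_lfunE.
- apply/lfunP => w; rewrite comp_lfunE id_lfunE; apply: s_inj; rewrite pE.
  have : s V w \in limg (young_symmetrizer l V) by rewrite sE subvsP.
  case/memv_imgP => u _ ->; rewrite young_trho -comp_lfunE trhoM; congr (fun_of_lfun (trho V _) u).
  by rewrite /eyoung mulrA.
by apply/lfunP => t; rewrite comp_lfunE pE.
Qed.

Variables (n : nat) (N : 'I_n -> nat).
Implicit Types V W : 'I_n -> vectType K.

Definition nested V : vectType K := bigtensor (fun i => tpower (N i) (V i)).

Definition nest_fun V (v : forall x : slots N, V (tag x)) : nested V :=
  pure (fun i => ppure (fun k : 'I_(N i) => v (slot k) : V i)).

Definition nest V : 'Hom(tens K N V, nested V) :=
  bigtensor_lift (E := fun x : slots N => V (tag x)) (@nest_fun V).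

Lemma slot_inj i : injective (fun k : 'I_(N i) => slot k).
Proof. by move=> k k' /eqP; rewrite /slot eq_Tagged => /eqP. Qed.

Lemma nestE V (v : forall x : slots N, V (tag x)) : nest V (pure v) = nest_fun v.
Proof.
apply: (bigtensor_liftE (E := fun x : slots N => V (tag x))); split=> [u w uw|[i k]].
  by apply: eq_pure => i; apply: eq_pure => k; exact: (uw (slot k)).
apply: (slot_linear_comp (j0 := i)
  (gamma := fun i (v : forall x : slots N, V (tag x)) => ppure (fun k : 'I_(N i) => v (slot k) : V i))).
- exact: multilinear_pure.
- apply: (slot_linear_comp (j0 := k)
    (gamma := fun k (v : forall x : slots N, V (tag x)) => v (slot k) : V i)).
  + exact: multilinear_pure.
  + exact: (slot_linear_proj (erefl (slot k))).
  + move=> k' k'k; have ne : slot k != slot k'.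
      by apply: contraNneq k'k => /slot_inj->.
    exact: (slot_indep_proj ne).
- move=> j ji; apply: (slot_indep_comp
    (gamma := fun k (v : forall x : slots N, V (tag x)) => v (slot k) : V j)).
    exact: multilinear_pure.
  move=> k'; have ne : slot k != slot k'.
    by apply: contraNneq ji => /(congr1 (@tag _ _)) /= ->.
  exact: (slot_indep_proj ne).
Qed.

(** Regrouping is onto, since it reaches a spanning family of nested pure tensors, and the
    dimensions agree. *)
Lemma nest_bij V : cancel (nest V) (nest V)^-1%VF /\ cancel (nest V)^-1%VF (nest V).
Proof.
have full : limg (nest V) = fullv.
  apply: (spans_full (spans_pure (u := fun i (s : {dffun 'I_(N i) -> 'I_(\dim {:V i})}) =>
    ppure (fun k => bvec (s k))) _)) => [i|t]; first exact: spans_bvec.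
  apply/memv_imgP; exists (pure (fun x : slots N => bvec (t (tag x) (tagged x)))).
    exact: memvf.
  by rewrite nestE.
apply: lker0_invK => //; apply: surj_lker0 => //.
rewrite !dim_bigtensor.
under [RHS]eq_bigr => i _ do rewrite dim_bigtensor.
by rewrite (sig_big_dep _ (fun i => predT) (fun i (_ : 'I_(N i)) => \dim {:V i})).
Qed.

Lemma nest_rho V (x : forall i, galg K 'S_(N i)) t :
  nest V (rho V (gtens x) t) = bigtensor_map (fun i => trho (V i) (x i)) (nest V t).
Proof.
rewrite -!comp_lfunE; congr (fun_of_lfun _ t); apply: bigtensor_ext => v.
rewrite !comp_lfunE rhoE nestE bigtensor_mapE linear_sum.
rewrite (eq_pure (fun i => trhoE _ _)) pure_sum; apply: eq_bigr => g _.
rewrite linearZ /= gcoef_gtens; congr (_ *: _).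
rewrite slot_actE nestE; apply: eq_pure => i; rewrite tpower_permE; apply: eq_ppure => k.
by rewrite /slot_perm /slot /= invg_ffun.
Qed.

Lemma nest_natural V W (f : forall i, 'Hom(V i, W i)) t :
  nest W (tens_map N f t) = bigtensor_map (fun i => tpower_map (N i) (f i)) (nest V t).
Proof.
rewrite -!comp_lfunE; congr (fun_of_lfun _ t); apply: bigtensor_ext => v.
rewrite !comp_lfunE bigtensor_mapE !nestE bigtensor_mapE.
by apply: eq_pure => i; rewrite tpower_mapE.
Qed.

Definition meyoung (nu : 'I_n -> seq nat) : galg K (slot_group N) :=
  gtens (fun i => eyoung (N i) (nu i)).

Lemma tensor_functor_retract (F : 'I_n -> functor1 K) (nu : 'I_n -> seq nat) :
  (forall i, sumn (nu i) = N i) -> (forall i, F i = schur K (nu i)) ->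
  exists iS rS, retract_of (F := tensor_functor F) (meyoung nu) iS rS.
Proof.
move=> eN eF.
have /fin_all_exists[s] : forall i, tpower_retract (F i) (eyoung (N i) (nu i)).
  by move=> i; rewrite eF; apply: schur_tpower_retract.
case/fin_all_exists => p sp.
pose iS V : 'Hom(tensor_functor F V, tens K N V) :=
  ((nest V)^-1 \o bigtensor_map (fun i => s i (V i)))%VF.
pose rS V : 'Hom(tens K N V, tensor_functor F V) :=
  (bigtensor_map (fun i => p i (V i)) \o nest V)%VF.
have nest_inj V : injective (nest V) by apply: can_inj (nest_bij V).1.
have nest_iS V t : nest V (iS V t) = bigtensor_map (fun i => s i (V i)) t.
  by rewrite /iS comp_lfunE (nest_bij V).2.
have rSE V t : rS V t = bigtensor_map (fun i => p i (V i)) (nest V t).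
  by rewrite /rS comp_lfunE.
exists iS, rS; split=> [V W f|V W f|V|V]; apply/lfunP => t;
  rewrite [LHS]comp_lfunE ?[RHS]comp_lfunE.
- apply: nest_inj; rewrite nest_iS nest_natural nest_iS -!comp_lfunE.
  congr (fun_of_lfun _ t); rewrite -[fmap _ _]/(bigtensor_map (fun i => fmap1 (F i) (f i))).
  rewrite -!(bigtensor_map_comp (fun=> erefl)).
  by apply: eq_bigtensor_map => i; case: (sp i) => ->.
- rewrite !rSE nest_natural -!comp_lfunE; congr (fun_of_lfun _ _).
  rewrite -[fmap _ _]/(bigtensor_map (fun i => fmap1 (F i) (f i))).
  rewrite -!(bigtensor_map_comp (fun=> erefl)).
  congr (_ \o _)%VF; by apply: eq_bigtensor_map => i; case: (sp i) => _ ->.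
- rewrite rSE nest_iS id_lfunE -comp_lfunE -!(bigtensor_map_comp (fun=> erefl)).
  rewrite bigtensor_map_id ?id_lfunE // => i; by case: (sp i).
apply: nest_inj; rewrite nest_iS rSE nest_rho -comp_lfunE; congr (fun_of_lfun _ _).
rewrite -!(bigtensor_map_comp (fun=> erefl)).
by apply: eq_bigtensor_map => i; case: (sp i).
Qed.

End SchurRetract.

Section SchurDecomposition.

Variables (K : fieldType) (n : nat) (N : 'I_n -> nat).
Hypothesis char0 : [pchar K] =i pred0.
Local Notation A := (galg K (slot_group N)).
Implicit Types nu mu : 'I_n -> seq nat.

Definition mpinv nu : A := gtens (fun i => galg_pinv char0 (young K (N i) (nu i))).

Lemma meyoungE nu : meyoung char0 N nu = mpinv nu * myoung K N nu.
Proof. by rewrite gtensM. Qed.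

Lemma mpinvK nu : myoung K N nu * mpinv nu * myoung K N nu = myoung K N nu.
Proof. by rewrite !gtensM; apply: eq_gtens => i; apply: galg_pinvK. Qed.

Lemma meyoungK nu : myoung K N nu * meyoung char0 N nu = myoung K N nu.
Proof. by rewrite meyoungE mulrA mpinvK. Qed.

Lemma meyoung_idem nu : meyoung char0 N nu * meyoung char0 N nu = meyoung char0 N nu.
Proof. by rewrite {1}meyoungE -mulrA meyoungK -meyoungE. Qed.

Lemma meyoung_scalar nu z : mshape N nu ->
  exists k : K, meyoung char0 N nu * z * meyoung char0 N nu = k *: meyoung char0 N nu.
Proof.
move=> snu; have [k e] := myoung_scalar char0 (z * mpinv nu) snu; exists k.
by rewrite meyoungE scalerAr -e !mulrA.
Qed.

Lemma meyoung_orth nu mu z : mshape N nu -> mshape N mu ->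
  (exists i k, nth 0%N (nu i) k != nth 0%N (mu i) k) ->
  meyoung char0 N nu * z * meyoung char0 N mu = 0.
Proof.
move=> snu smu ne; have e := myoung_orth char0 (z * mpinv mu) snu smu ne.
rewrite !meyoungE; transitivity (mpinv nu * (myoung K N nu * (z * mpinv mu) * myoung K N mu)).
  by rewrite !mulrA.
by rewrite e mulr0.
Qed.

(** Left multiplication by the symmetrizer c maps e A eps onto c A eps, and multiplication by
    [mpinv nu] undoes it. *)
Lemma dim_sandwich_meyoung nu eps :
  \dim (sandwich (meyoung char0 N nu) eps) = \dim (sandwich (myoung K N nu) eps).
Proof.
pose c := myoung K N nu.
have -> : sandwich c eps = (glmul c @: sandwich (meyoung char0 N nu) eps)%VS.
  apply/vspaceP => z; apply/sandwichP/memv_imgP => [[w ->]|[u + ->]].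
    exists (meyoung char0 N nu * w * eps); first by apply/sandwichP; exists w.
    by rewrite glmulE !mulrA meyoungK.
  by case/sandwichP => w ->; exists w; rewrite glmulE !mulrA meyoungK.
rewrite (limg_dim_eq (f := glmul c)) //; apply/eqP; rewrite -[_ == _]subv0; apply/subvP => z.
rewrite memv_cap memv_ker glmulE memv0 => /andP[/sandwichP[w ->]].
move/eqP/(congr1 (fun x => mpinv nu * x)); rewrite mulr0 !mulrA -meyoungE.
by rewrite meyoung_idem => ->.
Qed.

Variables (F : functor K n) (eps : A) (i : forall V, 'Hom(F V, tens K N V))
  (r : forall V, 'Hom(tens K N V, F V)).
Hypotheses (Fr : retract_of eps i r) (eps_idem : eps * eps = eps).

(** The list may omit every multipartition mu with c_mu A eps = 0: writing 1 through Young
    symmetrizers ([myoung_complete]) shows that the listed ones detect eps z. Listed shapes are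
    matched with partitions through equality of symmetrizers, since a shape may carry a zero row. *)
Lemma schur_decomposition (T : eqType) (L : seq T) (nu : T -> 'I_n -> seq nat)
    (G : T -> 'I_n -> functor1 K) (m : T -> nat) : uniq L ->
  (forall l, l \in L -> mshape N (nu l)) ->
  (forall l j, l \in L -> G l j = schur K (nu l j)) ->
  (forall l l', l \in L -> l' \in L -> l != l' ->
     exists j k, nth 0%N (nu l j) k != nth 0%N (nu l' j) k) ->
  (forall mu, (forall j, mu j \in parts_of (N j)) ->
     (exists2 l, l \in L & forall j, young K (N j) (mu j) = young K (N j) (nu l j)) \/
     (forall x, myoung K N mu * x * eps = 0)) ->
  (forall l, l \in L -> m l = \dim (sandwich (myoung K N (nu l)) eps)) ->
  natural_iso F (bigsum_functor L (fun l => copies_functor (tensor_functor (G l)) (m l))).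
Proof.
move=> uL sL GE dL cov mE; pose e l := meyoung char0 N (nu l).
have -> : bigsum_functor L (fun l => copies_functor (tensor_functor (G l)) (m l)) =
  bigsum_functor L (fun l => copies_functor (tensor_functor (G l)) (\dim (sandwich (e l) eps))).
  elim: L mE {uL sL GE dL cov} => //= l L IHL mE.
  rewrite IHL => [|l' l'L]; last by apply: mE; rewrite inE l'L orbT.
  by rewrite mE ?inE ?eqxx // dim_sandwich_meyoung.
apply: (retract_decomposition char0 Fr eps_idem (e := e)) => //.
- move=> l lL; apply: tensor_functor_retract => j; last exact: GE.
  by case: (sL l lL j).
- by move=> l _; apply: meyoung_idem.
- by move=> l z lL; apply/meyoung_scalar/sL.
- by move=> l l' z lL l'L ll'; apply: meyoung_orth; [apply: sL|apply: sL|apply: dL].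
move=> z ez; have [J [x [y [lab [labP e1]]]]] := myoung_complete N char0.
rewrite -[eps * z]mul1r e1 mulr_suml big1 // => j _.
transitivity (x j * (myoung K N (lab j) * y j * eps * z)); first by rewrite !mulrA.
have [[l lL labE]|->] := cov _ (labP j); last by rewrite mul0r mulr0.
rewrite /myoung (eq_gtens labE) -/(myoung K N (nu l)) -meyoungK -!mulrA.
by rewrite [meyoung _ _ _ * _]mulrA [_ * (eps * z)]mulrA ez // !mulr0.
Qed.

End SchurDecomposition.

(** * Koszul terms as retracts of tensor functors *)

Section CoinvariantSection.

Variables (K : fieldType) (k : nat) (chi : 'S_k -> K).
Hypothesis char0 : [pchar K] =i pred0.
Hypothesis chiM : forall s t, chi (s * t)%g = chi s * chi t.
Implicit Types V W : vectType K.

(** Twisted averaging kills the coinvariant relations and is the identity modulo them, so it induces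
    a natural section of the quotient map. *)
Definition coinv_avg V : 'End(tpower k V) :=
  ((#|'S_k|)%:R)^-1 *: \sum_(s : 'S_k) chi s *: tpower_perm V s.

Lemma coinv_avg_pure V (v : 'I_k -> V) : coinv_avg V (ppure v) =
  ((#|'S_k|)%:R)^-1 *: \sum_(s : 'S_k) chi s *: ppure (fun i => v ((s^-1)%g i)).
Proof.
rewrite /coinv_avg scale_lfunE sum_lfunE; congr (_ *: _); apply: eq_bigr => s _.
by rewrite scale_lfunE tpower_permE.
Qed.

Lemma coinv_avg_rel V t : t \in coinv_rel chi V -> coinv_avg V t = 0.
Proof.
move=> tr; apply/eqP; rewrite -memv_ker; apply: subvP t tr; rewrite lkerE -subv0.
apply: coinv_relP => s v; rewrite memv0 linearB linearZ /= !coinv_avg_pure scalerA mulrC -scalerA.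
rewrite -scalerBr scaler_eq0; apply/orP; right; rewrite subr_eq0; apply/eqP.
rewrite [LHS](reindex_inj (mulgI s)) scaler_sumr; apply: eq_bigr => t _.
rewrite scalerA -chiM; congr (_ *: _); apply: eq_ppure => i.
by rewrite invMg permM.
Qed.

Definition coinv_sect V : 'Hom(coinv chi V, tpower k V) := (coinv_avg V \o quot_repr _)%VF.

Lemma coinv_sectE V t : coinv_sect V (quot_pi _ t) = coinv_avg V t.
Proof.
rewrite /coinv_sect comp_lfunE quot_piE linearB /= [X in _ - X]coinv_avg_rel ?memv_proj //.
by rewrite subr0.
Qed.

Lemma coinv_sectK V : (quot_pi _ \o coinv_sect V)%VF = \1%VF.
Proof.
apply: coinv_ext => v; rewrite comp_lfunE id_lfunE {1}/coinv_pure coinv_sectE coinv_avg_pure.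
rewrite linearZ linear_sum /=.
under eq_bigr => s _ do rewrite linearZ /= -/(coinv_pure chi _) -coinv_pure_perm.
rewrite sumr_const -scaler_nat scalerA mulVf ?scale1r //.
by apply: natr_neq0 => //; apply/card_gt0P; exists 1%g.
Qed.

Lemma coinv_sect_natural V W (f : 'Hom(V, W)) :
  (coinv_sect W \o coinv_map chi f = tpower_map k f \o coinv_sect V)%VF.
Proof.
apply: coinv_ext => v; rewrite [LHS]comp_lfunE [RHS]comp_lfunE coinv_mapE /coinv_pure !coinv_sectE.
rewrite !coinv_avg_pure linearZ /=; congr (_ *: _); rewrite linear_sum; apply: eq_bigr => s _.
by rewrite linearZ /= tpower_mapE.
Qed.

Lemma coinv_proj_natural V W (f : 'Hom(V, W)) :
  (coinv_map chi f \o quot_pi _ = quot_pi (coinv_rel chi W) \o tpower_map k f)%VF.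
Proof.
apply: tpower_ext => v; rewrite [LHS]comp_lfunE [RHS]comp_lfunE tpower_mapE -/(coinv_pure chi v).
by rewrite coinv_mapE.
Qed.

End CoinvariantSection.

Section SymmetricSection.

Variable K : fieldType.
Hypothesis char0 : [pchar K] =i pred0.
Implicit Types V W : vectType K.

Definition sym_proj (k : int) V : 'Hom(tpower `|k|%N V, sym k V) :=
  match k with
  | Posz k' => quot_pi (coinv_rel (fun _ : 'S_k' => 1) V)
  | Negz _ => 0
  end.

Definition sym_sect (k : int) V : 'Hom(sym k V, tpower `|k|%N V) :=
  match k with
  | Posz k' => coinv_sect (fun _ : 'S_k' => 1) V
  | Negz _ => 0
  end.

Lemma sym_sectK (k : int) V : 0 <= k -> (sym_proj k V \o sym_sect k V)%VF = \1%VF.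
Proof. by case: k => //= k _; apply: coinv_sectK => // s t; rewrite mulr1. Qed.

Lemma sym_sect_natural (k : int) V W (f : 'Hom(V, W)) :
  (sym_sect k W \o sym_map k f = tpower_map `|k|%N f \o sym_sect k V)%VF.
Proof.
case: k => k /=; first by apply: coinv_sect_natural => s t; rewrite mulr1.
by rewrite comp_lfun0l comp_lfun0r.
Qed.

Lemma sym_proj_natural (k : int) V W (f : 'Hom(V, W)) :
  (sym_map k f \o sym_proj k V = sym_proj k W \o tpower_map `|k|%N f)%VF.
Proof.
case: k => k /=; first exact: coinv_proj_natural.
by rewrite comp_lfun0l comp_lfun0r.
Qed.

End SymmetricSection.

Section KoszulTerm.

Variables (K : fieldType) (n : nat).
Hypothesis char0 : [pchar K] =i pred0.
Implicit Types (V W : 'I_n -> vectType K).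

Section Functor.

Variables (d : 'I_n -> nat) (p : nat) (a : 'I_n -> int).

Definition kterm_obj V : vectType K :=
  tensor (ext p (sections (fun i => (d i)%:Z) V)) (sections a V).

Definition kterm_map V W (f : forall i, 'Hom(V i, W i)) : 'Hom(kterm_obj V, kterm_obj W) :=
  tensor_map (ext_map p (sections_map _ f)) (sections_map a f).

Lemma kterm_map_id V : kterm_map (fun i => \1%VF : 'End(V i)) = \1%VF.
Proof. by rewrite /kterm_map !sections_map_id /ext_map coinv_map_id tensor_map_id. Qed.

Lemma kterm_map_comp V W (X : 'I_n -> vectType K) (f : forall i, 'Hom(V i, W i))
    (g : forall i, 'Hom(W i, X i)) :
  kterm_map (fun i => (g i \o f i)%VF) = (kterm_map g \o kterm_map f)%VF.
Proof.
apply/lfunP => t; rewrite comp_lfunE /kterm_map.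
by apply: koszul_term_map_comp; apply: sections_map_comp.
Qed.

Definition kterm : functor K n := Functor kterm_map_id kterm_map_comp.

End Functor.

Definition pre_sections (a : 'I_n -> int) V : vectType K :=
  bigtensor (fun i => tpower `|a i|%N (V i)).
(** The Koszul term before passing to symmetric and exterior powers. *)
Definition pre_kterm (d : 'I_n -> nat) p a V : vectType K :=
  tensor (tpower p (pre_sections (fun i => (d i)%:Z) V)) (pre_sections a V).

Definition sections_proj a V : 'Hom(pre_sections a V, sections a V) :=
  bigtensor_map (fun i => sym_proj (a i) (V i)).
Definition sections_sect a V : 'Hom(sections a V, pre_sections a V) :=
  bigtensor_map (fun i => sym_sect (a i) (V i)).
Definition pre_sections_map a V W (f : forall i, 'Hom(V i, W i)) :
  'Hom(pre_sections a V, pre_sections a W) := bigtensor_map (fun i => tpower_map _ (f i)).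

Lemma sections_sectK a V : (forall i, 0 <= a i) ->
  (sections_proj a V \o sections_sect a V)%VF = \1%VF.
Proof.
move=> a0; rewrite -(bigtensor_map_comp (fun=> erefl)) bigtensor_map_id // => i.
by rewrite sym_sectK.
Qed.

Lemma sections_sect_natural a V W (f : forall i, 'Hom(V i, W i)) :
  (sections_sect a W \o sections_map a f = pre_sections_map a f \o sections_sect a V)%VF.
Proof.
rewrite -!(bigtensor_map_comp (fun=> erefl)); apply: eq_bigtensor_map => i.
exact: sym_sect_natural.
Qed.

Lemma sections_proj_natural a V W (f : forall i, 'Hom(V i, W i)) :
  (sections_map a f \o sections_proj a V = sections_proj a W \o pre_sections_map a f)%VF.
Proof.
rewrite -!(bigtensor_map_comp (fun=> erefl)); apply: eq_bigtensor_map => i.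
exact: sym_proj_natural.
Qed.

Variables (d : 'I_n -> nat) (p : nat) (a : 'I_n -> int).
Hypothesis a_ge0 : forall i, 0 <= a i.

Definition pre_kterm_map V W (f : forall i, 'Hom(V i, W i)) :
    'Hom(pre_kterm d p a V, pre_kterm d p a W) :=
  tensor_map (tpower_map p (pre_sections_map _ f)) (pre_sections_map a f).

Definition kterm_proj V : 'Hom(pre_kterm d p a V, kterm d p a V) :=
  tensor_map (quot_pi _ \o tpower_map p (sections_proj _ V))%VF (sections_proj a V).

Definition kterm_sect V : 'Hom(kterm d p a V, pre_kterm d p a V) :=
  tensor_map (tpower_map p (sections_sect _ V) \o coinv_sect _ _)%VF (sections_sect a V).

Lemma sign_permM k (s t : 'S_k) :
  (-1) ^+ (s * t)%g = (-1) ^+ s * (-1) ^+ t :> K.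
Proof. by rewrite odd_permM signr_addb. Qed.

Lemma kterm_sectK V : (kterm_proj V \o kterm_sect V)%VF = \1%VF.
Proof.
rewrite -tensor_map_comp sections_sectK // -[RHS]tensor_map_id; congr tensor_map.
set b := fun i => (d i)%:Z.
have e : (tpower_map p (sections_proj b V) \o tpower_map p (sections_sect b V))%VF = \1%VF.
  rewrite -(bigtensor_map_comp (h := fun=> \1%VF)) ?bigtensor_map_id // => i.
  by rewrite sections_sectK.
rewrite -comp_lfunA [X in (_ \o X)%VF]comp_lfunA e comp_lfun1l coinv_sectK //.
exact: sign_permM.
Qed.

Lemma kterm_sect_natural V W (f : forall i, 'Hom(V i, W i)) :
  (kterm_sect W \o fmap (kterm d p a) f = pre_kterm_map f \o kterm_sect V)%VF.
Proof.
rewrite -!tensor_map_comp sections_sect_natural; congr tensor_map.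
rewrite -comp_lfunA coinv_sect_natural; last exact: sign_permM.
rewrite [LHS]comp_lfunA [RHS]comp_lfunA; congr (_ \o _)%VF.
rewrite -[LHS](bigtensor_map_comp (fun=> erefl)) -[RHS](bigtensor_map_comp (fun=> erefl)).
apply: eq_bigtensor_map => i.
by rewrite sections_sect_natural.
Qed.

Lemma kterm_proj_natural V W (f : forall i, 'Hom(V i, W i)) :
  (kterm_proj W \o pre_kterm_map f = fmap (kterm d p a) f \o kterm_proj V)%VF.
Proof.
rewrite -!tensor_map_comp -sections_proj_natural; congr tensor_map.
rewrite comp_lfunA [X in _ = (X \o _)%VF]coinv_proj_natural -!comp_lfunA; congr (_ \o _)%VF.
rewrite -[LHS](bigtensor_map_comp (fun=> erefl)) -[RHS](bigtensor_map_comp (fun=> erefl)).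
apply: eq_bigtensor_map => i.
by rewrite sections_proj_natural.
Qed.

End KoszulTerm.

Section KoszulRetract.

Variables (K : fieldType) (n : nat).
Hypothesis char0 : [pchar K] =i pred0.
Variables (N d : 'I_n -> nat) (p : nat) (a : 'I_n -> int).
Hypothesis a_ge0 : forall i, 0 <= a i.
Variable pos : forall i, ('I_p * 'I_(d i) + 'I_(`|a i|%N))%type -> 'I_(N i).
Hypothesis pos_bij : forall i, bijective (@pos i).
Implicit Types (V W : 'I_n -> vectType K).

Local Notation args V := (forall x : slots N, V (tag x)).

(** The bijection [pos] distributes the N_i boxes: [inl (j, k)] is the k-th letter of the j-th
    factor of the exterior power, and [inr k] is the k-th letter of the coefficient. *)
Definition wedge_slot V (j : 'I_p) (v : args V) : pre_sections (fun i => (d i)%:Z) V :=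
  pure (fun i => ppure (fun k : 'I_(d i) => v (slot (pos (inl (j, k)))) : V i)).
Definition coef_slots V (v : args V) : pre_sections a V :=
  pure (fun i => ppure (fun k : 'I_(`|a i|%N) => v (slot (pos (inr k))) : V i)).
Definition ksplit_fun V (v : args V) : pre_kterm d p a V :=
  tpure (ppure (fun j => wedge_slot j v)) (coef_slots v).

Lemma slot_eq i i' (k : 'I_(N i)) (k' : 'I_(N i')) : slot k = slot k' -> i = i'.
Proof. by move/(congr1 (@tag _ _)). Qed.

(** As [pos] is bijective, each slot feeds exactly one place, either in a single wedge factor or in
    the coefficient, and all other places are independent of it. *)
Lemma multilinear_ksplit V : multilinear (@ksplit_fun V).
Proof.
have pos_inj i : injective (@pos i) by apply: bij_inj.
split=> [u w uw|[i y]].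
  congr tpure; apply: eq_pure => j; last by apply: eq_pure => k; apply: (uw (slot _)).
  by apply: eq_pure => i; apply: eq_pure => k; apply: (uw (slot _)).
have indep_coef j l : slot_indep (slot (pos (inl (j, l)) : 'I_(N i))) (@coef_slots V).
  apply: (slot_indep_comp (gamma := fun i' (v : args V) =>
    ppure (fun k => v (slot (pos (inr k))) : V i'))); first exact: multilinear_pure.
  move=> i'; apply: (slot_indep_comp (gamma := fun k (v : args V) =>
    v (slot (pos (inr k))) : V i')); first exact: multilinear_pure.
  move=> k; have ne : slot (pos (inl (j, l)) : 'I_(N i)) != slot (pos (inr k) : 'I_(N i')).
    apply/eqP => e; have ii := slot_eq e; case: i' / ii k e => k /slot_inj/pos_inj //.
  exact: (slot_indep_proj ne).
have indep_wedge (k : 'I_(`|a i|%N)) j : slot_indep (slot (pos (inr k) : 'I_(N i))) (@wedge_slot V j).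
  apply: (slot_indep_comp (gamma := fun i' (v : args V) =>
    ppure (fun k' => v (slot (pos (inl (j, k')))) : V i'))); first exact: multilinear_pure.
  move=> i'; apply: (slot_indep_comp (gamma := fun k' (v : args V) =>
    v (slot (pos (inl (j, k')))) : V i')); first exact: multilinear_pure.
  move=> l; have ne : slot (pos (inr k) : 'I_(N i)) != slot (pos (inl (j, l)) : 'I_(N i')).
    apply/eqP => e; have ii := slot_eq e; case: i' / ii l e => l /slot_inj/pos_inj //.
  exact: (slot_indep_proj ne).
have indep_wedge' j l j' : j' != j ->
    slot_indep (slot (pos (inl (j, l)) : 'I_(N i))) (@wedge_slot V j').
  move=> jj; apply: (slot_indep_comp (gamma := fun i' (v : args V) =>
    ppure (fun k' => v (slot (pos (inl (j', k')))) : V i'))); first exact: multilinear_pure.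
  move=> i'; apply: (slot_indep_comp (gamma := fun k' (v : args V) =>
    v (slot (pos (inl (j', k')))) : V i')); first exact: multilinear_pure.
  move=> l'; have ne : slot (pos (inl (j, l)) : 'I_(N i)) != slot (pos (inl (j', l')) : 'I_(N i')).
    apply/eqP => e; have ii := slot_eq e; case: i' / ii l' e => l' /slot_inj/pos_inj.
    by case=> e _; rewrite e eqxx in jj.
  exact: (slot_indep_proj ne).
have [f _ fK] := pos_bij i; rewrite -(fK y); case: (f y) => [[j l]|k].
  apply: slot_linear_tpurel; last exact: indep_coef.
  apply: (slot_linear_comp (j0 := j)); first exact: multilinear_pure; last first.
    by move=> j' jj; apply: indep_wedge'.
  apply: (slot_linear_comp (j0 := i) (gamma := fun i' (v : args V) =>
    ppure (fun k' => v (slot (pos (inl (j, k')))) : V i'))); first exact: multilinear_pure.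
    apply: (slot_linear_comp (j0 := l) (gamma := fun k' (v : args V) =>
      v (slot (pos (inl (j, k')))) : V i)); first exact: multilinear_pure.
      exact: (slot_linear_proj (erefl (slot (pos (inl (j, l)) : 'I_(N i))))).
    move=> l' ll; have ne : slot (pos (inl (j, l)) : 'I_(N i)) != slot (pos (inl (j, l')) : 'I_(N i)).
      by apply: contraNneq ll => /slot_inj/pos_inj [->].
    exact: (slot_indep_proj ne).
  move=> i' ii; apply: (slot_indep_comp (gamma := fun k' (v : args V) =>
    v (slot (pos (inl (j, k')))) : V i')); first exact: multilinear_pure.
  move=> l'; have ne : slot (pos (inl (j, l)) : 'I_(N i)) != slot (pos (inl (j, l')) : 'I_(N i')).
    by apply: contraNneq ii => /slot_eq ->.
  exact: (slot_indep_proj ne).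
apply: slot_linear_tpurer; last first.
  apply: (slot_indep_comp (gamma := @wedge_slot V)); first exact: multilinear_pure.
  by move=> j; apply: indep_wedge.
apply: (slot_linear_comp (j0 := i) (gamma := fun i' (v : args V) =>
    ppure (fun k' => v (slot (pos (inr k'))) : V i'))); first exact: multilinear_pure.
  apply: (slot_linear_comp (j0 := k) (gamma := fun k' (v : args V) =>
    v (slot (pos (inr k'))) : V i)); first exact: multilinear_pure.
    exact: (slot_linear_proj (erefl (slot (pos (inr k) : 'I_(N i))))).
  move=> l' ll; have ne : slot (pos (inr k) : 'I_(N i)) != slot (pos (inr l') : 'I_(N i)).
    by apply: contraNneq ll => /slot_inj/pos_inj [->].
  exact: (slot_indep_proj ne).
move=> i' ii; apply: (slot_indep_comp (gamma := fun k' (v : args V) =>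
  v (slot (pos (inr k'))) : V i')); first exact: multilinear_pure.
move=> l'; have ne : slot (pos (inr k) : 'I_(N i)) != slot (pos (inr l') : 'I_(N i')).
  by apply: contraNneq ii => /slot_eq ->.
exact: (slot_indep_proj ne).
Qed.

Definition ksplit V : 'Hom(tens K N V, pre_kterm d p a V) :=
  bigtensor_lift (@ksplit_fun V).

Lemma ksplitE V (v : args V) : ksplit V (pure v) = ksplit_fun v.
Proof. exact: (bigtensor_liftE _ (multilinear_ksplit V)). Qed.

Lemma ksplit_full V : limg (ksplit V) = fullv.
Proof.
pose u b i (s : {dffun 'I_(`|b i|%N) -> 'I_(\dim {:V i})}) : tpower `|b i|%N (V i) :=
  ppure (fun k => bvec (s k)).
have su b : spans (fun t : {dffun forall i, {dffun 'I_(`|b i|%N) -> 'I_(\dim {:V i})}} =>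
    pure (fun i => u b i (t i))).
  by apply: spans_pure => i; apply: spans_bvec.
apply: (spans_full (spans_tpure (spans_pure (fun j : 'I_p => su (fun i => (d i)%:Z))) (su a))).
move=> [s t]; apply/memv_imgP => /=.
have [f fK _] : exists2 f : forall i, 'I_(N i) -> ('I_p * 'I_(d i) + 'I_(`|a i|%N))%type,
    (forall i, cancel (@pos i) (@f i)) & True.
  have /fin_all_exists[f fP] : forall i, exists f : 'I_(N i) -> ('I_p * 'I_(d i) + 'I_(`|a i|%N))%type,
    cancel (@pos i) f by move=> i; have [f] := pos_bij i; exists f.
  by exists f.
exists (pure (fun x : slots N => match f (tag x) (tagged x) with
   | inl jk => bvec (s jk.1 (tag x) jk.2) | inr k => bvec (t (tag x) k) end)).
  exact: memvf.
rewrite ksplitE; congr tpure.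
  by apply: eq_pure => j; apply: eq_pure => i; apply: eq_pure => k; rewrite /= fK.
by apply: eq_pure => i; apply: eq_pure => k; rewrite /= fK.
Qed.

Lemma card_slots i : N i = (p * d i + `|a i|)%N.
Proof.
rewrite -[N i]card_ord -(bij_eq_card (pos_bij i)) card_sum card_prod !card_ord //.
Qed.

(** Surjectivity together with a dimension count based on N_i = p d_i + |a_i|. *)
Lemma ksplit_bij V : cancel (ksplit V) (ksplit V)^-1%VF /\ cancel (ksplit V)^-1%VF (ksplit V).
Proof.
apply: lker0_invK; last exact: ksplit_full.
apply: surj_lker0; last exact: ksplit_full.
have dimE b : \dim {: pre_sections b V} = (\prod_i \dim {:V i} ^ `|b i|)%N.
  rewrite dim_bigtensor; apply: eq_bigr => i _.
  by rewrite dim_bigtensor prod_nat_const card_ord.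
rewrite [LHS]dim_bigtensor [RHS]dim_tensor (dimE a) [X in (X * _)%N]dim_bigtensor.
rewrite prod_nat_const card_ord dimE.
rewrite (big_morph (expn^~ p) (fun x y => expnMn x y p) (exp1n p)) -big_split /=.
transitivity (\prod_i \prod_(k : 'I_(N i)) \dim {:V i})%N.
  by rewrite (sig_big_dep _ (fun i => predT) (fun i (_ : 'I_(N i)) => \dim {:V i})).
apply: eq_bigr => i _; rewrite prod_nat_const card_ord card_slots.
by rewrite expnD; congr (_ * _)%N; rewrite -expnM mulnC.
Qed.

End KoszulRetract.

(** * Multiplicities as dimensions of highest weight spaces *)

Section RhoCoefficients.

Variables (K : fieldType) (n : nat) (N : 'I_n -> nat) (V : 'I_n -> vectType K).
Hypothesis char0 : [pchar K] =i pred0.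
Local Notation A := (galg K (slot_group N)).
Variable f : forall i, 'I_(N i) -> 'I_(\dim {:V i}).

Definition basis_tensor : tens K N V := pure (fun x : slots N => bvec (f (tagged x)) : V (tag x)).

Lemma pure_bvec (I : finType) (E : I -> vectType K) (t s : {dffun forall i, 'I_(\dim {:E i})}) :
  pure (fun i => bvec (t i)) s = (t == s)%:R.
Proof.
rewrite ffunE; case: eqP => [->|ts].
  by rewrite big1 // => i _; rewrite bcoord_bvec eqxx.
have : ~~ [forall i, t i == s i].
  by apply/negP => /forallP e; apply: ts; apply/ffunP => i; apply/eqP.
case/forallPn => i ti.
by rewrite (bigD1 i) //= bcoord_bvec eq_sym (negPf ti) mul0r.
Qed.

Definition basis_index (g : slot_group N) : {dffun forall x : slots N, 'I_(\dim {:V (tag x)})} :=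
  finfun (fun x : slots N => f (g^-1%g (tag x) (tagged x))).

Lemma basis_indexP (g h : slot_group N) :
  reflect (forall i k, f (g^-1%g i k) = f (h^-1%g i k)) (basis_index g == basis_index h).
Proof.
apply: (iffP eqP) => [e i k|e].
  have := congr1 (fun s : {dffun forall x : slots N, 'I_(\dim {:V (tag x)})} => s (slot k)) e.
  by rewrite !ffunE.
by apply/ffunP => -[i k]; rewrite [LHS]ffunE [RHS]ffunE; apply: e.
Qed.

Lemma rho_basis_tensor (x : A) (h : slot_group N) :
  rho V x basis_tensor (basis_index h) =
  \sum_(g | basis_index g == basis_index h) gcoef x g.
Proof.
rewrite rhoE sum_ffunE [RHS]big_mkcond /=; apply: eq_bigr => g _.
rewrite ffunE slot_actE.
have -> : pure (fun x : slots N => (bvec (f (tagged (slot_perm g^-1%g x)))) : V (tag x)) =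
          pure (fun x => bvec (basis_index g x)) :> tens K N V.
  by apply: eq_pure => y; rewrite ffunE.
rewrite pure_bvec; case: ifP => _; first exact: mulr1.
exact: mulr0.
Qed.

Lemma rho_basis_inj (x : A) : (forall i, injective (@f i)) -> rho V x basis_tensor = 0 -> x = 0.
Proof.
move=> f_inj e; apply: galgP => h; have := rho_basis_tensor x h.
rewrite e ffunE (bigD1 h) //= big1 ?addr0 => [<-|g /andP[/basis_indexP gh /eqP[]]].
  by rewrite /gcoef ffunE.
by apply: invg_inj; apply/ffunP => i; apply/permP => k; apply: f_inj.
Qed.

Variable nu : 'I_n -> seq nat.
Hypothesis f_row : forall i k k', (f k == f k' :> 'I_(\dim {:V i})) = (box_row (nu i) k == box_row (nu i) k').

(** The permutations giving the same basis tensor as h form a coset of the row group, on which the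
    coefficients of x are constant. The coefficient of the image is thus a positive integer times
    that of x. *)
Lemma rho_row_inj (x : A) : (forall h : slot_group N, (forall i, h i \in rowg (N i) (nu i)) -> gelt h * x = x) ->
  rho V x basis_tensor = 0 -> x = 0.
Proof.
move=> xR e; apply: galgP => h; have := rho_basis_tensor x h; rewrite e ffunE.
rewrite (eq_bigr (fun=> gcoef x h)) => [|g /basis_indexP gh].
  rewrite sumr_const -mulr_natr => /esym/eqP; rewrite mulf_eq0 => /orP[/eqP->|].
    by rewrite /gcoef ffunE.
  rewrite (negPf (natr_neq0 char0 _)) //; apply/card_gt0P; exists h.
  exact: eqxx.
rewrite -{1}(xR (g * h^-1)%g).
  rewrite gcoefM (bigD1 (g * h^-1)%g) //= gcoef_elt eqxx mul1r big1 ?addr0.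
    by rewrite invMg invgK mulgKV.
  by move=> k /negPf kn; rewrite gcoef_elt kn mul0r.
move=> i; apply/rowgP => k; apply/eqP; rewrite -f_row mulg_ffun permM -gh.
by rewrite invg_ffun permK.
Qed.

End RhoCoefficients.

Section RhoFaithful.

Variables (K : fieldType) (n : nat) (N : 'I_n -> nat).
Local Notation A := (galg K (slot_group N)).

Lemma rho_inj (x y : A) : (forall V, rho V x = rho V y) -> x = y.
Proof.
move=> e; apply/eqP; rewrite -subr_eq0; apply/eqP.
pose E (i : 'I_n) : vectType K := 'rV[K]_(N i).
have eN i : N i = \dim {:E i} by rewrite dimvf dim_matrix; apply/esym/mul1n.
apply: (rho_basis_inj (V := E) (f := fun i => cast_ord (eN i))).
  by move=> i; apply: cast_ord_inj.
have -> : x - y = x + (-1) *: y by rewrite scaleN1r.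
by rewrite rhoD rhoZ scaleN1r e subrr zero_lfunE.
Qed.

(** The natural endomorphism [i \o r] is the action of some eps; it is idempotent, and so is eps
    because the action on all V is faithful. *)
Lemma retract_exists (F : functor K n) (i : forall V, 'Hom(F V, tens K N V))
    (r : forall V, 'Hom(tens K N V, F V)) : natural i -> natural r ->
  (forall V t, r V (i V t) = t) -> exists eps : A, retract_of eps i r /\ eps * eps = eps.
Proof.
move=> ni nr ri; have [eps epsE] := natural_endo (natural_comp nr ni).
have Fr : retract_of eps i r.
  by split=> // V; apply/lfunP => t; rewrite comp_lfunE ri id_lfunE.
exists eps; split=> //; apply: rho_inj => V; apply/lfunP => t.
rewrite -rhoM_app -!(retract_ir _ Fr).
by rewrite (retract_ri _ Fr).
Qed.

End RhoFaithful.

(** * Homology of natural complexes as a natural summand *)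

Section Retracts.

Variables (K : fieldType) (n : nat) (N : 'I_n -> nat).
Hypothesis char0 : [pchar K] =i pred0.
Local Notation A := (galg K (slot_group N)).

Definition is_retract (F : functor K n) := exists (i : forall V, 'Hom(F V, tens K N V)) r,
  [/\ natural i, natural r & forall V t, r V (i V t) = t].

(** Extended to the tensor functor, [phi] becomes the action of an element [D]; a pseudo-inverse of
    [D] gives [psi]. *)
Lemma natural_regular (F G : functor K n) (phi : forall V, 'Hom(F V, G V)) :
  is_retract F -> is_retract G -> natural phi ->
  exists2 psi : forall V, 'Hom(G V, F V), natural psi &
    forall V t, phi V (psi V (phi V t)) = phi V t.
Proof.
move=> [iF [rF [niF nrF riF]]] [iG [rG [niG nrG riG]]] nphi.
have [D DE] := natural_endo (natural_comp (natural_comp nrF nphi) niG).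
have DE' V t : rho V D t = iG V (phi V (rF V t)) by rewrite -DE !comp_lfunE.
exists (fun V => rF V \o (rho V (galg_pinv char0 D) \o iG V))%VF.
  apply: (natural_comp _ nrF); apply: (natural_comp niG); exact: natural_rho.
move=> V t; rewrite !comp_lfunE; apply: (can_inj (riG V)).
have phiE : iG V (phi V t) = rho V D (iF V t) by rewrite DE' riF.
by rewrite -DE' phiE !rhoM_app mulrA galg_pinvK.
Qed.

Definition homology_of (X Y W H : functor K n) (delta : forall V, 'Hom(X V, Y V))
    (dd : forall V, 'Hom(W V, X V)) (cl : forall V, 'Hom(X V, H V)) :=
  [/\ forall V h, exists2 z, delta V z = 0 & h = cl V z,
      forall V z, delta V z = 0 -> (cl V z == 0) = (z \in limg (dd V))
    & forall (V V' : 'I_n -> vectType K) (f : forall i, 'Hom(V i, V' i)) z, delta V z = 0 ->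
        fmap H f (cl V z) = cl V' (fmap X f z)].

(** Pseudo-inverses provide a natural projection [pi] onto the cycles and a natural map [kap] that
    splits off the boundaries. *)
Lemma homology_retract (X Y W H : functor K n) (delta : forall V, 'Hom(X V, Y V))
    (dd : forall V, 'Hom(W V, X V)) (cl : forall V, 'Hom(X V, H V)) :
  is_retract X -> is_retract Y -> is_retract W -> natural delta -> natural dd ->
  homology_of delta dd cl ->
  exists (pi : forall V, 'End(X V)) (i : forall V, 'Hom(H V, X V)),
    [/\ natural pi, forall V z, delta V (pi V z) = 0,
        forall V z, delta V z = 0 -> pi V z = z
      & [/\ natural i, natural (fun V => cl V \o pi V)%VF
          & forall V h, cl V (pi V (i V h)) = h]].
Proof.
move=> rX rY rW ndelta ndd [cl_surj cl_eq0 clE].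
have [del ndel delE] := natural_regular rX rY ndelta.
have [eta neta etaE] := natural_regular rW rY (natural_comp ndd ndelta).
have etaE' V t : delta V (dd V (eta V (delta V (dd V t)))) = delta V (dd V t).
  by have := etaE V t; rewrite !comp_lfunE.
(* [dt] is [dd] after a projection onto the kernel of [delta \o dd]. Its image is the set of
   boundaries that are cycles, which is the denominator in [homology_of]. *)
pose dt V : 'Hom(W V, X V) := (dd V \o (\1 - (eta V \o (delta V \o dd V))))%VF.
have dtE V t : dt V t = dd V (t - eta V (delta V (dd V t))).
  by rewrite /dt !comp_lfunE add_lfunE opp_lfunE id_lfunE !comp_lfunE.
have ndt : natural dt.
  apply: (natural_comp _ ndd); apply: natural_sub; first exact: natural_id.
  exact: (natural_comp (natural_comp ndd ndelta) neta).
have [tau ntau tauE] := natural_regular rW rX ndt.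
pose pi V : 'End(X V) := (\1 - (del V \o delta V))%VF.
have piE V z : pi V z = z - del V (delta V z).
  by rewrite /pi add_lfunE opp_lfunE id_lfunE comp_lfunE.
pose kap V : 'End(X V) := (\1 - (dt V \o tau V))%VF.
have kapE V z : kap V z = z - dt V (tau V z).
  by rewrite /kap add_lfunE opp_lfunE id_lfunE comp_lfunE.
have npi : natural pi.
  apply: natural_sub; first exact: natural_id.
  exact: (natural_comp ndelta ndel).
have nkap : natural kap.
  apply: natural_sub; first exact: natural_id.
  exact: (natural_comp ntau ndt).
have delta_pi V z : delta V (pi V z) = 0 by rewrite piE linearB /= delE subrr.
have pi_id V z : delta V z = 0 -> pi V z = z.
  by move=> z0; rewrite piE z0 linear0 subr0.
have delta_dt V t : delta V (dt V t) = 0 by rewrite dtE !linearB /= etaE' subrr.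
have dt_dd V t : delta V (dd V t) = 0 -> dt V t = dd V t.
  by move=> e; rewrite dtE e linear0 subr0.
have delta_kap V z : delta V z = 0 -> delta V (kap V z) = 0.
  by move=> z0; rewrite kapE linearB /= z0 delta_dt subrr.
have cl_kap V z : delta V z = 0 -> cl V (kap V z) = cl V z.
  move=> z0; apply/eqP; rewrite -subr_eq0 -linearB /= cl_eq0.
    rewrite kapE addrAC subrr add0r memvN dtE memv_img ?memvf //.
  by rewrite linearB /= delta_kap // z0 subrr.
have kap_cl V z z' : delta V z = 0 -> delta V z' = 0 -> cl V z = cl V z' -> kap V z = kap V z'.
  move=> z0 z'0 e; apply/eqP; rewrite -subr_eq0 -linearB; apply/eqP => /=.
  have zz0 : delta V (z - z') = 0 by rewrite linearB /= z0 z'0 subrr.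
  have : z - z' \in limg (dd V) by rewrite -cl_eq0 // linearB /= e subrr.
  case/memv_imgP => t _ zt; have -> : z - z' = dt V t by rewrite dt_dd -zt.
  by rewrite kapE tauE subrr.
pose g V : 'Hom(X V, H V) := (cl V \o pi V)%VF.
have gE V z : g V z = cl V (pi V z) by rewrite /g comp_lfunE.
have g_full V : limg (g V) = fullv.
  apply/eqP; rewrite eqEsubv subvf /=; apply/subvP => h _; apply/memv_imgP.
  by have [z z0 ->] := cl_surj V h; exists z; rewrite ?memvf // gE pi_id.
pose sec V : 'Hom(H V, X V) := (pi V \o (g V)^-1)%VF.
have secE V h : cl V (sec V h) = h.
  by rewrite /sec comp_lfunE -gE limg_lfunVK // g_full memvf.
have delta_sec V h : delta V (sec V h) = 0 by rewrite /sec comp_lfunE delta_pi.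
(* The section [sec] is an arbitrary pseudo-inverse chosen for each V separately. Naturality is
   restored by [kap], whose value on a cycle depends only on the class. *)
exists pi, (fun V => kap V \o sec V)%VF; split=> //; split.
- move=> V V' f; apply/lfunP => h.
  rewrite [LHS]comp_lfunE [RHS]comp_lfunE comp_lfunE [X in _ = _ X]comp_lfunE.
  rewrite -(natural_app _ _ nkap); apply: kap_cl => //.
    by rewrite (natural_app _ _ ndelta) delta_sec linear0.
  by rewrite secE -clE // secE.
- move=> V V' f; apply/lfunP => z.
  rewrite [LHS]comp_lfunE [RHS]comp_lfunE [LHS]comp_lfunE [X in _ = _ X]comp_lfunE.
  by rewrite (natural_app _ _ npi) clE.
move=> V h; rewrite comp_lfunE pi_id ?delta_kap //.
by rewrite cl_kap // secE.
Qed.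

End Retracts.

Section HighestWeight.

Variables (K : fieldType) (n : nat) (N : 'I_n -> nat).
Hypothesis char0 : [pchar K] =i pred0.
Local Notation A := (galg K (slot_group N)).

Lemma limg_dim_inj (B C : vectType K) (g : 'Hom(B, C)) (U : {vspace B}) :
  injective g -> \dim (g @: U) = \dim U.
Proof. by move/lker0P/eqP => g0; rewrite limg_dim_eq // g0 capv0. Qed.

Section Vectors.

Variables (nu : 'I_n -> seq nat) (V : 'I_n -> vectType K).
Variable f : forall i, 'I_(N i) -> 'I_(\dim {:V i}).
Implicit Types (F G : functor K n) (x z : A).

Definition row_tensor_ev : 'Hom(A, tens K N V) := linfun (fun z : A => rho V z (basis_tensor f)).

Lemma row_tensor_evE z : row_tensor_ev z = rho V z (basis_tensor f).
Proof.
rewrite /row_tensor_ev linfunE // => a x y.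
by rewrite rhoD rhoZ add_lfunE scale_lfunE.
Qed.

(* The span of the vectors [rho z e], with e the pure tensor of row-indexed   *)
(* basis vectors and z in the right ideal of the Young symmetrizer: up to     *)
(* [rho], the highest weight vectors of weight nu.                            *)
Definition hw_tens : {vspace tens K N V} := (row_tensor_ev @: limg (glmul (myoung K N nu)))%VS.

Lemma mem_hw_tens t :
  reflect (exists x, t = rho V (myoung K N nu * x) (basis_tensor f)) (t \in hw_tens).
Proof.
apply: (iffP memv_imgP) => [[_ /memv_imgP[x _ ->] ->]|[x ->]].
  by exists x; rewrite row_tensor_evE glmulE.
by exists (myoung K N nu * x); rewrite ?row_tensor_evE // -glmulE memv_img ?memvf.
Qed.

Lemma hw_tens_rho x t : t \in hw_tens -> rho V x t \in hw_tens.
Proof.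
by move/mem_hw_tens => [y ->]; apply/mem_hw_tens; exists (y * x); rewrite rhoM_app mulrA.
Qed.

Definition hw F (r : forall V, 'Hom(tens K N V, F V)) : {vspace F V} := (r V @: hw_tens)%VS.

(** On the tensor functor a natural map is the action of an element of A, and [hw_tens] is stable
    under A. *)
Lemma hw_natural F G (rF : forall V, 'Hom(tens K N V, F V)) (iG : forall V, 'Hom(G V, tens K N V))
    (rG : forall V, 'Hom(tens K N V, G V)) (phi : forall V, 'Hom(F V, G V)) t :
  natural rF -> natural iG -> (forall V t, rG V (iG V t) = t) -> natural phi ->
  t \in hw rF -> phi V t \in hw rG.
Proof.
move=> nrF niG riG nphi /memv_imgP[u uU ->].
have [D DE] := natural_endo (natural_comp (natural_comp nrF nphi) niG).
rewrite -[phi V _]riG memv_img // (_ : iG V _ = rho V D u); last by rewrite -DE !comp_lfunE.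
exact: hw_tens_rho.
Qed.

Hypothesis f_row : forall i k k',
  (f k == f k' :> 'I_(\dim {:V i})) = (box_row (nu i) k == box_row (nu i) k').

Lemma row_tensor_ev_inj x : row_tensor_ev (myoung K N nu * x) = 0 -> myoung K N nu * x = 0.
Proof.
rewrite row_tensor_evE; apply: (rho_row_inj char0 f_row) => h hR.
rewrite mulrA; congr (_ * _); rewrite gelt_gtens gtensM; apply: eq_gtens => i.
by rewrite /young mulrA (rsum_l K (hR i)).
Qed.

(** Evaluation on the row tensor is injective on c_nu A, and it turns right multiplication by eps
    into [i \o r]. *)
Lemma dim_sandwich_hw F eps (i : forall V, 'Hom(F V, tens K N V)) r :
  retract_of eps i r -> \dim (sandwich (myoung K N nu) eps) = \dim (hw r).
Proof.
move=> Fr; have i_inj : injective (i V) by apply: (can_inj (fun t => retract_ri t Fr)).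
transitivity (\dim (row_tensor_ev @: sandwich (myoung K N nu) eps)).
  rewrite (limg_dim_eq (f := row_tensor_ev)) //; apply/eqP; rewrite -[_ == _]subv0.
  apply/subvP => z; rewrite memv_cap memv_ker memv0 => /andP[/sandwichP[w ->] /eqP].
  by rewrite -mulrA => /row_tensor_ev_inj ->.
rewrite -(limg_dim_inj _ i_inj); congr (\dim _); apply/vspaceP => t.
apply/memv_imgP/memv_imgP => [[_ /sandwichP[w ->] ->]|[_ /memv_imgP[_ /mem_hw_tens[w ->] ->] ->]].
  exists (r V (rho V (myoung K N nu * w) (basis_tensor f))).
    by rewrite memv_img //; apply/mem_hw_tens; exists w.
  by rewrite (retract_ir _ Fr) rhoM_app row_tensor_evE.
exists (myoung K N nu * w * eps); first by apply/sandwichP; exists w.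
by rewrite (retract_ir _ Fr) rhoM_app row_tensor_evE.
Qed.

End Vectors.

Section Homology.

Variables (X Y W H : functor K n).
Variables (delta : forall V, 'Hom(X V, Y V)) (dd : forall V, 'Hom(W V, X V))
  (cl : forall V, 'Hom(X V, H V)).
Variables (iX : forall V, 'Hom(X V, tens K N V)) (rX : forall V, 'Hom(tens K N V, X V))
  (iW : forall V, 'Hom(W V, tens K N V)) (rW : forall V, 'Hom(tens K N V, W V)).
Hypotheses (niX : natural iX) (nrX : natural rX) (riX : forall V t, rX V (iX V t) = t).
Hypotheses (niW : natural iW) (nrW : natural rW) (riW : forall V t, rW V (iW V t) = t).
Hypotheses (retY : is_retract N Y) (ndelta : natural delta) (ndd : natural dd).
Hypothesis homH : homology_of delta dd cl.

(** Taking highest weight vectors is exact here: the natural projection onto cycles and a natural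
    pseudo-inverse of [dd] preserve them. So a highest weight cycle that is a boundary is the
    boundary of a highest weight vector. *)
Lemma homology_multiplicity :
  exists (i : forall V, 'Hom(H V, tens K N V)) (r : forall V, 'Hom(tens K N V, H V)) (eps : A),
  [/\ retract_of eps i r, eps * eps = eps &
   forall (nu : 'I_n -> seq nat) (V : 'I_n -> vectType K) (f : forall i, 'I_(N i) -> 'I_(\dim {:V i})),
     (forall i k k', (f i k == f i k' :> 'I_(\dim {:V i})) = (box_row (nu i) k == box_row (nu i) k')) ->
     let Z := (hw nu f rX :&: lker (delta V))%VS in
     \dim (sandwich (myoung K N nu) eps) = (\dim Z - \dim (Z :&: (dd V @: hw nu f rW)))%N].
Proof.
have retX : is_retract N X by exists iX, rX.
have retW : is_retract N W by exists iW, rW.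
have [pi [iH [npi dpi pi_id [niH npicl clpi]]]] :=
  homology_retract char0 retX retY retW ndelta ndd homH.
have [dd' ndd' dd'E] := natural_regular char0 retW retX ndd.
have [_ cl_eq0 _] := homH.
have riH V t : ((cl V \o pi V) \o rX V)%VF ((iX V \o iH V)%VF t) = t.
  by rewrite !comp_lfunE riX clpi.
have [eps [epsR eps_idem]] :=
  retract_exists (natural_comp niH niX) (natural_comp nrX npicl) riH.
exists (fun V => iX V \o iH V)%VF, (fun V => (cl V \o pi V) \o rX V)%VF, eps.
split=> // nu V f f_row Z; rewrite (dim_sandwich_hw f_row epsR).
have -> : hw nu f (fun V => (cl V \o pi V) \o rX V)%VF = (cl V @: Z)%VS.
  apply/vspaceP => t; apply/memv_imgP/memv_imgP => [[u uU ->]|[z + ->]].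
    exists (pi V (rX V u)); last by rewrite !comp_lfunE.
    rewrite memv_cap memv_ker dpi eqxx andbT.
    by apply: (hw_natural (phi := pi) nrX niX riX npi); apply: memv_img.
  rewrite memv_cap memv_ker => /andP[/memv_imgP[u uU ->] /eqP du].
  by exists u => //; rewrite !comp_lfunE pi_id.
rewrite -(limg_ker_dim (cl V) Z) [X in (_ - X)%N](_ : _ = \dim (Z :&: lker (cl V))).
  by rewrite addKn.
congr (\dim _); apply/vspaceP => z; rewrite [LHS]memv_cap [RHS]memv_cap.
case: (boolP (z \in Z)) => //=; rewrite memv_cap memv_ker => /andP[zh /eqP dz].
rewrite memv_ker cl_eq0 //; apply/idP/idP => [|/memv_imgP[t _ zt]].
  by move/(subvP (limgS _ (subvf _))).
rewrite zt -dd'E -zt memv_img //; by apply: (hw_natural (phi := dd') nrX niW riW ndd').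
Qed.

End Homology.

End HighestWeight.

(** * Polytabloids and their behaviour when the first row grows *)

(** Induction on the size of S1 - S2, exchanging one element of it with one of S2 - S1. *)
Lemma ex_perm_on (T : finType) (D S1 S2 : {set T}) : S1 \subset D -> S2 \subset D ->
  #|S1| = #|S2| -> exists2 s : {perm T}, perm_on D s & s @: S1 = S2.
Proof.
have [k] := ubnP #|S1 :\: S2|; elim: k => // k IHk in S1 *; rewrite ltnS => le_k sD1 sD2 e.
have [e0|[x]] := set_0Vmem (S1 :\: S2).
  exists 1%g; first by apply: perm_on1.
  rewrite (_ : _ @: _ = S1); last by rewrite -[RHS]imset_id; apply: eq_imset => x; rewrite perm1.
  by apply/eqP; rewrite eqEcard e leqnn andbT -setD_eq0 e0.
rewrite inE => /andP[xS2 xS1].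
have [y] : exists y, y \in S2 :\: S1.
  apply/set0Pn; rewrite -cards_eq0 cardsD -e setIC -cardsD cards_eq0.
  by apply/set0Pn; exists x; rewrite inE xS2.
rewrite inE => /andP[yS1 yS2].
have xD := subsetP sD1 x xS1; have yD := subsetP sD2 y yS2.
pose S1' := tperm x y @: S1.
have S1'D : S1' \subset D.
  apply/subsetP => _ /imsetP[z zS1 ->]; case: tpermP => // _ _; exact: (subsetP sD1).
have lt_k : (#|S1' :\: S2| < k)%N.
  apply: leq_trans le_k; apply/proper_card/properP; split.
    apply/subsetP => z; rewrite !inE => /andP[zS2 /imsetP[w wS1 zw]]; rewrite zS2 /=.
    move: zw; case: tpermP => [_ zy|wy _|_ _ ->] //.
      by rewrite zy yS2 in zS2.
    by rewrite -wy wS1 in yS1.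
  exists x; first by rewrite inE xS2.
  rewrite inE xS2 /=.
  apply/imsetP => -[w wS1 /(canLR (tpermK x y))]; rewrite tpermL => yw.
  by rewrite yw wS1 in yS1.
have [|s sD sS] := IHk S1' lt_k S1'D sD2; first by rewrite card_imset //; apply: perm_inj.
exists (tperm x y * s)%g.
  apply: perm_onM => //; apply/subsetP => z; rewrite inE; case: tpermP => [->|->|] //.
  by rewrite eqxx.
rewrite -sS -imset_comp; apply: eq_imset => z; by rewrite /= permM.
Qed.

Section Normalize.

Variables (s N m : nat) (A : {set 'I_(s + N)}) (nu nu' : seq nat).
Variables (rw cl : 'I_(s + N) -> nat).
Hypotheses (snu : sorted geq nu) (snu' : sorted geq nu') (sum_nu : sumn nu = N).
Hypothesis nu0 : nth 0%N nu' 0 = (s + nth 0%N nu 0)%N.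
Hypothesis nuS : forall k, nth 0%N nu' k.+1 = nth 0%N nu k.+1.
Hypothesis tab : tableau nu' rw cl.
Hypothesis inA : forall j, lshift N j \in A.
Hypothesis cardA : #|A| = (s + m)%N.
Hypothesis cl_inj : {in A &, injective cl}.
Hypothesis le_m : (0 < s)%N -> (nth 0%N nu 1 <= m)%N.

(* Column moves bring the boxes of A, which lie in distinct columns, to the   *)
(* first row. At most [nth 0 nu 1] <= m of these columns have height at least *)
(* two, so s columns of height one holding boxes of A can be split off.       *)
Lemma tableau_normalize : exists (c h : 'S_(s + N)) (cl2 : 'I_(s + N) -> nat),
  [/\ forall k, cl (c k) = cl k, perm_on A h,
      forall k k', (cl2 k == cl2 k') = (cl (h k) == cl (h k')),
      forall j, rw (c (h (lshift N j))) = 0%N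
    & tableau nu (fun k => rw (c (h (rshift s k)))) (fun k => cl2 (rshift s k))].
Proof.
have [sum' bd inj] := tab.
have [s0|s_gt0] := posnP s.
  exists 1%g, 1%g, cl; split.
  - by move=> k; rewrite perm1.
  - exact: perm_on1.
  - by move=> k k'; rewrite !perm1.
  - by move=> j; have := ltn_ord j; rewrite [X in (_ < X)%N]s0.
  split=> // [k|k k']; rewrite !perm1.
    have := bd (rshift s k); case: (rw _) => [|r]; last by rewrite nuS.
    by rewrite nu0 [X in (_ < X + _)%N]s0.
  by move=> r c; apply: (@rshift_inj s N); apply: inj.
have ex_top x : exists y, (rw y == 0%N) && (cl y == cl x).
  have [|y [ry cy]] := tableau_box tab (r := 0) (c := cl x); last by exists y; rewrite ry cy !eqxx.
  by apply: leq_trans (bd x) _; apply: nth_part.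
pose top x := xchoose (ex_top x).
have topP x : rw (top x) = 0%N /\ cl (top x) = cl x.
  by have /andP[/eqP-> /eqP->] := xchooseP (ex_top x).
(* [c0] exchanges each box of [A] with the top box of its column; it is an involution because the
   boxes of [A] lie in distinct columns. *)
pose c0 y := if y \in A then top y else odflt y [pick x in A | top x == y].
have cl_c0 y : cl (c0 y) = cl y.
  rewrite /c0; case: ifP => _; first by rewrite (topP y).2.
  by case: pickP => //= x /andP[_ /eqP <-]; rewrite (topP x).2.
have c0K : involutive c0.
  move=> y; rewrite {2}/c0; case: ifP => yA.
    rewrite /c0; case: ifP => tA.
      have e : top y = y by apply: cl_inj => //; rewrite (topP y).2.
      by rewrite !e.
    case: pickP => [x /andP[xA /eqP e]|/(_ y)] /=; last by rewrite yA eqxx.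
    by apply: cl_inj => //; rewrite -(topP x).2 e (topP y).2.
  case: pickP => [x /andP[xA /eqP <-]|H] /=; first by rewrite /c0 xA.
  by rewrite /c0 yA; case: pickP => // x; rewrite H.
pose c := perm (inv_inj c0K).
have cE y : c y = c0 y by rewrite permE.
have rw_c y : y \in A -> rw (c y) = 0%N by rewrite cE /c0 => ->; apply: (topP y).1.
pose l := nth 0%N nu 0.
have lt_cl k : (cl k < s + l)%N.
  by rewrite -nu0; apply: leq_trans (bd k) _; apply: nth_part.
(* The boxes of [A] in columns of height one. At most [nth 0 nu 1 <= m] of the s + m boxes of [A]
   lie in other columns, so at least s remain. *)
pose T := [set x in A | (nth 0%N nu 1 <= cl x)%N].
have leT : (s <= #|T|)%N.
  have : (#|[set x in A | (cl x < nth 0 nu 1)%N]| <= nth 0%N nu 1)%N.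
    case: (nth 0%N nu 1) => [|w].
      by rewrite leqn0 cards_eq0 -subset0; apply/subsetP => x; rewrite inE ltn0 andbF.
    pose g x : 'I_w.+1 := inord (cl x).
    rewrite -(card_in_imset (f := g)).
      by apply: leq_trans (max_card _) _; rewrite card_ord.
    move=> x y; rewrite !inE => /andP[xA cx] /andP[yA cy].
    by move/(congr1 val); rewrite /= !inordK //; apply: cl_inj.
  have -> : T = A :\: [set x in A | (cl x < nth 0 nu 1)%N].
    by apply/setP => x; rewrite !inE; case: (x \in A) => /=; rewrite ?andbF // andbT leqNgt.
  rewrite cardsDS; last by apply/subsetP => x; rewrite inE => /andP[].
  rewrite cardA => le1; have := leq_trans le1 (le_m s_gt0).
  move=> le2; rewrite -{1}(addnK m s); exact: leq_sub2l.
have [T' T'T cardT'] : exists2 T' : {set 'I_(s + N)}, T' \subset T & #|T'| = s.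
  pose T' := [set x in take s (enum T)]; exists T'.
    by apply/subsetP => x; rewrite inE => /mem_take; rewrite mem_enum.
  rewrite cardsE; have /card_uniqP -> : uniq (take s (enum T)) by rewrite take_uniq ?enum_uniq.
  by rewrite size_takel // -cardE.
have T'A : T' \subset A by apply: subset_trans T'T _; apply/subsetP => x; rewrite inE => /andP[].
have [||h hA hT] := @ex_perm_on _ A [set lshift N j | j : 'I_s] T' _ T'A.
  by apply/subsetP => _ /imsetP[j _ ->].
  by rewrite card_imset ?cardT' ?card_ord //; apply: lshift_inj.
have hT' j : h (lshift N j) \in T' by rewrite -hT imset_f // imset_f.
have tab1 : tableau nu' (fun k => rw (c (h k))) (fun k => cl (h k)).
  have := tableau_perm h (tableau_perm c tab); case=> e1 bd1 inj1; split=> // [k|k k' r1 c1].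
    by have := bd1 k; rewrite /= cE cl_c0.
  by apply: inj1; rewrite //= !cE !cl_c0.
have [_ bd1 inj1] := tab1.
pose clo k : 'I_(s + l) := Ordinal (lt_cl k).
pose Z := [set clo (h (lshift N j)) | j : 'I_s].
(* [phi] renumbers the columns of height one so that the s chosen ones come last; removing them
   leaves the shape [nu]. *)
have [|||phi phiD phiZ] := @ex_perm_on _ [set x : 'I_(s + l) | (nth 0 nu 1 <= x)%N] Z
    [set x : 'I_(s + l) | (l <= x)%N].
- apply/subsetP => _ /imsetP[j _ ->]; rewrite inE /=.
  by have := subsetP T'T _ (hT' j); rewrite inE => /andP[].
- apply/subsetP => x; rewrite !inE; apply: leq_trans; exact: nth_part.
- rewrite card_imset; last first.
    move=> j j' /(congr1 val) /= e; apply: (@lshift_inj s N); apply: (@perm_inj _ h).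
    by apply: cl_inj => //; apply: (subsetP T'A).
  pose u (j : 'I_s) : 'I_(s + l) := cast_ord (addnC l s) (rshift l j).
  have u_inj : injective u by move=> j j' /cast_ord_inj/rshift_inj.
  rewrite -(card_imset _ u_inj); apply: eq_card => x; rewrite inE; apply/imsetP/idP.
    by case=> j _ ->; rewrite /= leq_addr.
  move=> lx; have lt : (x - l < s)%N by rewrite ltn_subLR //; apply: leq_trans (ltn_ord x) _; rewrite addnC.
  by exists (Ordinal lt) => //; apply/val_inj; rewrite /= subnKC.
exists c, h, (fun k => val (phi (clo (h k)))); split=> //.
- by move=> k; rewrite cE cl_c0.
- by move=> k k'; rewrite (inj_eq val_inj) (inj_eq perm_inj) -(inj_eq val_inj).
- by move=> j; apply: rw_c; apply: (subsetP T'A).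
split=> // [k|k k' r1 c1].
  have := bd1 (rshift s k); case e: (rw _) => [|r].
    move=> _; rewrite ltnNge; apply/negP => le_l.
    have : phi (clo (h (rshift s k))) \in phi @: Z by rewrite phiZ inE.
    rewrite (mem_imset _ _ perm_inj) => /imsetP[j _ /(congr1 val) /= cj].
    have : rshift s k = lshift N j.
      apply: inj1 => //; rewrite e rw_c //; exact: (subsetP T'A).
    by move/eqP; rewrite eq_sym eq_lrshift.
  rewrite nuS => lt; have fix_phi : phi (clo (h (rshift s k))) = clo (h (rshift s k)).
    apply: (out_perm phiD); rewrite inE -ltnNge /=; apply: leq_trans lt _; exact: nth_part.
  by rewrite fix_phi.
by apply: (@rshift_inj s N); apply: inj1 => //; move/val_inj/perm_inj: c1 => /(congr1 val).
Qed.

End Normalize.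

Section Polytabloids.

Variables (K : fieldType) (n : nat) (V : 'I_n -> vectType K).
Hypothesis char0 : [pchar K] =i pred0.
Variable iota : forall i, nat -> 'I_(\dim {:V i}).

Section OneDegree.

Variable N : 'I_n -> nat.
Local Notation G := (slot_group N).
Local Notation filling := (forall i, 'I_(N i) -> nat).
Implicit Types (rw cl : filling) (g h : G).

Definition mcols cl : {set G} := [set g : G | [forall i, [forall k, cl i (g i k) == cl i k]]].
Definition msign g : K := \prod_i (-1) ^+ (g i).
Definition row_pure rw : tens K N V :=
  pure (fun x : slots N => bvec (iota (tag x) (rw (tag x) (tagged x))) : V (tag x)).

Definition polytab rw cl : tens K N V :=
  \sum_(g in mcols cl) msign g *: row_pure (fun i k => rw i (g i k)).

Lemma mcolsP cl g : reflect (forall i k, cl i (g i k) = cl i k) (g \in mcols cl).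
Proof.
rewrite inE; apply: (iffP forallP) => [H i k|H i]; first by apply/eqP/(forallP (H i)).
by apply/forallP => k; rewrite H.
Qed.

Lemma eq_row_pure rw rw' : (forall i k, rw i k = rw' i k) -> row_pure rw = row_pure rw'.
Proof. by move=> e; apply: eq_pure => x; rewrite e. Qed.

Lemma eq_polytab rw rw' cl cl' : (forall i k, rw i k = rw' i k) ->
  (forall i k k', (cl i k == cl i k') = (cl' i k == cl' i k')) -> polytab rw cl = polytab rw' cl'.
Proof.
move=> er ec; apply: eq_big => [g|g _]; last by rewrite (eq_row_pure (rw' := fun i k => rw' i (g i k))).
by apply/mcolsP/mcolsP => H i k; apply/eqP; move: (H i k) => /eqP; rewrite ec.
Qed.

Lemma msignM g h : msign (g * h)%g = msign g * msign h.
Proof.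
rewrite /msign -big_split /=; apply: eq_bigr => i _.
by rewrite mulg_ffun odd_permM signr_addb.
Qed.

Lemma msign_sqr g : msign g * msign g = 1.
Proof. by rewrite /msign -big_split /= big1 // => i _; rewrite -expr2 sqrr_sign. Qed.

Lemma msignV g : msign g^-1%g = msign g.
Proof. by apply: eq_bigr => i _; rewrite invg_ffun odd_permV. Qed.

Lemma slot_act_row_pure h rw : slot_act V h (row_pure rw) = row_pure (fun i k => rw i ((h i)^-1%g k)).
Proof. by rewrite slot_actE; apply: eq_pure => x; rewrite /slot_perm /slot /= invg_ffun. Qed.

Lemma slot_act_polytab h rw cl : slot_act V h (polytab rw cl) =
  polytab (fun i k => rw i ((h i)^-1%g k)) (fun i k => cl i ((h i)^-1%g k)).
Proof.
rewrite /polytab linear_sum [RHS](reindex_inj (conjg_inj h)) /=.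
apply: eq_big => [g|g _].
  apply/mcolsP/mcolsP => H i k.
    by rewrite conjgE !mulg_ffun invg_ffun !permM permK H.
  have := H i (h i k); rewrite conjgE !mulg_ffun invg_ffun !permM !permK; exact.
rewrite linearZ /= slot_act_row_pure conjgE !msignM msignV mulrCA msign_sqr mulr1.
congr (_ *: _); apply: eq_row_pure => i k.
by rewrite !mulg_ffun invg_ffun !permM permK.
Qed.

Lemma polytab_cols c rw cl : c \in mcols cl ->
  polytab (fun i k => rw i (c i k)) cl = msign c *: polytab rw cl.
Proof.
move=> /mcolsP cC; rewrite /polytab scaler_sumr [RHS](reindex_inj (mulIg c)) /=.
apply: eq_big => [g|g _].
  by apply/mcolsP/mcolsP => H i k; have := H i k; rewrite mulg_ffun permM cC.
rewrite scalerA msignM mulrCA msign_sqr mulr1; congr (_ *: _).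
by apply: eq_row_pure => i k; rewrite mulg_ffun permM.
Qed.

Variable nu : 'I_n -> seq nat.

Definition mtableau rw cl := forall i, tableau (nu i) (rw i) (cl i).

Local Notation f := (fun i (k : 'I_(N i)) => iota i (box_row (nu i) k)).
Local Notation boxr := (fun i (k : 'I_(N i)) => box_row (nu i) k).
Local Notation boxc := (fun i (k : 'I_(N i)) => box_col (nu i) k).

Lemma gcoef_rsum M l (g : 'S_M) : gcoef (rsum K M l) g = (g \in rowg M l)%:R.
Proof.
rewrite gcoef_sum; case: (boolP (g \in _)) => gR.
  rewrite (bigD1 g) //= gcoef_elt eqxx big1 ?addr0 // => h /andP[_ hg].
  by rewrite gcoef_elt eq_sym (negPf hg).
by rewrite big1 // => h hR; rewrite gcoef_elt; case: eqP => // e; rewrite e hR in gR.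
Qed.

Lemma gcoef_csum M l (g : 'S_M) : gcoef (csum K M l) g = (g \in colg M l)%:R * (-1) ^+ g.
Proof.
rewrite gcoef_sum; case: (boolP (g \in _)) => gR.
  rewrite (bigD1 g) //= gcoefZ gcoef_elt eqxx big1 ?addr0 ?mulr1 ?mul1r // => h /andP[_ hg].
  by rewrite gcoefZ gcoef_elt eq_sym (negPf hg) mulr0.
rewrite mul0r big1 // => h hR; rewrite gcoefZ gcoef_elt.
by case: eqP => [e|]; rewrite ?mulr0 //; rewrite e hR in gR.
Qed.

(** The row sum fixes the row tensor up to the order of the row group, and the column sum
    antisymmetrizes it. *)
Lemma rho_myoung_basis :
  exists2 k : K, k != 0 & rho V (myoung K N nu) (basis_tensor f) = k *: polytab boxr boxc.
Proof.
have e : basis_tensor f = row_pure boxr by [].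
pose R := [set g : G | [forall i, g i \in rowg (N i) (nu i)]].
exists (#|R|%:R).
  apply: natr_neq0 => //; apply/card_gt0P; exists 1%g; rewrite inE; apply/forallP => i.
  by rewrite oneg_ffun group1.
have -> : myoung K N nu = gtens (fun i => rsum K (N i) (nu i)) * gtens (fun i => csum K (N i) (nu i)).
  by rewrite gtensM.
rewrite -rhoM_app.
have -> : rho V (gtens (fun i => rsum K (N i) (nu i))) (basis_tensor f) = #|R|%:R *: row_pure boxr.
  rewrite rhoE (bigID (mem R)) /= [X in _ + X]big1 ?addr0 => [|g gR]; last first.
    rewrite gcoef_gtens; under eq_bigr do rewrite gcoef_rsum.
    by rewrite prod_nat_bool; move: gR; rewrite inE => /negPf ->; rewrite scale0r.
  rewrite (eq_bigr (fun=> row_pure boxr)) => [|g gR].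
    by rewrite sumr_const scaler_nat.
  rewrite gcoef_gtens; under eq_bigr do rewrite gcoef_rsum.
  rewrite prod_nat_bool; move: (gR); rewrite inE => gR'; rewrite gR' scale1r.
  rewrite e slot_act_row_pure; apply: eq_row_pure => i k.
  by have /rowgP -> : (g i)^-1%g \in rowg (N i) (nu i) by rewrite groupV (forallP gR').
rewrite linearZ /=; congr (_ *: _); rewrite rhoE (bigID (mem (mcols boxc))) /=.
rewrite [X in _ + X]big1 ?addr0 => [|g gC]; last first.
  rewrite gcoef_gtens; under eq_bigr do rewrite gcoef_csum.
  rewrite big_split /= prod_nat_bool; case: forallP => [H|]; last by rewrite mul0r scale0r.
  by case/negP: gC; apply/mcolsP => i k; apply/colgP.
rewrite /polytab (reindex_inj invg_inj) /=; apply: eq_big => [g|g gC].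
  apply/mcolsP/mcolsP => H i k; last by have := H i ((g^-1)%g i k); rewrite invg_ffun permKV.
  by have := H i (g i k); rewrite invg_ffun permK.
rewrite slot_act_row_pure gcoef_gtens; under eq_bigr do rewrite gcoef_csum.
rewrite big_split /= prod_nat_bool.
have -> : [forall i, (g^-1)%g i \in colg (N i) (nu i)].
  by apply/forallP => i; apply/colgP => k; move/mcolsP: gC; apply.
rewrite mul1r -/(msign _) msignV; congr (_ *: _); apply: eq_row_pure => i k.
by rewrite invg_ffun invgK.
Qed.

(** Any numbering differs from the row by row one by a permutation, and [hw_tens] is stable under
    the group. *)
Lemma polytab_hw rw cl : mtableau rw cl -> polytab rw cl \in hw_tens nu f.
Proof.
move=> tab; have ex i (k : 'I_(N i)) : exists y : 'I_(N i), (box_row (nu i) y == rw i k) && (box_col (nu i) y == cl i k).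
  have [e bd inj] := tab i; have [y [<- <-]] := tableau_box (box_tableau e) (bd k).
  by exists y; rewrite !eqxx.
pose t i k := xchoose (ex i k).
have tP i k : box_row (nu i) (t i k) = rw i k /\ box_col (nu i) (t i k) = cl i k.
  by have /andP[/eqP-> /eqP->] := xchooseP (ex i k).
have t_inj i : injective (t i).
  have [e bd inj] := tab i; move=> k k' ekk; apply: inj.
    by rewrite -(tP i k).1 ekk (tP i k').1.
  by rewrite -(tP i k).2 ekk (tP i k').2.
pose h : G := finfun (fun i => (perm (@t_inj i))^-1%g).
have [k k0 kE] := rho_myoung_basis.
apply/mem_hw_tens; exists (k^-1 *: gelt h).
rewrite -scalerAr rhoZ -rhoM scale_lfunE comp_lfunE kE rho_gelt linearZ /= scalerA mulVf // scale1r.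
rewrite slot_act_polytab; apply: eq_polytab => i.
  by move=> x; rewrite ffunE invgK permE (tP i x).1.
by move=> x y; rewrite !ffunE invgK !permE !(tP i _).2.
Qed.

Lemma hw_span (U : {vspace tens K N V}) : mshape N nu ->
  (forall rw cl, mtableau rw cl -> polytab rw cl \in U) -> (hw_tens nu f <= U)%VS.
Proof.
move=> snu H; apply/subvP => _ /mem_hw_tens[x ->].
have [k k0 kE] := rho_myoung_basis.
rewrite -rhoM_app kE linearZ memvZ //= rhoE memv_suml // => g _; rewrite memvZ // slot_act_polytab.
apply: H => i; exact: (tableau_perm _ (box_tableau (snu i).1)).
Qed.

Section Quotient.

Variables (C : vectType K) (r : 'Hom(tens K N V, C)) (A : forall i, {set 'I_(N i)}).
Hypothesis rA : forall h t, (forall i, perm_on (A i) (h i)) -> r (slot_act V h t) = r t.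

(** The transposition of [x] and [y] does not change the image under [r], but as a column
    transposition it changes the sign of the polytabloid. *)
Lemma polytab_eq0 rw cl i (x y : 'I_(N i)) : x \in A i -> y \in A i -> x != y ->
  cl i x = cl i y -> r (polytab rw cl) = 0.
Proof.
move=> xA yA xy cxy; pose h : G := dfung1 (tperm x y).
have hi : h i = tperm x y by rewrite dfung1_id.
have hj j : j != i -> h j = 1%g by move=> ji; rewrite dfung1_dflt // eq_sym.
have hA j : perm_on (A j) (h j).
  have [->|ji] := eqVneq j i; last by rewrite hj ?perm_on1.
  by rewrite hi; apply/subsetP => z; rewrite inE; case: tpermP => [->|->|] //; rewrite eqxx.
have hC : h \in mcols cl.
  apply/mcolsP => j k; have [ji|ji] := eqVneq j i; last by rewrite hj // perm1.
  by move: k; rewrite ji => k; rewrite hi; case: tpermP => [->|->|] //.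
have sh : msign h = -1.
  rewrite /msign (bigD1 i) //= hi odd_tperm xy expr1 big1 ?mulr1 // => j ji.
  by rewrite hj // odd_perm1.
have hV j : ((h j)^-1)%g = h j.
  have [->|ji] := eqVneq j i; last by rewrite hj // invg1.
  by rewrite hi tpermV.
apply: (eq_oppr0 char0); rewrite -{1}(rA _ hA) slot_act_polytab -linearN; congr (r _).
rewrite -scaleN1r -sh -polytab_cols //; apply: eq_polytab => j.
  by move=> k; rewrite hV.
by move/mcolsP: hC => hC k k'; rewrite !hV !hC.
Qed.

End Quotient.

End OneDegree.

End Polytabloids.

Section KoszulTermRetraction.

Variables (K : fieldType) (n : nat).
Hypothesis char0 : [pchar K] =i pred0.
Variables (N d : 'I_n -> nat) (p : nat) (a : 'I_n -> int).
Hypothesis a_ge0 : forall i, 0 <= a i.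
Variable pos : forall i, ('I_p * 'I_(d i) + 'I_(`|a i|%N))%type -> 'I_(N i).
Hypothesis pos_bij : forall i, bijective (@pos i).
Implicit Types (V W : 'I_n -> vectType K).

Local Notation args V := (forall x : slots N, V (tag x)).

Definition kterm_r V : 'Hom(tens K N V, kterm K d p a V) :=
  (kterm_proj d p a V \o ksplit pos V)%VF.

Definition kterm_j V : 'Hom(kterm K d p a V, tens K N V) :=
  ((ksplit pos V)^-1 \o kterm_sect d p a V)%VF.

Lemma ksplit_natural V W (f : forall i, 'Hom(V i, W i)) :
  (ksplit pos W \o tens_map N f = pre_kterm_map d p a f \o ksplit pos V)%VF.
Proof.
apply: bigtensor_ext => v; rewrite [LHS]comp_lfunE [RHS]comp_lfunE bigtensor_mapE.
rewrite !(ksplitE pos_bij) tensor_mapE tpower_mapE bigtensor_mapE; congr tpure.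
  by apply: eq_pure => j; rewrite bigtensor_mapE; apply: eq_pure => i; rewrite tpower_mapE.
by apply: eq_pure => i; rewrite tpower_mapE.
Qed.

Lemma kterm_r_natural : natural (F := tens K N) (G := kterm K d p a) kterm_r.
Proof.
move=> V W f; rewrite /kterm_r -comp_lfunA [X in (_ \o X)%VF]ksplit_natural comp_lfunA.
by rewrite kterm_proj_natural comp_lfunA.
Qed.

Lemma kterm_rK V t : kterm_r V (kterm_j V t) = t.
Proof.
rewrite /kterm_r /kterm_j !comp_lfunE (ksplit_bij pos_bij V).2 -comp_lfunE.
by rewrite kterm_sectK // id_lfunE.
Qed.

Lemma kterm_j_natural : natural (F := kterm K d p a) (G := tens K N) kterm_j.
Proof.
move=> V W f; apply/lfunP => t; rewrite [LHS]comp_lfunE [RHS]comp_lfunE.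
apply: (can_inj (ksplit_bij pos_bij W).1).
rewrite /kterm_j comp_lfunE (ksplit_bij pos_bij W).2 -[RHS]comp_lfunE ksplit_natural.
rewrite [RHS]comp_lfunE comp_lfunE (ksplit_bij pos_bij V).2 -[LHS]comp_lfunE.
by rewrite kterm_sect_natural // comp_lfunE.
Qed.

Lemma kterm_is_retract : is_retract N (kterm K d p a).
Proof.
exists kterm_j, kterm_r; split; [exact: kterm_j_natural|exact: kterm_r_natural|exact: kterm_rK].
Qed.

Definition wedge_arg V (v : args V) (j : 'I_p) : sections (fun i => (d i)%:Z) V :=
  pure (fun i => coinv_pure (fun=> 1) (fun k : 'I_(d i) => v (slot (pos (inl (j, k)))) : V i)).
Definition coef_arg V (v : args V) : sections a V :=
  pure (fun i => sym_proj (a i) (V i)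
    (ppure (fun k : 'I_(`|a i|%N) => v (slot (pos (inr k))) : V i))).

Lemma kterm_rE V (v : args V) :
  kterm_r V (pure v) = tpure (wedge (wedge_arg v)) (coef_arg v).
Proof.
rewrite /kterm_r comp_lfunE (ksplitE pos_bij) tensor_mapE comp_lfunE tpower_mapE.
rewrite [X in tpure _ X]bigtensor_mapE; congr tpure; congr (quot_pi _ _).
by apply: eq_ppure => j; rewrite [LHS]bigtensor_mapE.
Qed.

Definition coef_set i : {set 'I_(N i)} := [set pos (inr k : 'I_p * 'I_(d i) + _)%type | k : 'I_(`|a i|%N)].

Lemma card_coef_set i : #|coef_set i| = `|a i|%N.
Proof.
rewrite card_imset ?card_ord //; move=> k k' /(bij_inj (pos_bij i)) => -[] //.
Qed.

Lemma sym_proj_perm (k : int) (U : vectType K) (w : 'I_(`|k|%N) -> U) (s : 'I_(`|k|%N) -> 'I_(`|k|%N)) :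
  injective s -> sym_proj k U (ppure (fun i => w (s i))) = sym_proj k U (ppure w).
Proof.
case: k w s => k w s s_inj /=; last by rewrite !zero_lfunE.
exact: symnat_pure_perm.
Qed.

Lemma kterm_r_coef_set V (h : slot_group N) t :
  (forall i, perm_on (coef_set i) (h i)) -> kterm_r V (slot_act V h t) = kterm_r V t.
Proof.
move=> hA; rewrite -comp_lfunE; congr (fun_of_lfun _ t); apply: bigtensor_ext => v.
rewrite comp_lfunE slot_actE !kterm_rE.
have hV i (k : 'I_(N i)) : (h^-1)%g i k = ((h i)^-1)%g k by rewrite invg_ffun.
have hVA i : perm_on (coef_set i) (h i)^-1%g by apply: perm_onV.
have pos_inj i : injective (@pos i) by apply: bij_inj.
congr tpure.
  congr (quot_pi _ _); apply: eq_ppure => j; apply: eq_pure => i.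
  congr (quot_pi _ _); apply: eq_ppure => k; rewrite /slot_perm /slot /= hV.
  rewrite (out_perm (hVA i)) //; apply/imsetP => -[k' _ /pos_inj//].
apply: eq_pure => i.
have ex (k : 'I_(`|a i|%N)) : exists k' : 'I_(`|a i|%N),
    pos (inr k' : 'I_p * 'I_(d i) + _)%type == (h i)^-1%g (pos (inr k)).
  have : (h i)^-1%g (pos (inr k)) \in coef_set i.
    by rewrite (perm_closed _ (hVA i)) imset_f.
  by case/imsetP => k' _ ->; exists k'.
pose s k := xchoose (ex k); have sP k := eqP (xchooseP (ex k)).
have s_inj : injective s.
  move=> k k' e; have := sP k; rewrite -/(s k) e (sP k').
  by move/perm_inj/pos_inj => -[].
rewrite -[RHS](sym_proj_perm _ s_inj); congr (sym_proj _ _ _); apply: eq_ppure => k.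
by rewrite /slot_perm /slot /= hV -sP.
Qed.

Variables (V : 'I_n -> vectType K) (iota : forall i, nat -> 'I_(\dim {:V i})).

(** The number of columns is the length of the first row. With fewer columns than coefficient boxes,
    two of these share a column, and [polytab_eq0] applies. *)
Lemma kterm_hw_eq0 (nu : 'I_n -> seq nat) i : mshape N nu ->
  (nth 0%N (nu i) 0 < `|a i|)%N ->
  hw nu (fun i (k : 'I_(N i)) => iota i (box_row (nu i) k)) kterm_r = 0%VS.
Proof.
move=> snu lt_a; apply/eqP; rewrite -subv0; apply/subvP => _ /memv_imgP[t tU ->].
suff /subvP/(_ t tU) : (hw_tens nu (fun i (k : 'I_(N i)) => iota i (box_row (nu i) k)) <= lker (kterm_r V))%VS.
  by rewrite memv_ker memv0.
apply: hw_span => // rw cl tab; rewrite memv_ker.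
have [sum_i bd inj] := tab i.
have /injectivePn[k [k' kk' ekk']] : ~~ injectiveb (fun k : 'I_(`|a i|%N) =>
    cl i (pos (inr k : 'I_p * 'I_(d i) + _)%type)).
  apply/negP => /injectiveP cl_inj; move: lt_a; rewrite ltnNge => /negP; apply.
  have lt_cl y : (cl i y < nth 0 (nu i) 0)%N.
    by apply: leq_trans (bd y) _; apply: nth_part; case: (snu i).
  rewrite -[X in (X <= _)%N]card_ord -[X in (_ <= X)%N]card_ord.
  apply: (leq_card (fun k : 'I_(`|a i|%N) => Ordinal (lt_cl (pos (inr k : 'I_p * 'I_(d i) + _)%type)))).
  by move=> k k' /(congr1 val) /cl_inj.
apply/eqP; have rA (h : slot_group N) t' : (forall i, perm_on (coef_set i) (h i)) ->
    kterm_r V (slot_act V h t') = kterm_r V t' by exact: kterm_r_coef_set.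
have inA (l : 'I_(`|a i|%N)) : pos (inr l : 'I_p * 'I_(d i) + _)%type \in coef_set i.
  by apply/imsetP; exists l.
apply: (polytab_eq0 char0 _ rA _ (inA k) (inA k')) => //.
by apply: contra kk' => /eqP/(bij_inj (pos_bij i)) [->].
Qed.

End KoszulTermRetraction.

(** * Multiplication by powers of the highest weight vectors *)

Section SymmetricProduct.

Variables (K : fieldType) (V : vectType K).
Hypothesis char0 : [pchar K] =i pred0.

Lemma tpower_perm_coef k (sigma : 'S_k) (x : tpower k V) s :
  tpower_perm V sigma x s = x (finfun (fun i => s (sigma i))).
Proof.
rewrite /tpower_perm linfunE => [|a y z]; first by rewrite ffunE.
by apply/ffunP => t; rewrite !ffunE.
Qed.

Lemma tpower_cat_coef k l m (e : (k + l)%N = m) (x : tpower k V) (y : tpower l V) s :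
  tpower_cat e V (tpure x y) s =
  (x (finfun (fun i => s (cast_ord e (lshift l i)))) : K) *
  y (finfun (fun j => s (cast_ord e (rshift k j)))).
Proof.
rewrite /tpower_cat tensor_liftE ?ffunE //.
- by move=> z a u u'; apply/ffunP => t; rewrite !ffunE mulrDl -mulrA.
- by move=> z a u u'; apply/ffunP => t; rewrite !ffunE mulrDr mulrCA.
Qed.

Lemma symnat_mul_proj k l m (e : (k + l)%N = m) (x : tpower k V) (y : tpower l V) :
  symnat_mul e V (tpure (quot_pi _ x) (quot_pi _ y)) = quot_pi _ (tpower_cat e V (tpure x y)).
Proof.
rewrite -!currylE; move: x.
suff H : forall x, symnat_mul e V (tpure (quot_pi _ x) (quot_pi _ y)) =
    (quot_pi (coinv_rel (fun=> 1) V) \o curryl (tpower_cat e V) y)%VF x.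
  by move=> x; rewrite currylE H comp_lfunE currylE.
move=> x; transitivity ((curryl (symnat_mul e V) (quot_pi _ y) \o quot_pi _)%VF x).
  by rewrite comp_lfunE currylE.
congr (fun_of_lfun _ x); apply: tpower_ext => u; rewrite !comp_lfunE !currylE.
transitivity ((curryr (symnat_mul e V) (quot_pi _ (ppure u)) \o quot_pi _)%VF y).
  by rewrite comp_lfunE curryrE.
transitivity ((quot_pi (coinv_rel (fun=> 1) V) \o curryr (tpower_cat e V) (ppure u))%VF y).
  congr (fun_of_lfun _ y); apply: tpower_ext => v; rewrite !comp_lfunE !curryrE.
  by rewrite symnat_mulE tpower_catE.
by rewrite comp_lfunE curryrE.
Qed.

Lemma symmetric_coef k (t : tpower k V) (u u' : {dffun 'I_k -> 'I_(\dim {:V})}) :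
  (forall s, tpower_perm V s t = t) ->
  (forall v, \sum_r (u' r == v) = \sum_r (u r == v))%N -> t u' = t u.
Proof.
move=> tsym cnt.
have cntE (w : {dffun 'I_k -> 'I_(\dim {:V})}) v : count_mem v [tuple w i | i < k] = (\sum_r (w r == v))%N.
  rewrite -sum1_count big_map big_enum_cond /= big_mkcond /=; apply: eq_bigr => r _.
  by case: ifP.
have /tuple_permP[s us] : perm_eq [tuple u' i | i < k] [tuple u i | i < k].
  by apply/allP => v _ /=; rewrite !cntE cnt.
transitivity (t (finfun (fun i => u (s i)))); last by rewrite -tpower_perm_coef tsym.
rewrite (_ : finfun _ = u') //; apply/ffunP => r; rewrite ffunE; apply/esym.
have := congr1 (fun w => nth (u' r) w r) us.
by rewrite -!tnth_nth !tnth_mktuple.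
Qed.

Lemma coinv_avg_symmetric k (x : tpower k V) s :
  tpower_perm V s (coinv_avg (fun=> 1) V x) = coinv_avg (fun=> 1) V x.
Proof.
rewrite -comp_lfunE; congr (fun_of_lfun _ x); apply: tpower_ext => v.
rewrite comp_lfunE !coinv_avg_pure linearZ linear_sum /=; congr (_ *: _).
rewrite [RHS](reindex_inj (mulIg s)) /=; apply: eq_bigr => t _.
rewrite !scale1r tpower_permE; apply: eq_ppure => i.
by rewrite invMg permM.
Qed.

(** Represent [x] by a symmetric tensor t. If the product vanishes, so does the symmetrization of
    the tensor power times t, and its coefficient at s copies of [j0] followed by [u] is a positive
    multiple of the coefficient of t at [u]. *)
Lemma symnat_mul_inj s k l (e : (s + k)%N = l) (j0 : 'I_(\dim {:V})) (x : symnat k V) :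
  symnat_mul e V (tpure (coinv_pure (fun=> 1) (fun _ : 'I_s => bvec j0)) x) = 0 -> x = 0.
Proof.
case: l / e => e0.
have chiM m (a b : 'S_m) : (1 : K) = 1 * 1 by rewrite mulr1.
pose t := coinv_sect (fun _ : 'S_k => 1) V x.
have xE : x = quot_pi _ t.
  by rewrite /t -[RHS]comp_lfunE coinv_sectK ?id_lfunE //; apply: chiM.
have tsym sg : tpower_perm V sg t = t.
  by rewrite /t -(quot_reprK x) coinv_sectE ?coinv_avg_symmetric //; apply: chiM.
pose b : tpower s V := ppure (fun=> bvec j0).
pose z := tpower_cat (erefl (s + k)%N) V (tpure b t).
have avg0 : coinv_avg (fun=> 1) V z = 0.
  rewrite -(coinv_sectE (chi := fun=> 1)); last exact: chiM.
  by rewrite -symnat_mul_proj -xE e0 linear0.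
have sum0 (tau : {dffun 'I_(s + k) -> 'I_(\dim {:V})}) : \sum_(sg : 'S_(s + k)) (z (finfun (fun i => tau (sg i))) : K) = 0.
  have /eqP : (coinv_avg (fun=> 1) V z) tau = 0 by rewrite avg0 ffunE.
  rewrite /coinv_avg scale_lfunE sum_lfunE ffunE sum_ffunE -[_ *: _]/(_ * _) mulf_eq0 invr_eq0.
  rewrite (negPf (natr_neq0 char0 _)); last by apply/card_gt0P; exists 1%g.
  move=> /eqP H; rewrite -[RHS]H; apply: eq_bigr => sg _.
  by rewrite scale1r tpower_perm_coef.
suff t0 : t = 0 by rewrite xE t0 linear0.
apply/ffunP => u; rewrite [RHS]ffunE.
pose tau : {dffun 'I_(s + k) -> 'I_(\dim {:V})} :=
  finfun (fun i => match split i with inl _ => j0 | inr r => u r end).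
(* Only these permutations contribute. Each contributes the coefficient of [t] at [u], because the
   last k entries are a rearrangement of [u]; the identity is one of them. *)
pose good (sg : 'S_(s + k)) := [forall i : 'I_s, tau (sg (lshift k i)) == j0].
have bE (w : {dffun 'I_s -> 'I_(\dim {:V})}) : (b w : K) = [forall i, w i == j0]%:R.
  by rewrite ffunE -prod_nat_bool; apply: eq_bigr => i _; rewrite bcoord_bvec.
have zE (sg : 'S_(s + k)) : (z (finfun (fun i => tau (sg i))) : K) = (good sg)%:R * t u.
  rewrite /z tpower_cat_coef bE.
  rewrite (_ : [forall i, _] = good sg); last first.
    by apply: eq_forallb => i; rewrite 2!ffunE cast_ord_id.
  case g: (good sg); last by rewrite !mul0r.
  rewrite !mul1r; apply: symmetric_coef => // v.
  have tot : (\sum_i (tau (sg i) == v) = \sum_i (tau i == v))%N.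
    by rewrite [RHS](reindex_inj (@perm_inj _ sg)).
  move: tot; rewrite !big_split_ord /=.
  under eq_bigr => i _ do rewrite (eqP (forallP g i)).
  have tl i : tau (lshift k i) = j0 by rewrite ffunE (unsplitK (inl _)).
  have tr r : tau (rshift s r) = u r by rewrite ffunE (unsplitK (inr _)).
  under [X in _ = (X + _)%N -> _]eq_bigr => i _ do rewrite tl.
  move/addnI => tot; transitivity (\sum_r (tau (rshift s r) == v))%N.
    by rewrite -tot; apply: eq_bigr => r _; rewrite !ffunE cast_ord_id.
  by apply: eq_bigr => r _; rewrite tr.
have := sum0 tau; under eq_bigr => sg _ do rewrite zE.
rewrite -mulr_suml => /eqP; rewrite mulf_eq0 => /orP[|/eqP//].
rewrite -natr_sum (negPf (natr_neq0 char0 _)) //.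
rewrite (bigD1 1%g) //= ltn_addr // (_ : good 1%g) //.
by apply/forallP => i; rewrite perm1 ffunE (unsplitK (inl _)).
Qed.

End SymmetricProduct.

Section SymMul.

Variable K : fieldType.
Hypothesis char0 : [pchar K] =i pred0.
Implicit Types U V : vectType K.

Lemma fcatCA (T : Type) d s k dk sk l (e1 : (s + dk)%N = l) (e2 : (d + k)%N = dk)
    (e3 : (d + sk)%N = l) (e4 : (s + k)%N = sk) (b : 'I_s -> T) (u : 'I_d -> T) (v : 'I_k -> T) :
  exists2 h : 'I_l -> 'I_l, injective h &
    forall i, fcat e3 u (fcat e4 b v) i = fcat e1 b (fcat e2 u v) (h i).
Proof.
pose enc x y z (e : (x + y)%N = z) (t : 'I_x + 'I_y) : 'I_z := cast_ord e (unsplit t).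
pose dec x y z (e : (x + y)%N = z) (i : 'I_z) : 'I_x + 'I_y := split (cast_ord (esym e) i).
have encK x y z (e : (x + y)%N = z) : cancel (enc x y z e) (dec x y z e).
  by move=> t; rewrite /dec /enc cast_ordK unsplitK.
have decK x y z (e : (x + y)%N = z) : cancel (dec x y z e) (enc x y z e).
  by move=> i; rewrite /dec /enc splitK cast_ordKV.
have fcatE x y z (e : (x + y)%N = z) (f : 'I_x -> T) (g : 'I_y -> T) i :
  fcat e f g i = match dec x y z e i with inl j => f j | inr j => g j end by [].
pose h i := match dec _ _ _ e3 i with
  | inl j => enc _ _ _ e1 (inr (enc _ _ _ e2 (inl j)))
  | inr r => match dec _ _ _ e4 r with
     | inl j => enc _ _ _ e1 (inl j)
     | inr q => enc _ _ _ e1 (inr (enc _ _ _ e2 (inr q)))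
     end
  end.
exists h => [i i'|i]; last first.
  rewrite !fcatE /h; case: (dec _ _ _ e3 i) => [j|r]; first by rewrite encK fcatE encK.
  by rewrite fcatE; case: (dec _ _ _ e4 r) => [j|q]; rewrite encK // fcatE encK.
have encI x y z (e : (x + y)%N = z) t t' : enc x y z e t = enc x y z e t' -> t = t' by apply: can_inj (encK x y z e) t t'.
move=> hh; apply: (can_inj (decK _ _ _ e3)); move: hh; rewrite /h.
clear h; clearbody enc dec.
case: (dec _ _ _ e3 i) => [j|r]; case: (dec _ _ _ e3 i') => [j'|r'].
- by move=> /encI [/encI [->]].
- by case: (dec _ _ _ e4 r') => q /encI // [/encI].
- by case: (dec _ _ _ e4 r) => q /encI // [/encI].
move=> H; congr inr; apply: (can_inj (decK _ _ _ e4)); move: H.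
case: (dec _ _ _ e4 r) => q; case: (dec _ _ _ e4 r') => q' /encI //.
  by case=> ->.
by case=> /encI [->].
Qed.

Lemma absz_addn (s : nat) (k l : int) : 0 <= k -> s%:Z + k = l -> `|l|%N = (s + `|k|)%N.
Proof. by case: k => // k _ <-. Qed.

Lemma sym_mul_proj (s : nat) (k l : int) (e : s%:Z + k = l) U (k0 : 0 <= k)
    (E : `|l|%N = (s + `|k|)%N) (b : 'I_s -> U) (w : 'I_(`|k|%N) -> U) :
  sym_mul e U (tpure (coinv_pure (fun=> 1) b) (sym_proj k U (ppure w))) =
  sym_proj l U (ppure (fun x => match split (cast_ord E x) with inl i => b i | inr j => w j end)).
Proof.
case: k l e k0 E w => // k [l|l] // e k0 E w.
rewrite /= symnat_mulE; congr (quot_pi _ _); apply: eq_ppure => x; rewrite /fcat.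
by rewrite (_ : cast_ord _ x = cast_ord E x) //; apply: val_inj.
Qed.

Lemma sym_mul_inj (s : nat) (k l : int) (e : s%:Z + k = l) U (j0 : 'I_(\dim {:U})) : 0 <= k ->
  injective (curryr (sym_mul e U) (coinv_pure (fun=> 1) (fun _ : 'I_s => bvec j0))).
Proof.
case: k l e => // k [l|l] // e _; apply/lker0P; rewrite -subv0; apply/subvP => x.
rewrite memv_ker curryrE memv0 => /eqP /(symnat_mul_inj char0) ->; exact: eqxx.
Qed.

(** The identity b (x y) = x (b y). On pure tensors both sides differ by a permutation of blocks
    ([fcatCA]); linearity is then used in one argument at a time. *)
Lemma sym_mulCA (s d : nat) (a c a' c' : int) (e : d%:Z + a = c) (e' : d%:Z + a' = c')
    (es : s%:Z + a = a') (es' : s%:Z + c = c') U (b : sym s U) (x : sym d U) (y : sym a U) :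
  0 <= a ->
  sym_mul es' U (tpure b (sym_mul e U (tpure x y))) =
  sym_mul e' U (tpure x (sym_mul es U (tpure b y))).
Proof.
case: a c a' c' e e' es es' y => // a [c|//] [a'|//] [c'|//] e e' es es' y _.
rewrite -[b]quot_reprK -[x]quot_reprK -[y]quot_reprK /=.
move: (quot_repr _ b) (quot_repr _ x) (quot_repr _ y) => {}b {}x {}y.
rewrite !symnat_mul_proj; set CS := tpower_cat (PoszD_inj es'); set C := tpower_cat _ _.
pose f b' x' y' := quot_pi (coinv_rel (fun=> 1) U) (tpower_cat (PoszD_inj es') U
   (tpure b' (tpower_cat (PoszD_inj e) U (tpure x' y')))).
pose g b' x' y' := quot_pi (coinv_rel (fun=> 1) U) (tpower_cat (PoszD_inj e') U
   (tpure x' (tpower_cat (PoszD_inj es) U (tpure b' y')))).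
rewrite -[LHS]/(f b x y) -[RHS]/(g b x y).
have fb x' y' : exists F : 'Hom(tpower s U, symnat c' U), forall b', F b' = f b' x' y'.
  exists (quot_pi _ \o curryl (tpower_cat (PoszD_inj es') U) (tpower_cat (PoszD_inj e) U (tpure x' y')))%VF.
  by move=> b'; rewrite comp_lfunE currylE.
have fx b' y' : exists F : 'Hom(tpower d U, symnat c' U), forall x', F x' = f b' x' y'.
  exists (quot_pi _ \o (curryr (tpower_cat (PoszD_inj es') U) b' \o curryl (tpower_cat (PoszD_inj e) U) y'))%VF.
  by move=> x'; rewrite !comp_lfunE curryrE currylE.
have fy b' x' : exists F : 'Hom(tpower a U, symnat c' U), forall y', F y' = f b' x' y'.
  exists (quot_pi _ \o (curryr (tpower_cat (PoszD_inj es') U) b' \o curryr (tpower_cat (PoszD_inj e) U) x'))%VF.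
  by move=> y'; rewrite !comp_lfunE !curryrE.
have gx b' y' : exists F : 'Hom(tpower d U, symnat c' U), forall x', F x' = g b' x' y'.
  exists (quot_pi _ \o curryl (tpower_cat (PoszD_inj e') U) (tpower_cat (PoszD_inj es) U (tpure b' y')))%VF.
  by move=> x'; rewrite comp_lfunE currylE.
have gb x' y' : exists F : 'Hom(tpower s U, symnat c' U), forall b', F b' = g b' x' y'.
  exists (quot_pi _ \o (curryr (tpower_cat (PoszD_inj e') U) x' \o curryl (tpower_cat (PoszD_inj es) U) y'))%VF.
  by move=> b'; rewrite !comp_lfunE curryrE currylE.
have gy b' x' : exists F : 'Hom(tpower a U, symnat c' U), forall y', F y' = g b' x' y'.
  exists (quot_pi _ \o (curryr (tpower_cat (PoszD_inj e') U) x' \o curryr (tpower_cat (PoszD_inj es) U) b'))%VF.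
  by move=> y'; rewrite !comp_lfunE !curryrE.
have pure_fg u v w : f (ppure u) (ppure v) (ppure w) = g (ppure u) (ppure v) (ppure w).
  rewrite /f /g !tpower_catE.
  have [h h_inj hE] := fcatCA (PoszD_inj es') (PoszD_inj e) (PoszD_inj e') (PoszD_inj es) u v w.
  rewrite [RHS](_ : _ = coinv_pure (fun=> 1) (fun i => fcat (PoszD_inj es') u (fcat (PoszD_inj e) v w) (h i))).
    by rewrite symnat_pure_perm.
  by congr (quot_pi _ _); apply: eq_ppure => i; rewrite hE.
have fg1 u v y' : f (ppure u) (ppure v) y' = g (ppure u) (ppure v) y'.
  have [F FE] := fy (ppure u) (ppure v); have [G GE] := gy (ppure u) (ppure v).
  rewrite -FE -GE; congr (fun_of_lfun _ y'); apply: tpower_ext => w; by rewrite FE GE.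
have fg2 u x' y' : f (ppure u) x' y' = g (ppure u) x' y'.
  have [F FE] := fx (ppure u) y'; have [G GE] := gx (ppure u) y'.
  rewrite -FE -GE; congr (fun_of_lfun _ x'); apply: tpower_ext => w; by rewrite FE GE.
have [F FE] := fb x y; have [G GE] := gb x y.
rewrite -FE -GE; congr (fun_of_lfun _ b); apply: tpower_ext => w; by rewrite FE GE.
Qed.

Lemma bigtensor_map_inj (I : finType) (E F : I -> vectType K) (f : forall i, 'Hom(E i, F i)) :
  (forall i, injective (f i)) -> injective (bigtensor_map f).
Proof.
move=> f_inj; apply: (can_inj (g := bigtensor_map (fun i => (f i)^-1)%VF)) => x.
rewrite -comp_lfunE -(bigtensor_map_comp (fun=> erefl)) bigtensor_map_id ?id_lfunE // => i.
by apply: lker0_compVf; apply/lker0P.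
Qed.

Lemma tensor_map_inj (A B C D : vectType K) (f : 'Hom(A, C)) (g : 'Hom(B, D)) :
  injective f -> injective g -> injective (tensor_map f g).
Proof.
move=> /lker0P f0 /lker0P g0; apply: (can_inj (g := tensor_map f^-1 g^-1)%VF) => x.
by rewrite -comp_lfunE -tensor_map_comp !lker0_compVf // tensor_map_id id_lfunE.
Qed.

End SymMul.

Section MulOmega.

Variables (K : fieldType) (n : nat) (V : 'I_n -> vectType K).
Hypothesis char0 : [pchar K] =i pred0.
Variables (s : 'I_n -> nat) (j0 : forall i, 'I_(\dim {:V i})).
Implicit Types (a c : 'I_n -> int).

Definition omega : sections (fun i => (s i)%:Z) V :=
  pure (fun i => coinv_pure (fun=> 1) (fun _ : 'I_(s i) => bvec (j0 i)) : sym (s i)%:Z (V i)).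

Definition mul_omega a c (e : forall i, (s i)%:Z + a i = c i) : 'Hom(sections a V, sections c V) :=
  curryr (sections_mul e V) omega.

Lemma mul_omegaE a c (e : forall i, (s i)%:Z + a i = c i) (v : forall i, sym (a i) (V i)) :
  mul_omega e (pure v) = pure (fun i => sym_mul (e i) (V i)
    (tpure (coinv_pure (fun=> 1) (fun _ : 'I_(s i) => bvec (j0 i))) (v i))).
Proof. by rewrite /mul_omega curryrE; apply: bigtensor_mulE. Qed.

Lemma mul_omega_inj a c (e : forall i, (s i)%:Z + a i = c i) : (forall i, 0 <= a i) ->
  injective (mul_omega e).
Proof.
move=> a0; have -> : mul_omega e = bigtensor_map (fun i => curryr (sym_mul (e i) (V i))
    (coinv_pure (fun=> 1) (fun _ : 'I_(s i) => bvec (j0 i)))).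
  apply: bigtensor_ext => v; rewrite mul_omegaE bigtensor_mapE.
  by apply: eq_pure => i; rewrite curryrE.
by apply: bigtensor_map_inj => i; apply: sym_mul_inj.
Qed.

Lemma mul_omega_sections_mul (d : 'I_n -> nat) a c a' c' (e : forall i, (d i)%:Z + a i = c i)
    (e' : forall i, (d i)%:Z + a' i = c' i) (es : forall i, (s i)%:Z + a i = a' i)
    (es' : forall i, (s i)%:Z + c i = c' i) : (forall i, 0 <= a i) ->
  (mul_omega es' \o sections_mul e V = sections_mul e' V \o tensor_map \1 (mul_omega es))%VF.
Proof.
move=> a0; apply: tensor_ext => x y; rewrite -![fun_of_lfun _ (tpure x y)]currylE; move: x.
apply/lfunP; apply: bigtensor_ext => u; rewrite !currylE -!curryrE; move: y.
apply/lfunP; apply: bigtensor_ext => v; rewrite !curryrE.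
rewrite (comp_lfunE (mul_omega es')) (comp_lfunE (sections_mul e' V)).
rewrite tensor_mapE id_lfunE mul_omegaE.
rewrite (bigtensor_mulE (fun i => sym_mul (e i) (V i))) mul_omegaE.
rewrite (bigtensor_mulE (fun i => sym_mul (e' i) (V i))); apply: eq_pure => i.
by apply: sym_mulCA.
Qed.

End MulOmega.

(** * Highest weight vectors when boxes are added to the first row *)

Fixpoint lift_rshift s N (g : 'S_N) : 'S_(s + N) :=
  match s with 0%N => g | s'.+1 => lift_perm ord0 ord0 (lift_rshift s' g) end.

Lemma lift_rshiftl s N (g : 'S_N) (j : 'I_s) : lift_rshift s g (lshift N j) = lshift N j.
Proof.
elim: s j => [|s IH] j; first by case: j.
case: (unliftP ord0 j) => [j'|] ->.
  rewrite (_ : lshift N (lift ord0 j') = lift ord0 (lshift N j')) ?lift_perm_lift ?IH //.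
  exact: val_inj.
by rewrite (_ : lshift N ord0 = ord0) ?lift_perm_id //; apply: val_inj.
Qed.

Lemma lift_rshiftr s N (g : 'S_N) (k : 'I_N) : lift_rshift s g (rshift s k) = rshift s (g k).
Proof.
elim: s => [|s IH]; first by apply: val_inj => /=; congr (val (g _)); apply: val_inj.
have e k' : rshift s.+1 k' = lift ord0 (rshift s k') :> 'I_((s + N).+1) by apply: val_inj.
by rewrite !e lift_perm_lift IH.
Qed.

Lemma odd_lift_rshift s N (g : 'S_N) : odd_perm (lift_rshift s g) = odd_perm g.
Proof. by elim: s => //= s IH; rewrite odd_lift_perm IH. Qed.

Lemma lift_rshift_inj s N : injective (@lift_rshift s N).
Proof.
by move=> g h e; apply/permP => k; apply: (@rshift_inj s); rewrite -!lift_rshiftr e.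
Qed.

Lemma lift_rshift_onto s N (g : 'S_(s + N)) : (forall j : 'I_s, g (lshift N j) = lshift N j) ->
  exists h, g = lift_rshift s h.
Proof.
move=> gl; have gr k : exists k', g (rshift s k) == rshift s k'.
  case: (split_ordP (g (rshift s k))) => [j e|k' ->]; last by exists k'.
  by move: e; rewrite -(gl j) => /perm_inj/eqP; rewrite eq_rlshift.
pose h k := xchoose (gr k); have hP k : g (rshift s k) = rshift s (h k) := eqP (xchooseP (gr k)).
have h_inj : injective h.
  by move=> k k' e; apply: (@rshift_inj s); apply: (@perm_inj _ g); rewrite !hP e.
exists (perm h_inj); apply/permP => x; case: (split_ordP x) => [j|k] ->.
  by rewrite gl lift_rshiftl.
by rewrite hP lift_rshiftr permE.
Qed.

Section Stability.

Variables (K : fieldType) (n : nat).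
Hypothesis char0 : [pchar K] =i pred0.
Variables (s N d : 'I_n -> nat) (p : nat) (a a' : 'I_n -> int).
Hypothesis a_ge0 : forall i, 0 <= a i.
Hypothesis es : forall i, (s i)%:Z + a i = a' i.
Variable pos : forall i, ('I_p * 'I_(d i) + 'I_(`|a i|%N))%type -> 'I_(N i).
Hypothesis pos_bij : forall i, bijective (@pos i).

(** The s_i new boxes are the first ones and all belong to the coefficient; the old boxes keep their
    roles after a shift. *)
Definition shift_pos i (z : 'I_p * 'I_(d i) + 'I_(`|a' i|%N)) : 'I_(s i + N i) :=
  match z with
  | inl jk => rshift (s i) (pos (inl jk))
  | inr k => match split (cast_ord (absz_addn (a_ge0 i) (es i)) k) with
             | inl j => lshift (N i) j
             | inr k' => rshift (s i) (pos (inr k'))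
             end
  end.

Lemma shift_pos_bij i : bijective (@shift_pos i).
Proof.
have [posV posK posVK] := pos_bij i; pose E := absz_addn (a_ge0 i) (es i).
exists (fun x => match split x with
  | inl j => inr (cast_ord (esym E) (unsplit (inl j)))
  | inr y => match posV y with
             | inl jk => inl jk
             | inr k => inr (cast_ord (esym E) (unsplit (inr k)))
             end
  end).
- case=> [jk|k] /=; first by rewrite (unsplitK (inr _)) posK.
  case: (split_ordP (cast_ord _ k)) => [j|k'] e.
    by rewrite (unsplitK (inl _)) -e cast_ordK.
  by rewrite (unsplitK (inr _)) posK -e cast_ordK.
move=> x; case: (split_ordP x) => [j|y] -> /=; first by rewrite cast_ordKV (unsplitK (inl _)).
case e: (posV y) => [jk|k] /=; first by rewrite -e posVK.
by rewrite cast_ordKV (unsplitK (inr _)) -e posVK.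
Qed.

Lemma mem_coef_set_shift i (j : 'I_(s i)) : lshift (N i) j \in coef_set shift_pos i.
Proof.
apply/imsetP; exists (cast_ord (esym (absz_addn (a_ge0 i) (es i))) (unsplit (inl j))) => //.
by rewrite /= cast_ordKV (unsplitK (inl _)).
Qed.

Variables (V : 'I_n -> vectType K) (iota : forall i, nat -> 'I_(\dim {:V i})).
Local Notation sN := (fun i => s i + N i)%N.
Local Notation r := (kterm_r (a := a) pos V).
Local Notation r' := (kterm_r (a := a') shift_pos V).
Local Notation mu := (tensor_map \1 (mul_omega (fun i => iota i 0%N) es)
  : 'Hom(kterm K d p a V, kterm K d p a' V)).

Lemma shift_row_pure (rw : forall i, 'I_(sN i) -> nat) :
  (forall i j, rw i (lshift (N i) j) = 0%N) ->
  r' (row_pure iota rw) = mu (r (row_pure iota (fun i k => rw i (rshift (s i) k)))).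
Proof.
move=> rw0; rewrite !kterm_rE //; last exact: shift_pos_bij.
rewrite tensor_mapE id_lfunE; congr tpure; rewrite /coef_arg mul_omegaE; apply: eq_pure => i.
rewrite (sym_mul_proj (es i) (a_ge0 i) (absz_addn (a_ge0 i) (es i))); congr (sym_proj _ _ _).
by apply: eq_ppure => k /=; case: (split _) => // j; rewrite rw0.
Qed.

(** The new boxes are alone in their columns, so the column group fixes them and is that of the old
    boxes. As they lie in the first row, their factor is the power of the highest weight vector. *)
Lemma shift_polytab (rw cl : forall i, 'I_(sN i) -> nat) :
  (forall i j, rw i (lshift (N i) j) = 0%N) ->
  (forall i j x, cl i x = cl i (lshift (N i) j) -> x = lshift (N i) j) ->
  r' (polytab iota rw cl) =
  mu (r (polytab iota (fun i k => rw i (rshift (s i) k)) (fun i k => cl i (rshift (s i) k)))).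
Proof.
move=> rw0 cl1; pose L (g : slot_group N) : slot_group sN := finfun (fun i => lift_rshift (s i) (g i)).
have LE g i : L g i = lift_rshift (s i) (g i) by rewrite ffunE.
have L_inj : injective L.
  by move=> g h e; apply/ffunP => i; apply: (@lift_rshift_inj (s i)); rewrite -!LE e.
have -> : polytab iota rw cl = \sum_(g in mcols (fun i k => cl i (rshift (s i) k)))
    msign K g *: row_pure iota (fun i k => rw i (L g i k)).
  rewrite /polytab (_ : mcols cl = [set L g | g in mcols (fun i k => cl i (rshift (s i) k))]).
    rewrite big_imset => [|g h _ _ /L_inj//]; apply: eq_bigr => g _; congr (_ *: _).
    by apply: eq_bigr => i _; rewrite LE odd_lift_rshift.
  apply/setP => g; apply/mcolsP/imsetP => [gC|[h /mcolsP hC ->] i x].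
    have ex i : exists h, g i = lift_rshift (s i) h.
      by apply: lift_rshift_onto => j; apply: cl1; rewrite gC.
    have [h hE] := fin_all_exists ex; exists (finfun h : slot_group N).
      by apply/mcolsP => i k; rewrite ffunE -lift_rshiftr -hE gC.
    by apply/ffunP => i; rewrite LE ffunE.
  rewrite LE; case: (split_ordP x) => [j|k] ->; first by rewrite lift_rshiftl.
  by rewrite lift_rshiftr hC.
rewrite /polytab !linear_sum; apply: eq_bigr => g _; rewrite !linearZ /=; congr (_ *: _).
rewrite shift_row_pure => [|i j]; last by rewrite LE lift_rshiftl.
by congr (mu (r _)); apply: eq_row_pure => i k; rewrite LE lift_rshiftr.
Qed.

Variables nu nu' : 'I_n -> seq nat.
Hypotheses (snu : mshape N nu) (snu' : mshape sN nu').
Hypothesis nu0 : forall i, nth 0%N (nu' i) 0 = (s i + nth 0 (nu i) 0)%N.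
Hypothesis nuS : forall i k, nth 0%N (nu' i) k.+1 = nth 0%N (nu i) k.+1.
Hypothesis le_a : forall i, (0 < s i)%N -> (nth 0 (nu i) 1 <= `|a i|)%N.

(* A polytabloid with two coefficient boxes in one column is killed by r';    *)
(* any other one is brought by [tableau_normalize] to the shape of            *)
(* [shift_polytab].                                                           *)
Lemma hw_shift :
  hw nu' (fun i (k : 'I_(sN i)) => iota i (box_row (nu' i) k)) (kterm_r (a := a') shift_pos) =
  (mu @: hw nu (fun i (k : 'I_(N i)) => iota i (box_row (nu i) k)) (kterm_r (a := a) pos))%VS.
Proof.
have img_sub (A B : vectType K) (g : 'Hom(A, B)) (U : {vspace A}) (T : {vspace B}) :
    (U <= g @^-1: T)%VS -> (g @: U <= T)%VS.
  by move/subvP => UT; apply/subvP => _ /memv_imgP[t tU ->]; rewrite memv_preim; apply: UT.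
apply/eqP; rewrite eqEsubv; apply/andP; split; last first.
  rewrite -limg_comp; apply: img_sub; apply: hw_span => // rw cl tab.
  (* For the inclusion from right to left, append the new boxes as s_i columns of height one at the
     end of the first row. *)
  pose rw1 i (x : 'I_(sN i)) := if split x is inr k then rw i k else 0%N.
  pose cl1 i (x : 'I_(sN i)) := match split x with inr k => cl i k | inl j => (nth 0 (nu i) 0 + j)%N end.
  have rw1l i j : rw1 i (lshift (N i) j) = 0%N by rewrite /rw1 (unsplitK (inl _)).
  have rw1r i k : rw1 i (rshift (s i) k) = rw i k by rewrite /rw1 (unsplitK (inr _)).
  have cl1l i j : cl1 i (lshift (N i) j) = (nth 0 (nu i) 0 + j)%N by rewrite /cl1 (unsplitK (inl _)).
  have cl1r i k : cl1 i (rshift (s i) k) = cl i k by rewrite /cl1 (unsplitK (inr _)).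
  have lt_cl i k : (cl i k < nth 0 (nu i) 0)%N.
    have [_ bd _] := tab i; apply: leq_trans (bd k) _; exact: nth_part (snu i).2 _.
  have cl1_lr i j k : cl1 i (lshift (N i) j) <> cl1 i (rshift (s i) k).
    by rewrite cl1l cl1r => e; have := lt_cl i k; rewrite -e ltnNge leq_addr.
  have cl1_inj i j x : cl1 i x = cl1 i (lshift (N i) j) -> x = lshift (N i) j.
    case: (split_ordP x) => [j'|k] ->; last by move/esym/cl1_lr.
    by rewrite !cl1l => /addnI/val_inj ->.
  rewrite -memv_preim comp_lfunE; set z := (X in X \in _).
  have -> : z = r' (polytab iota rw1 cl1).
    rewrite shift_polytab //; congr (mu (r _)); apply: eq_polytab => // i k k'.
    by rewrite !cl1r.
  apply: memv_img; apply: polytab_hw => // i; have [e bd inj] := tab i; split=> [|x|x y].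
  - exact: (snu' i).1.
  - case: (split_ordP x) => [j|k] ->; first by rewrite rw1l cl1l nu0 addnC ltn_add2r.
    rewrite rw1r cl1r; apply: leq_trans (bd k) _.
    by case: (rw i k) => [|l]; rewrite ?nuS // nu0 leq_addl.
  - case: (split_ordP y) => [j|k] ->; first by move=> _; apply: cl1_inj.
    case: (split_ordP x) => [j'|k'] ->; first by move=> _ /cl1_lr.
    by rewrite !rw1r !cl1r => er ec; congr rshift; apply: inj.
apply: img_sub; apply: hw_span => // rw cl tab; rewrite -memv_preim.
pose A := coef_set shift_pos.
have rA (h : slot_group sN) t : (forall i, perm_on (A i) (h i)) -> r' (slot_act V h t) = r' t.
  by apply: kterm_r_coef_set; apply: shift_pos_bij.
case: (boolP [forall i, forall x in A i, forall y in A i, (cl i x == cl i y) ==> (x == y)]); last first.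
  case/forallPn => i /forall_inPn[x xA /forall_inPn[y yA]]; rewrite negb_imply => /andP[/eqP cxy xy].
  by rewrite (polytab_eq0 char0 _ rA _ xA yA xy cxy) mem0v.
move=> /forallP cl_inj.
have ex i : exists chc : 'S_(sN i) * 'S_(sN i) * ('I_(sN i) -> nat),
  [/\ forall k, cl i (chc.1.1 k) = cl i k, perm_on (A i) chc.1.2,
      forall k k', (chc.2 k == chc.2 k') = (cl i (chc.1.2 k) == cl i (chc.1.2 k')),
      forall j, rw i (chc.1.1 (chc.1.2 (lshift (N i) j))) = 0%N
    & tableau (nu i) (fun k => rw i (chc.1.1 (chc.1.2 (rshift (s i) k)))) (fun k => chc.2 (rshift (s i) k))].
  have [c [h [cl2 H]]] : exists (c h : 'S_(sN i)) (cl2 : 'I_(sN i) -> nat),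
      [/\ forall k, cl i (c k) = cl i k, perm_on (A i) h,
      forall k k', (cl2 k == cl2 k') = (cl i (h k) == cl i (h k')),
      forall j, rw i (c (h (lshift (N i) j))) = 0%N
    & tableau (nu i) (fun k => rw i (c (h (rshift (s i) k)))) (fun k => cl2 (rshift (s i) k))].
    apply: (tableau_normalize (m := `|a i|%N) (snu i).2 (snu' i).2 (snu i).1 (nu0 i) (nuS i) (tab i)).
    - exact: mem_coef_set_shift.
    - by rewrite card_coef_set ?(absz_addn (a_ge0 i) (es i)) //; apply: shift_pos_bij.
    - move=> x y xA yA cxy; apply/eqP; move/forall_inP: (cl_inj i) => /(_ x xA)/forall_inP/(_ y yA).
      by rewrite cxy eqxx.
    - exact: le_a.
  by exists (c, h, cl2).
have [chc chcP] := fin_all_exists ex.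
pose c : slot_group sN := finfun (fun i => (chc i).1.1).
pose h : slot_group sN := finfun (fun i => (chc i).1.2).
pose rw2 i x := rw i (c i (h i x)); pose cl2 i := (chc i).2.
have cC : c \in mcols cl by apply/mcolsP => i k; have [e _ _ _ _] := chcP i; rewrite ffunE e.
have tab2 i : tableau (nu i) (fun k => rw2 i (rshift (s i) k)) (fun k => cl2 i (rshift (s i) k)).
  by have [_ _ _ _ [e bd inj]] := chcP i; split=> [//|k|k k']; rewrite /rw2 !ffunE; [apply: bd|apply: inj].
have -> : r' (polytab iota rw cl) = msign K c *: r' (polytab iota rw2 cl2).
  have -> : polytab iota rw cl = msign K c *: polytab iota (fun i k => rw i (c i k)) cl.
    by rewrite polytab_cols // scalerA msign_sqr scale1r.
  rewrite linearZ /=; congr (_ *: _).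
  rewrite -(rA (h^-1)%g) => [|i]; last first.
    by rewrite invg_ffun; apply: perm_onV; have [_ ? _ _ _] := chcP i; rewrite ffunE.
  rewrite slot_act_polytab; congr (r' _); apply: eq_polytab => i k.
    by rewrite invg_ffun invgK.
  move=> k'; have [_ _ e _ _] := chcP i; rewrite /cl2 e !invg_ffun !invgK ffunE.
  by [].
rewrite memvZ // shift_polytab => [|i j|i j x].
- by apply/memv_img/memv_img; apply: polytab_hw.
- by have [_ _ _ e _] := chcP i; rewrite /rw2 !ffunE e.
have [ec hA e2 e0 _] := chcP i; have [_ _ inj] := tab i.
case: (split_ordP x) => [j'|k] -> /eqP; rewrite /cl2 e2 => /eqP ecl.
  have inA l : (chc i).1.2 (lshift (N i) l) \in A i by rewrite perm_closed ?mem_coef_set_shift.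
  apply: (@perm_inj _ (chc i).1.2); apply/eqP.
  move/forall_inP: (cl_inj i) => /(_ _ (inA j'))/forall_inP/(_ _ (inA j)).
  by rewrite ecl eqxx.
(* An old box sharing a column with a new one would give an old box [y] at the top of that column,
   in the same place as the new box. *)
have [_ bd _] := tab2 i.
have [|y [ry cy]] := tableau_box (tab2 i) (r := 0) (c := cl2 i (rshift (s i) k)).
  by apply: leq_trans (bd k) _; exact: nth_part (snu i).2 _.
have : (chc i).1.1 ((chc i).1.2 (rshift (s i) y)) = (chc i).1.1 ((chc i).1.2 (lshift (N i) j)).
  apply: inj; first by rewrite e0; move: ry; rewrite /rw2 !ffunE.
  by rewrite !ec -ecl; apply/eqP; rewrite -e2 -/(cl2 i) cy.
by move/perm_inj/perm_inj/eqP; rewrite eq_rlshift.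
Qed.

End Stability.

(** * Koszul homology *)

Section KoszulHomologyFunctor.

Variables (K : fieldType) (n : nat) (d : 'I_n -> nat) (q : nat).
Implicit Types (p : nat) (b : 'I_n -> int) (V : 'I_n -> vectType K).

(* For p = 0 every chain is a cycle; the target is then irrelevant.           *)
Definition kpq_target p b : functor K n :=
  if p is p'.+1 then kterm K d p' (twist d b (q%:Z + 1)) else kterm K d 0 (twist d b q).

Definition kpq_delta p b V : 'Hom(kterm K d p (twist d b q) V, kpq_target p b V) :=
  match p return 'Hom(kterm K d p (twist d b q) V, kpq_target p b V) with
  | 0%N => 0
  | p'.+1 => koszul p' (mul_out d q b V)
  end.

Definition kpq_source p b : functor K n := kterm K d p.+1 (twist d b (q%:Z - 1)).

Definition kpq_dd p b V : 'Hom(kpq_source p b V, kterm K d p (twist d b q) V) :=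
  koszul p (mul_in d q b V).

Definition kpq_class p b V : 'Hom(kterm K d p (twist d b q) V, Kpq K d p q b V) :=
  subquot_class (koszul_cycles p (mul_out d q b V)) (limg (koszul p (mul_in d q b V))).

Lemma mem_kpq_cycles p b V (z : kterm K d p (twist d b q) V) :
  (z \in koszul_cycles p (mul_out d q b V)) = (kpq_delta p b V z == 0).
Proof. by case: p z => [|p] z; [rewrite memvf zero_lfunE eqxx|rewrite memv_ker]. Qed.

Lemma kpq_homology_of p b : homology_of (X := kterm K d p (twist d b q)) (H := Kpq K d p q b)
  (@kpq_delta p b) (@kpq_dd p b) (@kpq_class p b).
Proof.
split=> [V h|V z|V V' f z] /=.
- have [z Zz ->] := subquot_class_surj h.
  by exists z => //; apply/eqP; rewrite -mem_kpq_cycles.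
- by move/eqP; rewrite -mem_kpq_cycles => Zz; apply: subquot_class_eq0.
- by move/eqP; rewrite -mem_kpq_cycles => Zz; apply: Kpq_mapE.
Qed.

Lemma kpq_dd_natural p b : natural (F := kpq_source p b) (@kpq_dd p b).
Proof. by move=> V W f; apply/esym; apply: koszul_map; apply: sections_mul_map. Qed.

Lemma kpq_delta_natural p b :
  natural (F := kterm K d p (twist d b q)) (G := kpq_target p b) (@kpq_delta p b).
Proof.
case: p => [|p] V W f; first by rewrite comp_lfun0l comp_lfun0r.
by apply/esym; apply: koszul_map; apply: sections_mul_map.
Qed.

Lemma exists_pos N p (a : 'I_n -> int) : (forall i, N i = p * d i + `|a i|)%N ->
  exists pos : forall i, ('I_p * 'I_(d i) + 'I_(`|a i|%N))%type -> 'I_(N i),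
    forall i, bijective (@pos i).
Proof.
move=> eN; have e i : #|{: 'I_p * 'I_(d i) + 'I_(`|a i|%N)}| = N i.
  by rewrite card_sum card_prod !card_ord.
exists (fun i z => cast_ord (e i) (enum_rank z)) => i.
by exists (fun x => enum_val (cast_ord (esym (e i)) x)) => x; rewrite ?cast_ordK ?enum_rankK ?enum_valK ?cast_ordKV.
Qed.

Lemma twist_shift (s : 'I_n -> nat) b b' k : (forall i, (s i)%:Z + b i = b' i) ->
  forall i, (s i)%:Z + twist d b k i = twist d b' k i.
Proof. by move=> es i; rewrite /twist addrCA es. Qed.

Variables (V : 'I_n -> vectType K) (s : 'I_n -> nat) (j0 : forall i, 'I_(\dim {:V i})).
Hypothesis char0 : [pchar K] =i pred0.

Definition kterm_shift p a a' (es : forall i, (s i)%:Z + a i = a' i) :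
  'Hom(kterm K d p a V, kterm K d p a' V) := tensor_map \1 (mul_omega j0 es).

Lemma kterm_shift_inj p a a' (es : forall i, (s i)%:Z + a i = a' i) : (forall i, 0 <= a i) ->
  injective (kterm_shift p es).
Proof.
move=> a0; apply: tensor_map_inj; first by move=> x y; rewrite !id_lfunE.
exact: mul_omega_inj.
Qed.

Lemma kterm_shift_koszul p a c a' c' (e : forall i, (d i)%:Z + a i = c i)
    (e' : forall i, (d i)%:Z + a' i = c' i) (es : forall i, (s i)%:Z + a i = a' i)
    (es' : forall i, (s i)%:Z + c i = c' i) : (forall i, 0 <= a i) ->
  (kterm_shift p es' \o koszul p (sections_mul e V) =
   koszul p (sections_mul e' V) \o kterm_shift p.+1 es)%VF.
Proof.
move=> a0; have := koszul_map p (mul_omega_sections_mul j0 e e' es es' a0).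
by rewrite /ext_map !coinv_map_id.
Qed.

End KoszulHomologyFunctor.

(** An injective map of complexes identifies cycles with cycles in the image, and likewise for the
    boundaries coming from the transported subspace. *)
Lemma dim_cap_transport (K : fieldType) (X0 Y0 W0 X Y W : vectType K)
    (delta0 : 'Hom(X0, Y0)) (dd0 : 'Hom(W0, X0)) (delta : 'Hom(X, Y)) (dd : 'Hom(W, X))
    (muX : 'Hom(X0, X)) (muY : 'Hom(Y0, Y)) (muW : 'Hom(W0, W)) (HX : {vspace X0}) (HW : {vspace W0}) :
  injective muX -> injective muY -> (delta \o muX = muY \o delta0)%VF ->
  (dd \o muW = muX \o dd0)%VF ->
  let Z0 := (HX :&: lker delta0)%VS in let Z := (muX @: HX :&: lker delta)%VS in
  \dim Z = \dim Z0 /\ \dim (Z :&: (dd @: (muW @: HW))) = \dim (Z0 :&: (dd0 @: HW)).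
Proof.
move=> X_inj Y_inj eY eW /=.
have -> : (muX @: HX :&: lker delta)%VS = (muX @: (HX :&: lker delta0))%VS.
  apply/vspaceP => x; rewrite memv_cap memv_ker; apply/andP/memv_imgP.
    move=> [/memv_imgP[y yH ->]]; rewrite -comp_lfunE eY comp_lfunE => dy.
    exists y => //; rewrite memv_cap yH memv_ker; apply/eqP/Y_inj; rewrite linear0; exact/eqP.
  move=> [y]; rewrite memv_cap memv_ker => /andP[yH /eqP dy] ->; split; first exact: memv_img.
  by rewrite -comp_lfunE eY comp_lfunE dy linear0.
split; first exact: limg_dim_inj.
rewrite -limg_comp eW limg_comp -lker0_img_cap ?limg_dim_inj //.
by apply/lker0P.
Qed.

Lemma kterm_eq0 (K : fieldType) n (d : 'I_n -> nat) p (a : 'I_n -> int) (V : 'I_n -> vectType K) j :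
  a j < 0 -> forall t : kterm K d p a V, t = 0.
Proof.
move=> aj t; suff /eqP e : ({: tensor (ext p (sections (fun i => (d i)%:Z) V)) (sections a V)} == 0)%VS.
  by have := memvf (t : tensor (ext p (sections (fun i => (d i)%:Z) V)) (sections a V)); rewrite e memv0 => /eqP.
rewrite -dimv_eq0; apply/eqP.
rewrite dim_tensor [X in (_ * X)%N](dim_bigtensor (fun i => sym (a i) (V i))) (bigD1 j) //=.
have -> : \dim {: sym (a j) (V j)} = 0%N.
  by case: (a j) aj => // k _; rewrite dimvf dim_matrix.
by rewrite mul0n muln0.
Qed.

Section Stability.

Variables (K : fieldType) (n : nat).
Hypothesis char0 : [pchar K] =i pred0.
Variables (d : 'I_n -> nat) (p q : nat) (c : 'I_n -> nat) (v : 'I_n).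
Hypothesis lt_cd : (c v < d v)%N.

Local Notation b0 := (fun i => (c i)%:Z).
Local Notation N0 := (fun i => (p + q) * d i + c i)%N.

Definition shape_shift (s : 'I_n -> nat) (nu nu' : 'I_n -> seq nat) :=
  [/\ mshape N0 nu, mshape (fun i => s i + N0 i)%N nu',
      forall i, nth 0%N (nu' i) 0 = (s i + nth 0 (nu i) 0)%N,
      forall i k, nth 0%N (nu' i) k.+1 = nth 0%N (nu i) k.+1
    & forall i, (0 < s i)%N -> (nth 0 (nu i) 1 <= c i)%N].

Lemma twist_nat (b : 'I_n -> int) (B : nat) (k : nat) i : b i = B ->
  twist d b k i = (k * d i + B)%N.
Proof. by move=> bi; rewrite /twist bi -PoszM -PoszD. Qed.

Lemma shift_nat (s : 'I_n -> nat) b : (forall i, (s i)%:Z + b0 i = b i) ->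
  forall i, b i = (s i + c i)%N.
Proof. by move=> es i; rewrite -es -PoszD. Qed.

(* For q = 0 the hypothesis [lt_cd] makes the source term vanish.             *)
Lemma source_terms :
  exists HW : forall (nu : 'I_n -> seq nat) (V : 'I_n -> vectType K),
      (forall i, nat -> 'I_(\dim {:V i})) -> {vspace kpq_source K d q p b0 V},
  forall s b (es : forall i, (s i)%:Z + b0 i = b i), s v = 0%N ->
  exists (i : forall V, 'Hom(kpq_source K d q p b V, tens K (fun i => s i + N0 i)%N V))
    (r : forall V, 'Hom(tens K (fun i => s i + N0 i)%N V, kpq_source K d q p b V)),
  [/\ natural i, natural r, forall V t, r V (i V t) = t &
    forall nu nu' (V : 'I_n -> vectType K) (iota : forall i, nat -> 'I_(\dim {:V i})),
    shape_shift s nu nu' ->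
    hw nu' (fun i (k : 'I_(s i + N0 i)) => iota i (box_row (nu' i) k)) r =
      (kterm_shift d (fun i => iota i 0%N) p.+1 (twist_shift d (q%:Z - 1) es) @: HW nu V iota)%VS].
Proof.
have [q0|q_gt0] := posnP q.
  exists (fun _ _ _ => 0%VS) => s b es sv; exists (fun=> 0), (fun=> 0).
  have W0 V (t : kpq_source K d q p b V) : t = 0.
    apply: (kterm_eq0 (j := v)); rewrite q0 /twist sub0r mulN1r (shift_nat es) sv.
    by rewrite addrC Num.Theory.subr_lt0.
  split=> [V W f|V W f|V t|nu nu' V iota _]; rewrite ?comp_lfun0l ?comp_lfun0r //.
    by rewrite [RHS]W0 [LHS]W0.
  apply/eqP; rewrite eqEsubv; apply/andP; split; apply/subvP => t _; rewrite (W0 V t); exact: mem0v.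
have e1 : q%:Z - 1 = q.-1 by rewrite -{1}(prednK q_gt0) -addn1 PoszD addrK.
have a0 i : 0 <= twist d b0 (q%:Z - 1) i by rewrite e1 (twist_nat (B := c i)).
have [|pos pos_bij] := @exists_pos n d N0 p.+1 (twist d b0 (q%:Z - 1)).
  move=> i; rewrite e1 (twist_nat (B := c i)) // absz_nat addnA -mulnDl.
  by rewrite addSnnS prednK.
exists (fun nu V iota => hw nu (fun i (k : 'I_((p + q) * d i + c i)) => iota i (box_row (nu i) k)) (kterm_r (K := K) pos)).
move=> s b es sv.
have a0' i : 0 <= twist d b (q%:Z - 1) i by rewrite e1 (twist_nat _ (shift_nat es i)).
have bij' := shift_pos_bij a0 (twist_shift d (q%:Z - 1) es) pos_bij.
exists (kterm_j (shift_pos a0 (twist_shift d (q%:Z - 1) es) pos)), (kterm_r (shift_pos a0 (twist_shift d (q%:Z - 1) es) pos)).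
split; [exact: kterm_j_natural|exact: kterm_r_natural|exact: kterm_rK|].
move=> nu nu' V iota [snu snu' nu0 nuS le_c]; have le_a i : (0 < s i)%N -> (nth 0 (nu i) 1 <= `|twist d b0 (q%:Z - 1) i|)%N.
  by move=> /le_c le; apply: leq_trans le _; rewrite e1 (twist_nat (B := c i)) // absz_nat leq_addl.
have H := hw_shift char0 a0 (twist_shift d (q%:Z - 1) es) pos_bij iota snu snu' nu0 nuS le_a.
exact: H.
Qed.

End Stability.

Section StableMultiplicity.

Variables (K : fieldType) (n : nat).
Hypothesis char0 : [pchar K] =i pred0.
Variables (d : 'I_n -> nat) (p q : nat) (c : 'I_n -> nat) (v : 'I_n).
Hypothesis lt_cd : (c v < d v)%N.

Local Notation b0 := (fun i => (c i)%:Z).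
Local Notation N0 := (fun i => (p + q) * d i + c i)%N.

(** A basis vector for each row of [nu], and one more, which serves when [nu i] is empty but its
    shift has a first row. *)
Definition row_spaces (nu : 'I_n -> seq nat) (i : 'I_n) : vectType K := 'rV[K]_(size (nu i)).+1.

Lemma dim_row_space m : m.+1 = \dim {: 'rV[K]_m.+1}.
Proof. by rewrite dimvf dim_matrix mul1r. Qed.

Definition row_index nu i (r : nat) : 'I_(\dim {: row_spaces nu i}) :=
  cast_ord (dim_row_space (size (nu i))) (inord r).

Lemma row_index_eq nu i r r' : (r <= size (nu i))%N -> (r' <= size (nu i))%N ->
  (row_index nu i r == row_index nu i r') = (r == r').
Proof. by move=> le_r le_r'; rewrite -!val_eqE /= !inordK. Qed.

Lemma shape_shift_row s nu nu' i (k : 'I_(s i + N0 i)) : shape_shift d p q c s nu nu' ->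
  (box_row (nu' i) k <= size (nu i))%N.
Proof.
move=> [_ snu' _ nuS _]; have [_ bd _] := box_tableau (snu' i).1.
have := bd k; case: (box_row _ _) => // r; rewrite nuS; rewrite ltnNge => /negP H.
by rewrite ltnNge; apply/negP => le_r; apply: H; rewrite nth_default ?leqW.
Qed.

Lemma kpq_target_shift (V : 'I_n -> vectType K) (s : 'I_n -> nat) (j0 : forall i, 'I_(\dim {:V i}))
    b (es : forall i, (s i)%:Z + b0 i = b i) :
  exists2 mu : 'Hom(kpq_target K d q p b0 V, kpq_target K d q p b V), injective mu &
    (kpq_delta d q p b V \o kterm_shift d j0 p (twist_shift d q es) = mu \o kpq_delta d q p b0 V)%VF.
Proof.
have a0 k i : 0 <= twist d b0 k%:Z i by rewrite (twist_nat d _ (B := c i)).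
case: p => [|p'] /=.
  exists (kterm_shift d j0 0 (twist_shift d q es)); first exact: kterm_shift_inj.
  by rewrite comp_lfun0l comp_lfun0r.
have a1 i : 0 <= twist d b0 (q%:Z + 1) i by rewrite -PoszD.
exists (kterm_shift d j0 p' (twist_shift d (q%:Z + 1) es)); first exact: kterm_shift_inj.
by apply/esym/kterm_shift_koszul.
Qed.

Lemma kpq_target_is_retract (s : 'I_n -> nat) b : (forall i, (s i)%:Z + b0 i = b i) ->
  is_retract (fun i => s i + N0 i)%N (kpq_target K d q p b).
Proof.
move=> /shift_nat bE; have a0 k i : 0 <= twist d b k%:Z i by rewrite (twist_nat d _ (bE i)).
have e1 : q%:Z + 1 = q.+1 by rewrite -PoszD addn1.
have : exists pos : forall i, ('I_p.-1 * 'I_(d i) + 'I_(`|twist d b (if p is p'.+1 then q%:Z + 1 else q) i|))%type ->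
    'I_(s i + N0 i), forall i, bijective (@pos i).
  apply: exists_pos => i; rewrite addnCA; case: p => [|p'].
    by rewrite (twist_nat d _ (bE i)).
  by rewrite e1 (twist_nat d _ (bE i)) absz_nat [RHS]addnA -mulnDl addSnnS.
case: p => [|p'] /= [pos pos_bij]; apply: kterm_is_retract pos_bij => //.
by rewrite e1.
Qed.

Lemma kpq_dd_shift (V : 'I_n -> vectType K) (s : 'I_n -> nat) (j0 : forall i, 'I_(\dim {:V i}))
    b (es : forall i, (s i)%:Z + b0 i = b i) :
  (kpq_dd d q p b V \o kterm_shift d j0 p.+1 (twist_shift d (q%:Z - 1) es) =
   kterm_shift d j0 p (twist_shift d q es) \o kpq_dd d q p b0 V)%VF.
Proof.
have [q0|q_gt0] := posnP q.
  apply/lfunP => t; rewrite (_ : t = 0) ?linear0 //.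
  by apply: (kterm_eq0 (j := v)); rewrite q0 /twist sub0r mulN1r addrC Num.Theory.subr_lt0.
apply/esym/kterm_shift_koszul => i.
have -> : q%:Z - 1 = q.-1 by rewrite -{1}(prednK q_gt0) -addn1 PoszD addrK.
by rewrite (twist_nat d _ (B := c i)).
Qed.

(** The multiplicity is defined at s = 0 as the dimension of homology on highest weight vectors;
    multiplication by [omega] transports it to every s. The last clause is the vanishing of the
    highest weight vectors in the middle term. *)
Theorem kpq_stable_multiplicity :
  exists mult : ('I_n -> seq nat) -> nat,
  forall s b, (forall i, (s i)%:Z + b0 i = b i) -> s v = 0%N ->
  let N := (fun i => s i + N0 i)%N in
  exists (i : forall V, 'Hom(Kpq K d p q b V, tens K N V))
    (r : forall V, 'Hom(tens K N V, Kpq K d p q b V)) (eps : galg K (slot_group N)),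
  [/\ retract_of eps i r, eps * eps = eps,
      forall nu nu', shape_shift d p q c s nu nu' ->
        \dim (sandwich (myoung K N nu') eps) = mult nu
    & forall nu j, mshape N nu -> (nth 0 (nu j) 0 < `|twist d b q j|)%N ->
        \dim (sandwich (myoung K N nu) eps) = 0%N].
Proof.
have a0 i : 0 <= twist d b0 q i by rewrite (twist_nat d _ (B := c i)).
have [|posX posX_bij] := @exists_pos n d N0 p (twist d b0 q).
  by move=> i; rewrite (twist_nat d _ (B := c i)) // absz_nat addnA -mulnDl.
have [HW HWP] := source_terms char0 p q lt_cd.
exists (fun nu => let Z0 := (hw nu (fun i (k : 'I_(N0 i)) => row_index nu i (box_row (nu i) k))
     (kterm_r (K := K) posX) :&: lker (kpq_delta d q p b0 (row_spaces nu)))%VS in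
  (\dim Z0 - \dim (Z0 :&: (kpq_dd d q p b0 (row_spaces nu) @: HW nu (row_spaces nu) (row_index nu))))%N).
move=> s b es sv N.
have a0' i : 0 <= twist d b q i by rewrite (twist_nat d _ (shift_nat es i)).
have bij' := shift_pos_bij a0 (twist_shift d q es) posX_bij.
have [iW [rW [niW nrW riW hwW]]] := HWP s b es sv.
have [i [r [eps [epsR eps_idem dimE]]]] := homology_multiplicity char0
  (@kterm_j_natural K n _ _ _ _ _ bij') (@kterm_r_natural K n _ _ _ _ _ bij')
  (@kterm_rK K n char0 _ _ _ _ a0' _ bij')
  niW nrW riW (kpq_target_is_retract es) (@kpq_delta_natural K n d q p b)
  (@kpq_dd_natural K n d q p b) (@kpq_homology_of K n d q p b).
exists i, r, eps; split=> // [nu nu' shp|nu j snu lt_a].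
  rewrite (dimE nu' (row_spaces nu) (fun j (k : 'I_(N j)) => row_index nu j (box_row (nu' j) k))); last first.
    by move=> j k k'; rewrite row_index_eq // (shape_shift_row _ shp).
  rewrite (hwW nu nu' _ (row_index nu) shp).
  have [snu snu' nu0 nuS le_c] := shp.
  have le_a j : (0 < s j)%N -> (nth 0 (nu j) 1 <= `|twist d b0 q j|)%N.
    by move=> /le_c le; apply: leq_trans le _; rewrite (twist_nat d _ (B := c j)) // absz_nat leq_addl.
  have -> := hw_shift char0 a0 (twist_shift d q es) posX_bij (row_index nu) snu snu' nu0 nuS le_a.
  have [muY Y_inj eY] := kpq_target_shift (fun j => row_index nu j 0) es.
  have X_inj : injective (kterm_shift d (fun j => row_index nu j 0) p (twist_shift d q es)).
    exact: kterm_shift_inj.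
  have [e1 e2] := dim_cap_transport
    (hw nu (fun i (k : 'I_(N0 i)) => row_index nu i (box_row (nu i) k)) (kterm_r (K := K) posX))
    (HW nu (row_spaces nu) (row_index nu)) X_inj Y_inj eY
    (kpq_dd_shift (fun j => row_index nu j 0) es).
  by congr (_ - _)%N; [exact: e1|exact: e2].
rewrite (dimE nu (row_spaces nu) (fun j (k : 'I_(N j)) => row_index nu j (box_row (nu j) k))); last first.
  have le_row i' (k : 'I_(N i')) : (box_row (nu i') k <= size (nu i'))%N.
    have [_ bd _] := box_tableau (snu i').1; have lt_k := bd k.
    by rewrite leqNgt; apply/negP => /ltnW le; rewrite nth_default in lt_k.
  by move=> j' k k'; rewrite row_index_eq.
have -> := kterm_hw_eq0 char0 bij' (row_index nu) snu lt_a.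
by rewrite cap0v dimv0.
Qed.

End StableMultiplicity.

(** * Bracket shapes *)

Lemma intpart_sorted (l : intpart) : sorted geq l.
Proof. by case: l => l /= /andP[]. Qed.

Lemma intpart_neq0 (l : intpart) : 0%N \notin (l : seq nat).
Proof. by case: l => l /= /andP[]. Qed.

Definition intparts (M : nat) : seq intpart := pmap insub (flatten [seq parts_of k | k <- iota 0 M.+1]).

Lemma mem_intparts M (l : intpart) : (sumn l <= M)%N -> l \in intparts M.
Proof.
move=> le_M; rewrite mem_pmap_sub; apply/flattenP; exists (parts_of (sumn l)).
  by apply/mapP; exists (sumn l); rewrite // mem_iota.
by rewrite mem_parts_of intpart_sorted intpart_neq0 eqxx.
Qed.

Definition intpart_tuples n (M : nat) : seq (n.-tuple intpart) :=
  [seq [tuple tnth (in_tuple (intparts M)) (g i) | i < n]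
    | g : {ffun 'I_n -> 'I_(size (intparts M))}].

Lemma mem_intpart_tuples n M (l : n.-tuple intpart) : (forall i, sumn (tnth l i) <= M)%N ->
  l \in intpart_tuples n M.
Proof.
move=> le_M; have ex i : exists k, tnth l i = tnth (in_tuple (intparts M)) k.
  by apply/tnthP; apply: mem_intparts.
have [g gE] := fin_all_exists ex; apply/imageP; exists (finfun g) => //.
by apply: eq_from_tnth => i; rewrite tnth_mktuple ffunE.
Qed.

(* The empty partition reappears as the bracket shape [:: 0].                 *)
Lemma young_N0 (K : fieldType) (l m : seq nat) N : N = 0%N -> young K N l = young K N m.
Proof.
move=> -> ; rewrite /young /rsum /csum.
have -> : rowg 0 l = rowg 0 m by apply/setP => s; apply/rowgP/rowgP => _ [].
by have -> : colg 0 l = colg 0 m by apply/setP => s; apply/colgP/colgP => _ [].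
Qed.

Section BracketShapes.

Variables (n r : nat) (N : 'I_n -> nat).

Definition bracket_shape (lambda : n.-tuple intpart) (i : 'I_n) : seq nat :=
  if (i < r)%N then (N i - sumn (tnth lambda i))%N :: tnth lambda i else tnth lambda i.

Definition bracket_ok (P : 'I_n -> nat) (lambda : n.-tuple intpart) :=
  [forall i : 'I_n, if (i < r)%N then (sumn (tnth lambda i) <= P i)%N else sumn (tnth lambda i) == N i].

Lemma bracket_shape_inj lambda lambda' : lambda != lambda' ->
  exists j k, nth 0%N (bracket_shape lambda j) k != nth 0%N (bracket_shape lambda' j) k.
Proof.
move=> neq; have [j neqj] : exists j, tnth lambda j != tnth lambda' j.
  by apply/existsP; rewrite -negb_forall; apply: contra neq => /forallP e; apply/eqP/eq_from_tnth => j; apply/eqP.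
have [k neqk] := part_neq_nth (intpart_neq0 (tnth lambda j)) (intpart_neq0 (tnth lambda' j)) neqj.
by exists j; rewrite /bracket_shape; case: ifP => _; [exists k.+1|exists k].
Qed.

(** Twice the size of lambda^i is at most N_i, so the added first row is at least that size, hence
    at least as long as the first part. *)
Lemma mshape_bracket_shape (P : 'I_n -> nat) lambda :
  (forall i : 'I_n, (i < r)%N -> (2 * P i <= N i)%N) ->
  bracket_ok P lambda -> mshape N (bracket_shape lambda).
Proof.
move=> le_P /forallP ok i; have := ok i; have := le_P i; rewrite /bracket_shape.
case: ifP => [_ /(_ isT) le2 le_sum|_ _ /eqP->]; last by split=> //; apply: intpart_sorted.
have le_N : (sumn (tnth lambda i) + sumn (tnth lambda i) <= N i)%N.
  by apply: leq_trans le2; rewrite mul2n -addnn leq_add.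
split=> /=; first by rewrite subnK // (leq_trans _ le_N) // leq_addl.
have := intpart_sorted (tnth lambda i); move: le_N.
case: (parts (tnth lambda i)) => //= x l le_N ->; rewrite andbT /=.
rewrite leq_subRL; last by apply: leq_trans le_N; rewrite leq_addl.
by apply: leq_trans le_N; rewrite leq_add2l leq_addr.
Qed.

End BracketShapes.

Theorem theorem5p3 (K : fieldType) (charK0 : [pchar K] =i pred0)
    (n r : nat) (lt_r_n : (r < n)%N)
    (d : 'I_n -> nat) (d_gt0 : forall i, (0 < d i)%N)
    (p q : nat) (c : 'I_n -> nat)
    (lt_c_d : exists j : 'I_n, (r <= j)%N /\ (c j < d j)%N) :
  exists (Lambda : seq (n.-tuple intpart)) (m : n.-tuple intpart -> nat),
    uniq Lambda /\
    forall b : 'I_n -> int,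
      (forall i : 'I_n, (r <= i)%N -> b i = (c i)%:Z) ->
      (forall i : 'I_n, (i < r)%N -> ((p + q) * d i)%:Z <= b i) ->
      natural_iso (Kpq K d p q b)
        (bigsum_functor Lambda (fun lambda =>
           copies_functor
             (tensor_functor (fun i : 'I_n =>
                if (i < r)%N
                then schur_bracket K (tnth lambda i) (((p + q) * d i)%:Z + b i)
                else schur K (tnth lambda i)))
             (m lambda))).
Proof.
have [v [le_rv lt_cv]] := lt_c_d.
(* The reference degree: the least admissible b. *)
pose c0 (i : 'I_n) := if (i < r)%N then ((p + q) * d i)%N else c i.
have c0r (i : 'I_n) : (i < r)%N -> c0 i = ((p + q) * d i)%N by rewrite /c0 => ->.
have c0c (i : 'I_n) : (r <= i)%N -> c0 i = c i by rewrite /c0 ltnNge => ->.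
(* [P i] bounds the size of lambda^i: the first row must accommodate the q d_i + b_i coefficient
   boxes, which leaves p d_i of the N_i boxes. *)
pose N0 i := ((p + q) * d i + c0 i)%N; pose P i := (p * d i)%N.
have [|mult multP] := @kpq_stable_multiplicity K n charK0 d p q c0 v; first by rewrite c0c.
pose ok := bracket_ok r N0 P.
pose Lambda := undup [seq l <- intpart_tuples n (\sum_i N0 i) | ok l].
have le_P2 (i : 'I_n) : (i < r)%N -> (2 * P i <= N0 i)%N.
  by move=> ir; rewrite /N0 c0r // mul2n -addnn leq_add // leq_mul2r leq_addr orbT.
have le_P (i : 'I_n) : (P i <= N0 i)%N.
  by apply: leq_trans (leq_addr _ _); rewrite leq_mul2r leq_addr orbT.
have mem_Lambda l : (l \in Lambda) = ok l.
  rewrite mem_undup mem_filter; case ok_l: (ok l) => //=; apply: mem_intpart_tuples => i.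
  apply: (@leq_trans (N0 i)); last by rewrite (bigD1 i) //= leq_addr.
  have /forallP/(_ i) := ok_l; case: ifP => _; last by move/eqP->.
  by move=> le; apply: leq_trans le (le_P i).
exists Lambda, (fun l => mult (bracket_shape r N0 l)); split; first exact: undup_uniq.
move=> b b_c le_b; pose s i := `|b i - (c0 i)%:Z|%N.
have es i : (s i)%:Z + (c0 i)%:Z = b i.
  have [ir|ri] := ltnP i r; last by rewrite /s c0c // b_c // subrr.
  by rewrite /s c0r // gez0_abs ?subrK // Num.Theory.subr_ge0 le_b.
have s0 (i : 'I_n) : (r <= i)%N -> s i = 0%N by move=> ri; rewrite /s c0c // b_c // subrr.
pose N i := (s i + N0 i)%N.
have le_N i : (N0 i <= N i)%N by rewrite leq_addl.
have [i [r' [eps [epsR eps_idem dimE vanish]]]] := multP s b es (s0 v le_rv).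
have ok_N l : ok l = bracket_ok r N P l.
  apply: eq_forallb => j; have [//|rj] := ltnP j r; by rewrite /N s0.
have shape_N l : ok l -> mshape N (bracket_shape r N l).
  rewrite ok_N; apply: mshape_bracket_shape => j jr; exact: leq_trans (le_P2 j jr) (le_N j).
apply: (schur_decomposition charK0 epsR eps_idem (nu := bracket_shape r N)).
- exact: undup_uniq.
- by move=> l; rewrite mem_Lambda; apply: shape_N.
- move=> l j; rewrite mem_Lambda => okl; rewrite /bracket_shape; case: ifP => jr; rewrite ?jr //.
  have /forallP/(_ j) := okl; rewrite jr => le_sum.
  have le_sN : (sumn (tnth l j) <= N j)%N by apply: leq_trans le_sum (leq_trans (le_P j) (le_N j)).
  have eN : ((p + q) * d j)%:Z + b j - (sumn (tnth l j))%:Z = (N j - sumn (tnth l j))%N.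
    by rewrite -subzn // -es -!PoszD /N /N0 addnCA.
  rewrite /schur_bracket eN absz_nat; case: ifP => //; rewrite ltz_nat.
  have [_ /=] := shape_N l okl j; rewrite /bracket_shape jr /=.
  by case: (parts (tnth l j)) => [|x u] //= /andP[xle _]; rewrite ltnNge xle.
- by move=> l l' _ _; apply: bracket_shape_inj.
- move=> mu muP.
  have mu_ok j : [/\ sorted geq (mu j), 0%N \notin mu j & sumn (mu j) = N j].
    by have := muP j; rewrite mem_parts_of => /and3P[? ? /eqP].
  have snu : mshape N mu by move=> j; have [? _ ?] := mu_ok j.
  (* A shape with more than p d_j boxes below its first row has a first row shorter than the
     coefficient degree, and does not occur. *)
  have [/forallP le_mu|] := boolP [forall j : 'I_n, (j < r)%N ==> (sumn (behead (mu j)) <= P j)%N]; last first.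
    case/forallPn=> j; rewrite negb_imply -ltnNge => /andP[jr lt_mu]; right=> x.
    have lt_tw : (nth 0 (mu j) 0 < `|twist d b q j|)%N.
      rewrite (twist_nat d q (shift_nat es j)) absz_nat.
      have [_ _] := mu_ok j; move: lt_mu; case: (mu j) => [|y u] //= lt_u eN.
      rewrite -(ltn_add2r (sumn u)) eN /N /N0 mulnDl -/(P j) (addnC (P j)) -(addnA (q * d j)).
      by rewrite addnCA -addnA ltn_add2l -addnA ltn_add2l addnC ltn_add2l.
    have /eqP := vanish mu j snu lt_tw; rewrite dimv_eq0 => /eqP e0.
    apply/eqP; rewrite -memv0 -e0; apply/sandwichP; by exists x.
  left; have ex (j : 'I_n) : exists l : intpart, (l : seq nat) = (if (j < r)%N then behead (mu j) else mu j).
    have [smu mu0 _] := mu_ok j.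
    have P' : sorted geq (if (j < r)%N then behead (mu j) else mu j) && (0%N \notin (if (j < r)%N then behead (mu j) else mu j)).
      case: ifP => _; last by rewrite smu.
      case: (mu j) smu mu0 => //= y u /path_sorted ->; by rewrite inE negb_or => /andP[].
    by exists (IntPart P').
  have [l lE] := fin_all_exists ex; exists (mktuple l).
    rewrite mem_Lambda; apply/forallP => j; rewrite tnth_mktuple lE.
    have := le_mu j; have [jr|rj] := ltnP j r => //= _.
    by have [_ _ ->] := mu_ok j; rewrite /N s0.
  move=> j; rewrite /bracket_shape tnth_mktuple lE; case: ifP => jr; rewrite ?jr //.
  (* [mu j] is empty only when [N j = 0]; the bracket shape is then [[:: 0]], with the same
     symmetrizer. *)
  have [_ _] := mu_ok j; case: (mu j) => [|y u] /= e; first by apply: young_N0.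
  by congr (young K _ (_ :: _)); rewrite -[RHS]/(N j - sumn u)%N -e addnK.
move=> l; rewrite mem_Lambda => okl; apply/esym; apply: dimE; split.
- exact: mshape_bracket_shape le_P2 okl.
- exact: shape_N.
- move=> j; rewrite /bracket_shape; have [jr|rj] := ltnP j r => /=; last by rewrite s0.
  have /forallP/(_ j) := okl; rewrite jr => le_sum.
  by rewrite addnBA //; apply: leq_trans le_sum (le_P j).
- by move=> j k; rewrite /bracket_shape; case: ifP.
(* The second row of the bracket shape is at most the size of lambda^j, hence at most p d_j <= (p +
   q) d_j = [c0 j]. *)
move=> j; rewrite /bracket_shape; have [jr _|rj] := ltnP j r => /=; last by rewrite s0.
have /forallP/(_ j) := okl; rewrite jr c0r // => le_sum.
apply: (@leq_trans (sumn (tnth l j))).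
  by case: (parts (tnth l j)) => //= x u; rewrite leq_addr.
by apply: leq_trans le_sum _; rewrite leq_mul2r leq_addr orbT.
Qed.
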